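(* Let $A\in\mathbb{R}^{m\times n}$ be an arbitrary matrix, let $k\ge 1$ be an integer, and let $\overline{\Sigma}_k$ be given by the partitioned singular value decomposition of $A$ described in the context. Let $Z=AG\in\mathbb{R}^{m\times\ell}$, where $G\in\mathbb{R}^{n\times\ell}$ is a random matrix whose columns are independent $n$-variate standard Gaussian vectors and $\ell\le\operatorname{rank}(A)$. Then, if $\ell\ge k+2$, $$\mathbb{E}\big[\|[I_m-\Pi(Z)]A\|_F\big]\le\Big(1+\sqrt{\frac{k}{\ell-k-1}}\Big)\|\overline{\Sigma}_k\|_F.$$ Moreover, if $\ell\ge k+4$, then for all real $u,t\ge1$, the inequality $$\|[I_m-\Pi(Z)]A\|_F\le\Big(1+\sqrt3\,ut\cdot\sqrt{\frac{k}{\ell-k+1}}\Big)\|\overline{\Sigma}_k\|_F$$ holds with probability at least $1-e^{-u^2/2}-t^{-(\ell-k)}$.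
   Context: Partitioned SVD: $A=U\Sigma V^{T}$ with $U\in\mathbb{R}^{m\times m}$, $V\in\mathbb{R}^{n\times n}$ orthogonal and $\Sigma\in\mathbb{R}^{m\times n}$ (rectangular) diagonal with diagonal entries the singular values $\sigma_1\ge\dots\ge\sigma_{\min\{m,n\}}\ge 0$; for $k\le\min\{m,n\}$, $\Sigma=\begin{bmatrix}\Sigma_k&\\&\overline{\Sigma}_k\end{bmatrix}$ with $\Sigma_k\in\mathbb{R}^{k\times k}$, $\overline{\Sigma}_k\in\mathbb{R}^{(m-k)\times(n-k)}$. $\|\cdot\|_F$ is the Frobenius norm, and $\Pi(M)=MM^{\dagger}$ ($M^\dagger$ the Moore-Penrose inverse) is the orthogonal projection onto the column space of $M$. $I_m$ is the $m\times m$ identity. *)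

(* Defs.v *)
From HB Require Import structures.
From mathcomp Require Import all_boot all_order all_algebra.
From mathcomp Require Import all_classical all_reals all_analysis.

Set Implicit Arguments.
Unset Strict Implicit.
Unset Printing Implicit Defensive.

Import Order.TTheory GRing.Theory Num.Theory.
Import numFieldNormedType.Exports.

Local Open Scope classical_set_scope.
Local Open Scope ring_scope.

Section MatrixNotions.
Context {R : realType}.

Definition frobenius_norm m n (M : 'M[R]_(m, n)) : R :=
  Num.sqrt (\sum_(i < m) \sum_(j < n) M i j ^+ 2).

Record penrose m n (M : 'M[R]_(m, n)) (X : 'M[R]_(n, m)) : Prop := Penrose {
  penrose_MXM : M *m X *m M = M;
  penrose_XMX : X *m M *m X = X;
  penrose_MX_sym : (M *m X)^T = M *m X;
  penrose_XM_sym : (X *m M)^T = X *m M }.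

(* The default value 0 of xget is never used: see [mpinvP]; uniqueness is
   [penrose_unique]. *)
Definition mpinv m n (M : 'M[R]_(m, n)) : 'M[R]_(n, m) :=
  xget 0 [set X | penrose M X].

Definition col_proj m n (M : 'M[R]_(m, n)) : 'M[R]_m := M *m mpinv M.

Definition orthogonal_mx n (U : 'M[R]_n) : Prop := U^T *m U = 1%:M.

Record is_svd m n (A : 'M[R]_(m, n)) (U : 'M[R]_m) (S : 'M[R]_(m, n))
    (V : 'M[R]_n) : Prop := IsSVD {
  svd_left : orthogonal_mx U;
  svd_right : orthogonal_mx V;
  svd_diag : is_diag_mx S;
  svd_ge0 : forall (i : 'I_m) (j : 'I_n), i = j :> nat -> 0 <= S i j;
  svd_noninc : forall (i i' : 'I_m) (j j' : 'I_n),
    i = j :> nat -> i' = j' :> nat -> (i <= i')%N -> S i' j' <= S i j;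
  svd_eq : A = U *m S *m V^T }.

Fact tail_ord_subproof n k (i : 'I_(n - k)) : (k + i < n)%N.
Proof. by rewrite -ltn_subRL. Qed.

Definition tail_ord n k (i : 'I_(n - k)) : 'I_n :=
  Ordinal (tail_ord_subproof i).

(* Lower-right block left after deleting the first k rows and k columns
   (empty as soon as k >= minn m n, the subtractions being truncated). *)
Definition trailing_block k m n (S : 'M[R]_(m, n)) : 'M[R]_(m - k, n - k) :=
  mxsub (@tail_ord m k) (@tail_ord n k) S.

Lemma gram_unitmx m n (X : 'M[R]_(m, n)) :
  row_free X -> X *m X^T \in unitmx.
Proof.
move=> fX; rewrite -row_free_unit; apply: inj_row_free => v vXX0.
suff: v *m X = 0 by move/eqP; rewrite mulmx_free_eq0// => /eqP.
have: (v *m X) *m (v *m X)^T = 0 by rewrite trmx_mul mulmxA -(mulmxA v) vXX0 mul0mx.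
move=> /matrixP/(_ 0 0); rewrite !mxE => /eqP.
rewrite psumr_eq0 => [/allP vX0|j _]; last by rewrite [X in _ * X]mxE -expr2 sqr_ge0.
apply/rowP => j; have := vX0 j (mem_index_enum _).
by rewrite implyTb [X in _ * X]mxE mulf_eq0 orbb => /eqP ->; rewrite mxE.
Qed.

Lemma penrose_unique m n (M : 'M[R]_(m, n)) X Y :
  penrose M X -> penrose M Y -> X = Y.
Proof.
move=> [MX XX sMX sXM] [MY YY sMY sYM].
transitivity (X *m (M *m Y)).
  rewrite -[LHS]XX -[in LHS](mulmxA X) -[in LHS]MY -!(mulmxA (M *m Y)).
  rewrite -{1}sMX -{1}sMY -trmx_mul; congr (_ *m _).
  by rewrite mulmxA MX sMY.
rewrite -[RHS]YY mulmxA -[in RHS]MX -(mulmxA M X M) (mulmxA Y M) -sYM -sXM.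
by rewrite -trmx_mul -(mulmxA X M) (mulmxA M Y) MY sXM.
Qed.

Lemma penrose_exists m n (M : 'M[R]_(m, n)) : exists X, penrose M X.
Proof.
have [r [C [B [fC fB CB]]]] : exists r (C : 'M[R]_(m, r)) (B : 'M[R]_(r, n)),
    [/\ row_full C, row_free B & C *m B = M].
  exists (\rank M), (col_base M), (row_base M); split.
  - exact: col_base_full.
  - exact: row_base_free.
  - exact: mulmx_base.
pose K := B *m B^T; pose L := C^T *m C.
have uK : K \in unitmx by exact: gram_unitmx.
have uL : L \in unitmx.
  rewrite /L -[X in _ *m X]trmxK; apply: gram_unitmx.
  by rewrite /row_free mxrank_tr.
have sK : K^T = K by rewrite /K trmx_mul trmxK.
have sL : L^T = L by rewrite /L trmx_mul trmxK.
pose X := B^T *m invmx K *m (invmx L *m C^T).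
have MX : M *m X = C *m invmx L *m C^T.
  by rewrite -CB /X !mulmxA -(mulmxA C B) mulmxK.
have XM : X *m M = B^T *m invmx K *m B.
  by rewrite -CB /X !mulmxA -(mulmxA _ C^T C) mulmxKV.
exists X; split.
- by rewrite MX -CB mulmxA -(mulmxA _ C^T C) mulmxKV.
- by rewrite XM /X !mulmxA -(mulmxA _ B B^T) mulmxKV.
- by rewrite MX !trmx_mul trmxK trmx_inv sL mulmxA.
- by rewrite XM !trmx_mul trmxK trmx_inv sK mulmxA.
Qed.

Lemma mpinvP m n (M : 'M[R]_(m, n)) : penrose M (mpinv M).
Proof. by have [X MX] := penrose_exists M; exact: (xgetPex 0 (ex_intro _ X MX)). Qed.

End MatrixNotions.

Section GaussianMatrix.
Context {d : measure_display} {T : measurableType d} {R : realType}.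
Variable P : probability T R.

Definition mutually_independent (I : finType) d' (T' : measurableType d')
    (X : I -> T -> T') : Prop :=
  forall (J : {set I}) (B : I -> set T'), (forall i, measurable (B i)) ->
    P (\bigcap_(i in [set` J]) (X i @^-1` B i)) =
    (\prod_(i in J) P (X i @^-1` B i))%E.

Record std_gaussian (X : T -> R) : Prop := StdGaussian {
  std_gaussian_meas : measurable_fun [set: T] X;
  std_gaussian_law : forall B : set R, measurable B ->
    P (X @^-1` B) = normal_prob 0 1 B }.

Record std_gaussian_vector n (X : T -> n.-tuple R) : Prop :=
  StdGaussianVector {
  std_gaussian_coord : forall i, std_gaussian (fun w => tnth (X w) i);
  std_gaussian_indep : mutually_independent (fun i w => tnth (X w) i) }.

(* Columns are handled as tuples because n.-tuple R, unlike 'cV[R]_n, carries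
   the product sigma-algebra. *)
Definition col_tuple m n (M : 'M[R]_(m, n)) (j : 'I_n) : m.-tuple R :=
  [tuple M i j | i < m].

Record std_gaussian_mx m n (G : T -> 'M[R]_(m, n)) : Prop := StdGaussianMx {
  std_gaussian_mx_col : forall j,
    std_gaussian_vector (fun w => col_tuple (G w) j);
  std_gaussian_mx_indep :
    mutually_independent (fun j w => col_tuple (G w) j) }.

End GaussianMatrix.

(* Main.v *)
(* With [W = V^T G], again Gaussian by rotation invariance, split after its first [k]
   rows into [W1], [W2], the squared error is almost surely at most
   [tau ^+ 2 + \sum_(j > k) s_j ^+ 2 \sum_(i <= k) T_ji ^+ 2], where
   [T = W2 *m right_inv W1] and [tau] is the tail of the singular values. Given [W1],
   [T_ji] is a centered Gaussian whose standard deviation is the norm of a column of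
   [right_inv W1], i.e. the inverse of the norm of a standard Gaussian vector of
   dimension [l - k + 1]. Hence [E |T_ji| ^ b <= m_b * m_(l-k-b) / m_(l-k)] for
   [0 < b <= l - k], with [m_b] the absolute moments of the standard Gaussian. Only
   these marginal moments are needed: the case [b = 2] and AM-GM bound the expectation;
   for the tail bound, Jensen's inequality dominates the [b]-th power of the weighted
   quadratic mean of the [T_ji] by the weighted mean of the [|T_ji| ^ b], and Markov's
   inequality with a well-chosen [b] concludes, without concentration of measure. *)

(* The squared excess is kept as a weighted sum of the [T_ji ^+ 2] instead of being bounded through
   norms of [right_inv W1], so the expectation acts entry by entry and dependence between entries
   does no harm. Conditioning on [W1] is an iterated integral over the reference laws [gauss_mx];
   all integrands are nonnegative, so Tonelli applies with no integrability known beforehand.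
   Rotation invariance is built from plane rotations, which need only one-variable substitutions.
   The constant [sqrt 3] comes from the choice of [b]: at the threshold [Y] with
   [Y ^ 2 = 3 u^2 t^2 / (l - k + 1)], the even order [b = 2 q] with [q] the integer part of
   [u^2 / 2] makes the Markov ratio at most [4 ^- q], which is below [exp (- u^2 / 2)] as soon as
   [q >= 3]; smaller [u] are treated by orders 2 and 4. Once [u^2] exceeds [(l - k + 1) / 3] such
   orders are too large, but then [Y >= t] and the top order [b = l - k] yields [t ^- (l - k)].
   Hence the two terms of the failure probability. *)
From HB Require Import structures.
Require Import Defs.
From mathcomp Require Import all_boot all_order all_algebra perm.
From mathcomp Require Import all_classical all_reals all_analysis.
From mathcomp Require Import measurable_realfun.
From mathcomp Require Import ring lra zify.

Set Implicit Arguments.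
Unset Strict Implicit.
Unset Printing Implicit Defensive.

Import Order.TTheory GRing.Theory Num.Theory.
Import numFieldNormedType.Exports.
Local Open Scope classical_set_scope.
Local Open Scope ring_scope.

(** * One-dimensional Gaussian moments *)

Definition image_measure d d' (T1 : measurableType d) (T2 : measurableType d')
    (R : realType) (mu : {measure set T1 -> \bar R}) (f : T1 -> T2)
    (mf : measurable_fun [set: T1] f) : {measure set T2 -> \bar R} :=
  measure_function_pushforward__canonical__measure_function_Measure mu mf.

Lemma ge0_integral_image_measure d d' (T1 : measurableType d)
    (T2 : measurableType d') (R : realType) (mu : {measure set T1 -> \bar R})
    (f : T1 -> T2) (mf : measurable_fun [set: T1] f) (F : T2 -> \bar R) :
  measurable_fun [set: T2] F -> (forall x, (0 <= F x)%E) ->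
  (\int[image_measure mu mf]_x F x = \int[mu]_x F (f x))%E.
Proof.
by move=> mF F0; rewrite (ge0_integral_pushforward mf)// preimage_setT.
Qed.

Section LineIntegrals.
Context {R : realType}.
Local Notation mu := (@lebesgue_measure R).
Local Open Scope ereal_scope.

(** Lebesgue measure is determined by its values on half-open intervals, and the pushforward along
    [a * x + b], scaled by [|a|], takes the same values; a negative [a] reverses the interval, so
    its closed end changes side. *)
Lemma ge0_integral_affine (a b : R) (f : R -> \bar R) : a != 0%R ->
  measurable_fun [set: R] f -> (forall x, 0 <= f x) ->
  \int[mu]_x f (a * x + b)%R = (`|a|^-1)%:E * \int[mu]_x f x.
Proof.
move=> a0 mf f0.
pose g := (fun x : R => a * x + b)%R : R -> measurableTypeR R.
have mg : measurable_fun [set: R] g.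
  by apply: measurable_funD => //; apply: measurable_funM.
have na0 : (0 < `|a|)%R by rewrite normr_gt0.
pose nu := mscale (NngNum (ltW na0)) (image_measure mu mg).
have nuE A : measurable A -> mu A = nu A.
  apply: lebesgue_measure_unique => _ [[p q]] _ <-.
  rewrite [RHS](_ : _ = `|a|%:E * mu (g @^-1` `]p, q]))//.
  have [a_gt0|a_le0] := ltP 0%R a.
    have -> : g @^-1` `]p, q] = `]((p - b) / a)%R, ((q - b) / a)%R]%classic.
      apply/seteqP; split => x /=; rewrite /g !in_itv/=;
        by rewrite ltr_pdivrMr// ler_pdivlMr// ltrBlDr lerBrDr [(x * a)%R]mulrC.
    rewrite !lebesgue_measure_itv/= !lte_fin ltr_pM2r ?invr_gt0// ltrD2r.
    case: ifP => _; last by rewrite mule0.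
    rewrite -!EFinD -EFinM gtr0_norm//; congr EFin.
    by field; rewrite gt_eqF.
  have a_lt0 : (a < 0)%R by rewrite lt_neqAle a0.
  have -> : g @^-1` `]p, q] = `[((q - b) / a)%R, ((p - b) / a)%R[%classic.
    apply/seteqP; split => x /=; rewrite /g !in_itv/=;
      rewrite ler_ndivrMr// ltr_ndivlMr// ltrBlDr lerBrDr [(x * a)%R]mulrC;
      by rewrite andbC.
  rewrite !lebesgue_measure_itv/= !lte_fin ltr_nM2r ?invr_lt0// ltrD2r.
  case: ifP => _; last by rewrite mule0.
  rewrite -!EFinD -EFinM ltr0_norm//; congr EFin.
  by field; rewrite lt_eqF.
rewrite (@eq_measure_integral _ _ _ setT nu mu f)//.
  rewrite ge0_integral_mscale// ge0_integral_image_measure//= muleA -EFinM.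
  by rewrite mulVf ?gt_eqF// mul1e.
by move=> A mA _; exact: nuE.
Qed.

Lemma ge0_integral_scale (a : R) (f : R -> \bar R) : a != 0%R ->
  measurable_fun [set: R] f -> (forall x, 0 <= f x) ->
  \int[mu]_x f (a * x)%R = (`|a|^-1)%:E * \int[mu]_x f x.
Proof.
move=> a0 mf f0; rewrite -(@ge0_integral_affine a 0%R f)//.
by apply: eq_integral => x _; rewrite addr0.
Qed.

End LineIntegrals.

Section Density.
Local Open Scope ereal_scope.
Context d (T : measurableType d) (R : realType).
Variables (mu nu : {measure set T -> \bar R}) (g : T -> R).
Hypotheses (mg : measurable_fun [set: T] g) (g0 : forall x, (0 <= g x)%R).
Hypothesis nuE : forall A, measurable A -> nu A = \int[mu]_(x in A) (g x)%:E.

Import HBNNSimple.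

(** Both sides are monotone limits over simple functions, for which the identity reduces to [nuE] on
    level sets. *)
Lemma ge0_integral_density (f : T -> \bar R) :
  measurable_fun [set: T] f -> (forall x, 0 <= f x) ->
  \int[nu]_x f x = \int[mu]_x (f x * (g x)%:E).
Proof.
move=> mf f0; pose f_ := nnsfun_approx measurableT mf.
transitivity (limn (fun n => \int[nu]_x (f_ n x)%:E)).
  rewrite -monotone_convergence//.
  - by apply: eq_integral => y _; apply/esym/cvg_lim => //;
      apply: cvg_nnsfun_approx.
  - by move=> n; exact/measurable_EFinP/measurable_funP.
  - by move=> n y _; rewrite lee_fin.
  - by move=> y _ m n mn; rewrite lee_fin; exact/lefP/nd_nnsfun_approx.
have -> : \int[mu]_x (f x * (g x)%:E) =
    limn (fun n => \int[mu]_x ((f_ n x)%:E * (g x)%:E)).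
  rewrite -monotone_convergence//.
  - apply: eq_integral => y _; apply/esym/cvg_lim => //.
    apply: cvgeZr => //; exact: cvg_nnsfun_approx.
  - move=> n; apply: emeasurable_funM; last exact/measurable_EFinP.
    exact/measurable_EFinP/measurable_funP.
  - by move=> n y _; rewrite mule_ge0// lee_fin.
  - move=> y _ m n mn; rewrite lee_wpmul2r ?lee_fin//.
    exact/lefP/nd_nnsfun_approx.
congr (limn _); apply/funext => n.
under eq_integral do rewrite fimfunE -fsumEFin//.
rewrite ge0_integral_fsum//; last 2 first.
- by move=> y; exact/measurable_EFinP/measurable_funM.
- by move=> y x _; rewrite nnfun_muleindic_ge0.
under [RHS]eq_integral.
  move=> x _; rewrite fimfunE -fsumEFin// ge0_mule_fsuml; last first.
    by move=> r; rewrite nnfun_muleindic_ge0.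
  over.
rewrite [RHS]ge0_integral_fsum//; last 2 first.
- move=> r; apply: emeasurable_funM; last exact/measurable_EFinP.
  exact/measurable_EFinP/measurable_funM.
- move=> r x _; rewrite mule_ge0 ?lee_fin//.
  by have := nnfun_muleindic_ge0 (f_ n) r x; rewrite -EFinM lee_fin.
apply: eq_fsbigr => r _.
(* A nonnegative simple function has empty level sets at negative values; the sign of [r] must be
   known before the constant can leave the integral. *)
have [r0|r0] := ltP r 0%R.
  rewrite preimage_nnfun0//; apply: (@etrans _ _ 0).
    by rewrite integral0_eq// => x _; rewrite indic0 mulr0.
  by rewrite integral0_eq// => x _; rewrite indic0 mulr0 mul0e.
under [LHS]eq_integral do rewrite EFinM.
rewrite ge0_integralZl//; last exact/measurable_EFinP/measurable_indic.
rewrite integral_indic// setIT nuE//.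
under [RHS]eq_integral do rewrite EFinM -muleA.
rewrite ge0_integralZl//; last 2 first.
- apply: emeasurable_funM; last exact/measurable_EFinP.
  exact/measurable_EFinP/measurable_indic.
- by move=> x _; rewrite mule_ge0 ?lee_fin.
congr (_ * _).
rewrite integral_mkcond; apply: eq_integral => x _.
rewrite patchE indicE; case: ifPn => _ /=; first by rewrite mul1e.
by rewrite mul0e.
Qed.

End Density.

Section StandardGaussian.
Context {R : realType}.
Local Notation mu := (@lebesgue_measure R).
Local Notation gauss := (@normal_prob R 0 1).
Implicit Types f : R -> \bar R.

Definition gauss_density (x : R) : R := normal_peak 1 * expR (- (x ^+ 2 / 2)).

Lemma gauss_densityE : gauss_density = normal_pdf 0 1.
Proof.
apply/funext => x; rewrite normal_pdfE ?oner_eq0// /gauss_density /normal_fun.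
by rewrite subr0 expr1n mulNr.
Qed.

Lemma gauss_density_ge0 x : 0 <= gauss_density x.
Proof. by rewrite gauss_densityE normal_pdf_ge0. Qed.

Lemma measurable_gauss_density : measurable_fun [set: R] gauss_density.
Proof. by rewrite gauss_densityE; exact: measurable_normal_pdf. Qed.

Lemma gauss_density_rot (c s x y : R) : c ^+ 2 + s ^+ 2 = 1 ->
  gauss_density (c * x - s * y) * gauss_density (s * x + c * y) =
  gauss_density x * gauss_density y.
Proof.
move=> cs; rewrite /gauss_density; set p := normal_peak 1.
rewrite [LHS]mulrACA [RHS]mulrACA -!expRD; congr (_ * expR _).
rewrite -!opprD -!mulrDl; congr (- (_ / _)).
transitivity ((c ^+ 2 + s ^+ 2) * (x ^+ 2 + y ^+ 2)); first by ring.
by rewrite cs mul1r.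
Qed.

Lemma ge0_integral_gauss f : measurable_fun [set: R] f ->
  (forall x, 0 <= f x)%E ->
  (\int[gauss]_x f x = \int[mu]_x (f x * (gauss_density x)%:E))%E.
Proof.
move=> mf f0; apply: ge0_integral_density => //.
- exact: measurable_gauss_density.
- exact: gauss_density_ge0.
- by move=> A mA; rewrite gauss_densityE.
Qed.

Definition gauss_moment (b : nat) : \bar R := \int[gauss]_x (`|x| ^+ b)%:E.

Lemma measurable_normX (b : nat) : measurable_fun [set: R] (fun x => `|x| ^+ b).
Proof. by apply: measurable_funX; exact: normr_measurable. Qed.

Lemma gauss_momentE b :
  gauss_moment b = (\int[mu]_x (`|x| ^+ b * gauss_density x)%:E)%E.
Proof.
rewrite /gauss_moment ge0_integral_gauss//.
  by apply/measurable_EFinP; exact: measurable_normX.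
Qed.

Lemma gauss_moment_ge0 b : (0 <= gauss_moment b)%E.
Proof. by apply: integral_ge0 => x _; rewrite lee_fin exprn_ge0. Qed.

Lemma gauss_moment0 : gauss_moment 0 = 1%E.
Proof.
rewrite /gauss_moment; under eq_integral do rewrite expr0.
rewrite integral_cst//; rewrite [X in (_ * X)%E](_ : _ = 1%E) ?mul1e//.
exact: probability_setT.
Qed.

(** Substitution of [w * r]: the power contributes [b] factors and the differential one more. Read
    from right to left, it turns an inverse power into a Gaussian integral, which is how negative
    moments are reached. *)
Lemma ge0_integral_gauss_scale (b : nat) (w : R) : 0 < w ->
  (\int[mu]_r (`|r| ^+ b * gauss_density (w * r))%:E =
   (w ^- b.+1)%:E * gauss_moment b)%E.
Proof.
move=> w0; have wn0 : w != 0 by rewrite gt_eqF.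
pose f r : \bar R := ((w ^- b) * (`|r| ^+ b * gauss_density r))%:E.
have mg : measurable_fun [set: R] (fun r => `|r| ^+ b * gauss_density r).
  by apply: measurable_funM; [exact: measurable_normX|
    exact: measurable_gauss_density].
transitivity (\int[mu]_r f (w * r)%R)%E.
  apply: eq_integral => r _; rewrite /f normrM exprMn gtr0_norm//.
  by rewrite -mulrA mulKf// expf_neq0.
rewrite ge0_integral_scale//; last 2 first.
- by apply/measurable_EFinP; exact: measurable_funM.
- by move=> r; rewrite lee_fin !mulr_ge0 ?gauss_density_ge0 ?invr_ge0 ?exprn_ge0// ltW.
rewrite /f; under eq_integral do rewrite EFinM.
rewrite ge0_integralZl//=.
- by rewrite gauss_momentE muleA -EFinM gtr0_norm// exprS invfM.
- exact/measurable_EFinP.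
- by move=> r _; rewrite lee_fin mulr_ge0 ?gauss_density_ge0.
- by rewrite lee_fin invr_ge0 exprn_ge0// ltW.
Qed.

End StandardGaussian.

Arguments gauss_moment : clear implicits.

(** * Recursion, positivity and finiteness of the absolute Gaussian moments *)

Section MomentRecursion.
Context {R : realType}.
Local Notation mu := (@lebesgue_measure R).

Lemma integral_exprn (b : nat) (y : R) : 0 <= y ->
  (\int[mu]_(x in `[0%R, y]) (x ^+ b)%:E = (y ^+ b.+1 / b.+1%:R)%:E)%E.
Proof.
rewrite le_eqVlt => /predU1P[<-|y0].
  by rewrite set_itv1 integral_set1 expr0n mul0r.
rewrite (@continuous_FTC2 _ _ (fun x => x ^+ b.+1 / b.+1%:R))//.
- by rewrite expr0n mul0r sube0.
- by apply: continuous_subspaceT; exact: exprn_continuous.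
- pose F (x : R^o) : R^o := x ^+ b.+1 / b.+1%:R.
  have dF x : derivable F x 1 by apply: derivableM => //; exact: exprn_derivable.
  have cF x : {for x, continuous F}.
    exact/differentiable_continuous/derivable1_diffP.
  split => //; [apply: cvg_at_right_filter|apply: cvg_at_left_filter]; exact: cF.
- move=> x _; rewrite derive1E.
  have : is_derive x 1 ((b.+1%:R^-1 : R) *: ((@idfun R) ^+ b.+1)) (x ^+ b).
    apply: is_derive_eq; rewrite /= /GRing.scale/= mulr1.
    by rewrite -mulr_natl mulrA mulVf ?mul1r// pnatr_eq0.
  move=> /@derive_val <-; congr ('D_1 _ x).
  by apply/funext => z /=; rewrite !fctE /= mulrC.
Qed.

Lemma is_derive_gauss_density (x : R) :
  is_derive x 1 (gauss_density : R -> R) (- (x * gauss_density x)).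
Proof.
rewrite [X in is_derive _ _ X](_ : _ =
  normal_peak 1 *: (expR \o (- (2^-1 *: ((@idfun R) ^+ 2))))); last first.
  apply/funext => y; rewrite /gauss_density /= !fctE/=; congr (_ * expR _).
  by rewrite /GRing.scale/= mulrC.
apply: is_derive_eq; rewrite /gauss_density /= !fctE/= /GRing.scale/=.
have -> : 2^-1 * (2 * x ^+ 1 * 1) = x by rewrite expr1; field.
by rewrite [2^-1 * x ^+ 2]mulrC !mulrN mulrA [in RHS]mulrC.
Qed.

Lemma continuous_gauss_density : continuous (gauss_density : R -> R).
Proof. by rewrite gauss_densityE; apply: continuous_normal_pdf; rewrite oner_eq0. Qed.

Lemma integral_gauss_tail (x : R) : 0 <= x ->
  (\int[mu]_(y in `[x, +oo[) (y * gauss_density y)%:E = (gauss_density x)%:E)%E.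
Proof.
move=> x0; rewrite (@ge0_continuous_FTC2y _ _ (fun y => - gauss_density y) _ 0).
- by rewrite sub0e EFinN oppeK.
- by move=> y xy; rewrite mulr_ge0 ?gauss_density_ge0// (le_trans x0).
- apply: continuous_subspaceT => y; apply: cvgM; first exact: cvg_id.
  exact: continuous_gauss_density.
- rewrite -oppr0; apply: cvgN; rewrite -[X in _ --> X](mulr0 (normal_peak 1)).
  apply: cvgMr; apply: (cvg_comp (fun y : R => y ^+ 2 / 2) (fun y => expR (- y))).
    apply: gt0_cvgMly; first by rewrite invr_gt0.
    exact: cvgr_expr2.
  exact: cvgr_expR.
- move=> y _; apply: derivableN.
  by have := is_derive_gauss_density y => /@ex_derive.
- apply: cvg_at_right_filter; apply: cvgN; exact: continuous_gauss_density.
- move=> y _; rewrite derive1E.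
  have /@derive_val := is_deriveN (is_derive_gauss_density y).
  by rewrite opprK.
Qed.

Lemma gauss_moment_half (b : nat) :
  (gauss_moment R b =
   2%:E * \int[mu]_(x in `[0%R, +oo[) (`|x| ^+ b * gauss_density x)%:E)%E.
Proof.
rewrite gauss_momentE set_itvcy -ge0_symfun_integralT//.
- by move=> x; rewrite mulr_ge0 ?gauss_density_ge0 ?exprn_ge0.
- move=> x; apply: cvgM; last exact: continuous_gauss_density.
  apply: (@continuous_comp _ _ _ (fun x : R => `|x|) (fun x => x ^+ b)).
    exact: norm_continuous.
  exact: exprn_continuous.
- by move=> x /=; rewrite normrN /gauss_density sqrrN.
Qed.

(** Integration by parts in the form of Tonelli for the kernel [x ^+ b * (y * gauss_density y)] on
    [0 <= x <= y]: integrating in [y] first leaves [x ^+ b * gauss_density x], in [x] first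
    [y ^+ b.+2 * gauss_density y / b.+1]. No boundary term appears. *)
Lemma gauss_momentSS (b : nat) :
  (gauss_moment R b.+2 = b.+1%:R%:E * gauss_moment R b)%E.
Proof.
pose K (z : R * R) : R := if (0 <= z.1) && (z.1 <= z.2) then
  z.1 ^+ b * (z.2 * gauss_density z.2) else 0.
have K0 z : (0 <= K z).
  rewrite /K; case: ifPn => // /andP[z1 z2].
  by rewrite mulr_ge0 ?exprn_ge0// mulr_ge0 ?gauss_density_ge0// (le_trans z1).
have mK : measurable_fun [set: R * R] K.
  apply: measurable_fun_ifT => /=.
  - by apply: measurable_and; apply: measurable_fun_ler.
  - apply: measurable_funM; first exact: measurable_funX.
    apply: measurable_funM => //.
    by apply: measurableT_comp => //; exact: measurable_gauss_density.
  - exact: measurable_cst.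
have xK (x : R) : (\int[mu]_y (K (x, y))%:E =
    if (0 <= x)%R then (x ^+ b * gauss_density x)%:E else 0)%E.
  rewrite /K/=; case: ifPn => x0; last first.
    by rewrite integral0_eq.
  rewrite EFinM -(integral_gauss_tail x0) -ge0_integralZl//.
  - rewrite [RHS]integral_mkcond; apply: eq_integral => y _.
    rewrite patchE mem_setE/= in_itv/= andbT; by case: ifP.
  - apply/measurable_EFinP; apply: measurable_funM => //.
    by apply: measurable_funTS; exact: measurable_gauss_density.
  - move=> y /=; rewrite in_itv/= andbT => xy.
    by rewrite lee_fin mulr_ge0 ?gauss_density_ge0// (le_trans x0).
  - by rewrite lee_fin exprn_ge0.
have yK (y : R) : (\int[mu]_x (K (x, y))%:E =
    if (0 <= y)%R then (b.+1%:R^-1 * (y ^+ b.+2 * gauss_density y))%:E else 0)%E.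
  rewrite /K/=; case: ifPn => y0; last first.
    rewrite integral0_eq// => x _; case: ifPn => // /andP[x0 xy].
    by rewrite (le_trans x0 xy) in y0.
  transitivity (\int[mu]_(x in `[0%R, y]) ((y * gauss_density y)%:E * (x ^+ b)%:E))%E.
    rewrite [RHS]integral_mkcond; apply: eq_integral => x _.
    rewrite patchE mem_setE/= in_itv/=; case: ifP => // _.
    by rewrite -EFinM mulrC.
  rewrite ge0_integralZl//.
  - rewrite integral_exprn// -EFinM; congr EFin.
    by rewrite [in RHS]exprS; field; rewrite nat1r pnatr_eq0.
  - by apply/measurable_EFinP; exact: measurable_funX.
  - by move=> x /=; rewrite in_itv/= => /andP[x0 _]; rewrite lee_fin exprn_ge0.
  - by rewrite lee_fin mulr_ge0 ?gauss_density_ge0.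
have H : (\int[mu]_x (if (0 <= x)%R then (x ^+ b * gauss_density x)%:E else 0) =
  \int[mu]_y (if (0 <= y)%R
     then (b.+1%:R^-1 * (y ^+ b.+2 * gauss_density y))%:E else 0))%E.
  transitivity (\int[mu]_x \int[mu]_y (K (x, y))%:E)%E.
    by apply: eq_integral => x _; exact/esym/xK.
  transitivity (\int[mu]_y \int[mu]_x (K (x, y))%:E)%E; last first.
    by apply: eq_integral => y _; exact/yK.
  apply: (@fubini_tonelli _ _ _ _ _ mu mu (EFin \o K)).
    exact/measurable_EFinP.
  by move=> z; rewrite lee_fin.
rewrite !gauss_moment_half muleCA; congr (_ * _)%E.
transitivity (b.+1%:R%:E * \int[mu]_y
    (if (0 <= y)%R then (b.+1%:R^-1 * (y ^+ b.+2 * gauss_density y))%:E else 0))%E.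
  rewrite -ge0_integralZl//.
  - rewrite [LHS]integral_mkcond; apply: eq_integral => y _.
    rewrite patchE mem_setE/= in_itv/= andbT; case: ifP => y0; last by rewrite mule0.
    by rewrite ger0_norm// -EFinM mulVKf ?pnatr_eq0.
  - apply: measurable_fun_ifT => //=; first exact: measurable_fun_ler.
    apply/measurable_EFinP; apply: measurable_funM => //; apply: measurable_funM.
      exact: measurable_funX.
    exact: measurable_gauss_density.
  - move=> y _; case: ifP => // y0.
    by rewrite lee_fin mulr_ge0 ?invr_ge0// mulr_ge0 ?gauss_density_ge0 ?exprn_ge0.
rewrite -H; congr (_ * _)%E.
rewrite [RHS]integral_mkcond; apply: eq_integral => y _.
by rewrite patchE mem_setE/= in_itv/= andbT; case: ifP => // y0; rewrite ger0_norm.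
Qed.

(** Gives the recursion a positive start on odd orders: integrate [x ^ 2 <= |x| + x ^ 4 / 4], the
    second and fourth moments being 1 and 3. *)
Lemma gauss_moment1_ge : (4^-1%:E <= gauss_moment R 1)%E.
Proof.
have m2 : gauss_moment R 2 = 1%E by rewrite gauss_momentSS gauss_moment0 mule1.
have m4 : gauss_moment R 4 = 3%:E by rewrite gauss_momentSS m2 mule1.
have : (gauss_moment R 2 <= gauss_moment R 1 + 4^-1%:E * gauss_moment R 4)%E.
  rewrite /gauss_moment -ge0_integralZl//; last first.
    by apply/measurable_EFinP; exact: measurable_normX.
  rewrite -ge0_integralD//; last 2 first.
  - by apply/measurable_EFinP; exact: measurable_normX.
  - apply/measurable_EFinP; apply: measurable_funM => //; exact: measurable_normX.
  apply: ge0_le_integral => //.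
  - by apply/measurable_EFinP; exact: measurable_normX.
  - apply/measurable_EFinP; apply: measurable_funD; first exact: measurable_normX.
    by apply: measurable_funM => //; exact: measurable_normX.
  - move=> x _; rewrite -EFinM -EFinD lee_fin; set z := `|x|.
    have z0 : 0 <= z by exact: normr_ge0.
    have : 0 <= z ^+ 3 - 4 * z + 4.
      have -> : z ^+ 3 - 4 * z + 4 = (z - 1) ^+ 2 * (z + 2) + (2 - z) by ring.
      have [z2|z2] := leP z 2; first by rewrite addr_ge0 ?subr_ge0// mulr_ge0 ?sqr_ge0 ?addr_ge0.
      by nra.
    by move=> /(mulr_ge0 z0); lra.
rewrite m2 m4; case: (gauss_moment R 1) => [r| |]; rewrite ?leey// -?EFinM.
by rewrite -EFinD !lee_fin; lra.
Qed.

Lemma gauss_moment_gt0 b : (0 < gauss_moment R b)%E.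
Proof.
(* The recursion moves by two, so the induction carries two consecutive orders. *)
suff : (0 < gauss_moment R b)%E /\ (0 < gauss_moment R b.+1)%E by case.
elim: b => [|b [h0 h1]].
  rewrite gauss_moment0 lte01; split => //; apply: lt_le_trans gauss_moment1_ge.
  by rewrite lte_fin.
by split => //; rewrite gauss_momentSS mule_gt0// lte_fin.
Qed.

Lemma gauss_moment_lty b : (gauss_moment R b < +oo)%E.
Proof.
suff : (gauss_moment R b < +oo)%E /\ (gauss_moment R b.+1 < +oo)%E by case.
elim: b => [|b [h0 h1]]; last first.
  split => //; rewrite gauss_momentSS lte_mul_pinfty//; exact: gauss_moment_ge0.
rewrite gauss_moment0 ltry; split => //.
have m2 : gauss_moment R 2 = 1%E by rewrite gauss_momentSS gauss_moment0 mule1.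
(* The first moment is controlled by [|x| <= 1 + x ^+ 2]. *)
apply: (@le_lt_trans _ _ (gauss_moment R 0 + gauss_moment R 2)%E); last first.
  by rewrite gauss_moment0 m2 -EFinD ltry.
rewrite /gauss_moment -ge0_integralD//; last 2 first.
- by apply/measurable_EFinP; exact: measurable_normX.
- by apply/measurable_EFinP; exact: measurable_normX.
apply: ge0_le_integral => //.
- by apply/measurable_EFinP; exact: measurable_normX.
- apply/measurable_EFinP; apply: measurable_funD; exact: measurable_normX.
- move=> x _; rewrite -EFinD lee_fin expr1 expr0; have z0 : 0 <= `|x| by exact: normr_ge0.
  by set z := `|x| in z0 *; nra.
Qed.

End MomentRecursion.

(** * Gaussian matrices *)

Definition image_probability d d' (T1 : measurableType d) (T2 : measurableType d')
    (R : realType) (P : probability T1 R) (f : T1 -> T2)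
    (mf : measurable_fun [set: T1] f) : probability T2 R :=
  distribution P (HB.pack_for {mfun T1 >-> T2} f (isMeasurableFun.Build _ _ _ _ f mf)).

(** * The sigma-algebra on matrices generated by the entries *)

Section MeasurableMatrix.
Context {R : realType}.
Variables m n : nat.

Definition mx_entry_preimages : set (set 'M[R]_(m, n)) :=
  [set X | exists i j, exists2 B : set R, measurable B &
           X = (fun M : 'M[R]_(m, n) => M i j) @^-1` B].

Let mx_measurable := <<s mx_entry_preimages >>.

Let mx_set0 : mx_measurable set0.
Proof. exact: sigma_algebra0. Qed.

Let mx_setC A : mx_measurable A -> mx_measurable (~` A).
Proof. exact: sigma_algebraC. Qed.

Let mx_bigcup (F : (set 'M[R]_(m, n))^nat) : (forall i, mx_measurable (F i)) ->
  mx_measurable (\bigcup_i (F i)).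
Proof. exact: sigma_algebra_bigcup. Qed.

HB.instance Definition _ := @isMeasurable.Build default_measure_display
  'M[R]_(m, n) mx_measurable mx_set0 mx_setC mx_bigcup.

Lemma measurable_mx_entry (i : 'I_m) (j : 'I_n) :
  measurable_fun [set: 'M[R]_(m, n)] (fun M : 'M[R]_(m, n) => M i j).
Proof.
move=> _ B mB; rewrite setTI; apply: sub_sigma_algebra.
by exists i, j, B.
Qed.

(** The sets with measurable preimage form a sigma-algebra, so it is enough to test the generators,
    which are conditions on a single entry. *)
Lemma measurable_mxP d (T : measurableType d) (f : T -> 'M[R]_(m, n)) :
  measurable_fun [set: T] f <->
  forall i j, measurable_fun [set: T] (fun w => f w i j).
Proof.
split=> [mf i j|mf].
  exact: (measurableT_comp (measurable_mx_entry i j)).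
move=> _ B mB; rewrite setTI.
pose F := [set B : set 'M[R]_(m, n) | measurable (f @^-1` B)].
suff : mx_measurable `<=` F by apply.
apply: smallest_sub.
  split; rewrite /F/=.
  - by rewrite preimage_set0.
  - by move=> A mA; rewrite setTD preimage_setC; exact: measurableC.
  - by move=> A mA; rewrite preimage_bigcup; exact: bigcupT_measurable.
move=> _ [i [j [C mC ->]]]; rewrite /F/= -comp_preimage.
by rewrite -[X in measurable X]setTI; exact: mf.
Qed.

End MeasurableMatrix.

Section MeasurableMatrixOperations.
Context {R : realType} d (T : measurableType d).

Lemma measurable_col_mx m1 m2 n
    (X1 : T -> 'M[R]_(m1, n)) (X2 : T -> 'M[R]_(m2, n)) :
  measurable_fun setT X1 -> measurable_fun setT X2 ->
  measurable_fun setT (fun w => col_mx (X1 w) (X2 w)).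
Proof.
move=> /measurable_mxP mX1 /measurable_mxP mX2; apply/measurable_mxP => i j.
rewrite /col_mx; under eq_fun do rewrite mxE.
by case: (fintype.split i) => k; [exact: mX1|exact: mX2].
Qed.

Lemma measurable_row_mx m n1 n2
    (X1 : T -> 'M[R]_(m, n1)) (X2 : T -> 'M[R]_(m, n2)) :
  measurable_fun setT X1 -> measurable_fun setT X2 ->
  measurable_fun setT (fun w => row_mx (X1 w) (X2 w)).
Proof.
move=> /measurable_mxP mX1 /measurable_mxP mX2; apply/measurable_mxP => i j.
rewrite /row_mx; under eq_fun do rewrite mxE.
by case: (fintype.split j) => k; [exact: mX1|exact: mX2].
Qed.

Lemma measurable_trmx m n (X : T -> 'M[R]_(m, n)) :
  measurable_fun setT X -> measurable_fun setT (fun w => (X w)^T).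
Proof.
move=> /measurable_mxP mX; apply/measurable_mxP => i j.
under eq_fun do rewrite mxE; exact: mX.
Qed.

Lemma measurable_mulmx m n p (X : T -> 'M[R]_(m, n)) (Y : T -> 'M[R]_(n, p)) :
  measurable_fun setT X -> measurable_fun setT Y ->
  measurable_fun setT (fun w => X w *m Y w).
Proof.
move=> /measurable_mxP mX /measurable_mxP mY; apply/measurable_mxP => i j.
under eq_fun do rewrite mxE.
by apply: measurable_sum => k; apply: measurable_funM.
Qed.

Lemma measurable_prod_seq (I : Type) (s : seq I) (f : I -> T -> R) :
  (forall i, measurable_fun setT (f i)) ->
  measurable_fun setT (fun w => \prod_(i <- s) f i w).
Proof.
move=> mf; elim: s => [|i s ih]; first by under eq_fun do rewrite big_nil; exact: measurable_cst.
by under eq_fun do rewrite big_cons; exact: measurable_funM.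
Qed.

Lemma measurable_determinant n (X : T -> 'M[R]_n) :
  measurable_fun setT X -> measurable_fun setT (fun w => \det (X w)).
Proof.
move=> /measurable_mxP mX; apply: measurable_sum => s.
by apply: measurable_funM => //; exact: measurable_prod_seq.
Qed.

Lemma measurable_adjugate n (X : T -> 'M[R]_n) :
  measurable_fun setT X -> measurable_fun setT (fun w => \adj (X w)).
Proof.
move=> mX; apply/measurable_mxP => i j.
under eq_fun do rewrite mxE /cofactor.
apply: measurable_funM => //; apply: measurable_determinant.
apply/measurable_mxP => i' j'; under eq_fun do rewrite !mxE.
by move/measurable_mxP : mX; exact.
Qed.

End MeasurableMatrixOperations.

Lemma measurable_scalar_mx11 (R : realType) :
  measurable_fun [set: R] (fun x : R => x%:M : 'M[R]_1).
Proof.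
apply/measurable_mxP => i j; rewrite !ord1 (_ : (fun x : R => _) = id)//.
by apply/funext => x; rewrite mxE eqxx mulr1n.
Qed.

Section GaussianMatrix.
Context {R : realType}.
Local Notation gauss := (@normal_prob R 0 1).

Definition mx_box m n (B : 'I_m -> 'I_n -> set R) : set 'M[R]_(m, n) :=
  [set M | forall i j, B i j (M i j)].

Definition mx_boxes m n : set (set 'M[R]_(m, n)) :=
  [set X | exists2 B, (forall i j, measurable (B i j)) & X = mx_box B].

Lemma mx_box_bigcap m n (B : 'I_m -> 'I_n -> set R) :
  mx_box B = \bigcap_(ij in [set: 'I_m * 'I_n])
     ((fun M : 'M[R]_(m, n) => M ij.1 ij.2) @^-1` B ij.1 ij.2).
Proof.
apply/seteqP; split => [M BM [i j] _|M BM i j]; first exact: BM.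
exact: (BM (i, j)).
Qed.

Lemma measurable_mx_box m n (B : 'I_m -> 'I_n -> set R) :
  (forall i j, measurable (B i j)) -> measurable (mx_box B).
Proof.
move=> mB; rewrite mx_box_bigcap; apply: fin_bigcap_measurable => //.
move=> [i j] _ /=; rewrite -[X in measurable X]setTI.
exact: measurable_mx_entry.
Qed.

Lemma measurable_mx_boxes m n :
  (@measurable _ 'M[R]_(m, n)) = <<s @mx_boxes m n >>.
Proof.
apply/seteqP; split.
  apply: smallest_sub; first exact: smallest_sigma_algebra.
  move=> _ [i [j [B mB ->]]]; apply: sub_sigma_algebra.
  exists (fun i' j' => if (i' == i) && (j' == j) then B else setT).
    by move=> i' j'; case: ifP.
  apply/seteqP; split => M /=; last by move/(_ i j); rewrite !eqxx.
  by move=> BM i' j'; case: ifP => // /andP[/eqP-> /eqP->].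
apply: smallest_sub; first exact: sigma_algebra_measurable.
by move=> _ [B mB ->]; exact: measurable_mx_box.
Qed.

(** Independence of all entries and their standard normal law in a single product formula; taking
    every [B i j] to be [setT] shows that [P] has mass 1. *)
Definition is_gaussian d (T : measurableType d) (P : {measure set T -> \bar R})
    m n (X : T -> 'M[R]_(m, n)) :=
  measurable_fun [set: T] X /\
  forall B : 'I_m -> 'I_n -> set R, (forall i j, measurable (B i j)) ->
    P (X @^-1` mx_box B) = (\prod_(i < m) \prod_(j < n) gauss (B i j))%E.

Lemma is_gaussian_setT d (T : measurableType d) (P : {measure set T -> \bar R})
    m n (X : T -> 'M[R]_(m, n)) : is_gaussian P X -> P setT = 1%E.
Proof.
move=> [_ /(_ (fun _ _ => setT))]; rewrite (_ : _ @^-1` _ = setT); last exact/seteqP.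
move=> -> //; rewrite big1// => i _; rewrite big1// => j _.
exact: probability_setT.
Qed.

(** Boxes are stable under intersection and generate the sigma-algebra, so a finite measure is
    determined by its values on them. This lets every later computation move to a convenient
    probability space. *)
Lemma is_gaussian_unique d (T : measurableType d) (P : {measure set T -> \bar R})
    d' (T' : measurableType d') (P' : {measure set T' -> \bar R})
    m n (X : T -> 'M[R]_(m, n)) (X' : T' -> 'M[R]_(m, n)) A :
  is_gaussian P X -> is_gaussian P' X' -> measurable A ->
  P (X @^-1` A) = P' (X' @^-1` A).
Proof.
move=> gX gX'; have [mX PX] := gX; have [mX' PX'] := gX'.
move=> mA; change (image_measure P mX A = image_measure P' mX' A).
apply: (measure_unique (@mx_boxes m n) (fun=> setT)) => //.
- exact: measurable_mx_boxes.
- move=> _ _ [B mB ->] [C mC ->]; exists (fun i j => B i j `&` C i j).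
    by move=> i j; exact: measurableI.
  apply/seteqP; split => [M [BM CM] i j|M BCM]; first by split; [exact: BM|exact: CM].
  by split => i j; have [] := BCM i j.
- by move=> _; exists (fun _ _ => setT) => //; apply/seteqP; split.
- by rewrite bigcup_const.
- by move=> _ [B mB ->]; exact: (etrans (PX _ mB) (esym (PX' _ mB))).
- by move=> _; rewrite [X in (X < _)%E](is_gaussian_setT gX) ltry.
Qed.

Lemma is_gaussian_integral d (T : measurableType d) (P : {measure set T -> \bar R})
    d' (T' : measurableType d') (P' : {measure set T' -> \bar R})
    m n (X : T -> 'M[R]_(m, n)) (X' : T' -> 'M[R]_(m, n)) (F : 'M[R]_(m, n) -> \bar R) :
  is_gaussian P X -> is_gaussian P' X' -> measurable_fun setT F ->
  (forall M, (0 <= F M)%E) ->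
  (\int[P]_w F (X w) = \int[P']_w F (X' w))%E.
Proof.
move=> gX gX' mF F0; have [mX _] := gX; have [mX' _] := gX'.
rewrite -(ge0_integral_image_measure _ mX)// -(ge0_integral_image_measure _ mX')//.
by apply: eq_measure_integral => A mA _; exact: (is_gaussian_unique gX gX' mA).
Qed.

Lemma is_gaussian_col_mx m1 m2 n d1 (T1 : measurableType d1)
    (P1 : probability T1 R) d2 (T2 : measurableType d2) (P2 : probability T2 R)
    (X1 : T1 -> 'M[R]_(m1, n)) (X2 : T2 -> 'M[R]_(m2, n)) :
  is_gaussian P1 X1 -> is_gaussian P2 X2 ->
  is_gaussian (P1 \x P2)%E (fun w => col_mx (X1 w.1) (X2 w.2)).
Proof.
move=> [mX1 PX1] [mX2 PX2]; split.
  by apply: measurable_col_mx; exact: measurableT_comp.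
move=> B mB; rewrite (_ : _ @^-1` _ =
    (X1 @^-1` mx_box (fun i => B (lshift m2 i))) `*`
    (X2 @^-1` mx_box (fun i => B (rshift m1 i)))); last first.
  apply/seteqP; split => [[x y] /= BM|[x y] /= [B1 B2] i j].
    by split=> i j; [have := BM (lshift m2 i) j|have := BM (rshift m1 i) j];
      rewrite ?col_mxEu ?col_mxEd.
  by rewrite -[i]splitK; case: (fintype.split i) => k /=; rewrite ?col_mxEu ?col_mxEd.
transitivity (P1 (X1 @^-1` mx_box (fun i => B (lshift m2 i))) *
    P2 (X2 @^-1` mx_box (fun i => B (rshift m1 i))))%E; last first.
  by rewrite big_split_ord/= PX1// PX2.
apply: product_measure1E.
- by rewrite -[X in measurable X]setTI; apply: mX1 => //; exact: measurable_mx_box.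
- by rewrite -[X in measurable X]setTI; apply: mX2 => //; exact: measurable_mx_box.
Qed.

Lemma is_gaussian_tr m n d (T : measurableType d) (P : {measure set T -> \bar R})
    (X : T -> 'M[R]_(m, n)) :
  is_gaussian P X -> is_gaussian P (fun w => (X w)^T).
Proof.
move=> [mX PX]; split; first exact: measurable_trmx.
move=> B mB; rewrite exchange_big/= -(PX (fun i j => B j i))//.
congr (P _); apply/seteqP; split => w /= BM i j; have := BM j i;
  by rewrite mxE.
Qed.

Lemma exists_gaussian m n :
  exists P : probability 'M[R]_(m, n) R, is_gaussian P id.
Proof.
have gaussian_image d (T : measurableType d) (P : probability T R) p q
    (X : T -> 'M[R]_(p, q)) : is_gaussian P X ->
    exists P : probability 'M[R]_(p, q) R, is_gaussian P id.
  by move=> [mX PX]; exists (image_probability P mX); split.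
(* Stacks [p] independent rows of width [q], using product measures. It serves twice: scalars are
   stacked into a column, whose transpose is the row to be stacked into the matrix. *)
have col : forall p q, (exists P : probability 'M[R]_(1, q) R, is_gaussian P id) ->
    exists P : probability 'M[R]_(p, q) R, is_gaussian P id.
  move=> p q [P1 gP1]; elim: p => [|p [P gP]].
    apply: (gaussian_image _ _ (@normal_prob R 0 1) _ _ (fun=> 0)); split => // B mB.
    rewrite big_ord0 (_ : _ @^-1` _ = setT); last by apply/seteqP; split => // ? _ [].
    exact: probability_setT.
  exact: (@gaussian_image _ _ _ (1 + p)%N q _ (is_gaussian_col_mx gP1 gP)).
apply: (col); have [|P gP] := col n 1.
  apply: (@gaussian_image _ _ (@normal_prob R 0 1) _ _ (fun x => x%:M)); split.
    exact: measurable_scalar_mx11.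
  move=> B mB; rewrite !big_ord1; congr (normal_prob 0 1 _).
  apply/seteqP; split => x /=; first by move/(_ 0 0); rewrite mxE.
  by move=> Bx i j; rewrite !ord1 mxE.
exact: (gaussian_image _ _ P _ _ _ (is_gaussian_tr gP)).
Qed.

Definition gauss_mx m n : probability 'M[R]_(m, n) R :=
  projT1 (cid (exists_gaussian m n)).

Lemma gauss_mxP m n : is_gaussian (gauss_mx m n) id.
Proof. exact: (projT2 (cid (exists_gaussian m n))). Qed.

Lemma integral_is_gaussian d (T : measurableType d) (P : {measure set T -> \bar R})
    m n (X : T -> 'M[R]_(m, n)) (F : 'M[R]_(m, n) -> \bar R) :
  is_gaussian P X -> measurable_fun setT F -> (forall M, 0 <= F M)%E ->
  (\int[P]_w F (X w) = \int[gauss_mx m n]_M F M)%E.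
Proof. by move=> gX mF F0; apply: is_gaussian_integral gX (gauss_mxP m n) mF F0. Qed.

(** Conditioning on the upper block; the variant with the integrals exchanged conditions on the
    lower one. *)
Lemma integral_gauss_col_mx m1 m2 n (F : 'M[R]_(m1 + m2, n) -> \bar R) :
  measurable_fun setT F -> (forall M, 0 <= F M)%E ->
  (\int[gauss_mx (m1 + m2) n]_M F M =
   \int[gauss_mx m1 n]_x \int[gauss_mx m2 n]_y F (col_mx x y))%E.
Proof.
move=> mF F0.
rewrite -(integral_is_gaussian (is_gaussian_col_mx (gauss_mxP m1 n) (gauss_mxP m2 n)))//.
rewrite (@fubini_tonelli1 _ _ _ _ _ (gauss_mx m1 n) (gauss_mx m2 n)
  (fun w => F (col_mx w.1 w.2)))//.
by apply: measurableT_comp => //; exact: measurable_col_mx.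
Qed.

Lemma integral_gauss_col_mx_swap m1 m2 n (F : 'M[R]_(m1 + m2, n) -> \bar R) :
  measurable_fun setT F -> (forall M, 0 <= F M)%E ->
  (\int[gauss_mx (m1 + m2) n]_M F M =
   \int[gauss_mx m2 n]_y \int[gauss_mx m1 n]_x F (col_mx x y))%E.
Proof.
move=> mF F0; rewrite integral_gauss_col_mx//.
rewrite (@fubini_tonelli _ _ _ _ _ (gauss_mx m1 n) (gauss_mx m2 n)
  (fun w => F (col_mx w.1 w.2)))//.
by apply: measurableT_comp => //; exact: measurable_col_mx.
Qed.

Lemma integral_gauss_tr m n (F : 'M[R]_(m, n) -> \bar R) :
  measurable_fun setT F -> (forall M, 0 <= F M)%E ->
  (\int[gauss_mx m n]_M F M = \int[gauss_mx n m]_M F M^T)%E.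
Proof.
by move=> mF F0; rewrite -(integral_is_gaussian (is_gaussian_tr (gauss_mxP n m))).
Qed.

Lemma integral_gauss_row_mx m n1 n2 (F : 'M[R]_(m, n1 + n2) -> \bar R) :
  measurable_fun setT F -> (forall M, 0 <= F M)%E ->
  (\int[gauss_mx m (n1 + n2)]_M F M =
   \int[gauss_mx m n1]_x \int[gauss_mx m n2]_y F (row_mx x y))%E.
Proof.
move=> mF F0; rewrite integral_gauss_tr// integral_gauss_col_mx//; last first.
  by apply: measurableT_comp => //; apply: measurable_trmx.
rewrite [RHS]integral_gauss_tr; last 2 first.
- apply: (@measurable_fun_fubini_tonelli_F _ _ _ _ _ (gauss_mx m n2)
    (fun w => F (row_mx w.1 w.2))) => //.
  by apply: measurableT_comp => //; exact: measurable_row_mx.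
- by move=> x; exact: integral_ge0.
apply: eq_integral => x _; rewrite [RHS]integral_gauss_tr//.
  by apply: eq_integral => y _; rewrite tr_col_mx.
by apply: measurableT_comp => //; apply: measurable_row_mx.
Qed.

Lemma integral_gauss_mx11 (F : 'M[R]_1 -> \bar R) :
  measurable_fun setT F -> (forall M, 0 <= F M)%E ->
  (\int[gauss_mx 1 1]_M F M = \int[gauss]_x F x%:M)%E.
Proof.
move=> mF F0; rewrite -(@integral_is_gaussian _ _ (@normal_prob R 0 1) _ _ (fun x => x%:M))//.
split.
  exact: measurable_scalar_mx11.
move=> B mB; rewrite !big_ord1; congr (normal_prob 0 1 _).
apply/seteqP; split => x /=; first by move/(_ 0 0); rewrite mxE.
by move=> Bx i j; rewrite !ord1 mxE.
Qed.

End GaussianMatrix.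

(** * Orthogonal invariance *)

Section PlaneRotation.
Context {R : realType}.
Local Notation mu := (@lebesgue_measure R).
Local Notation gauss := (@normal_prob R 0 1).
Local Open Scope ereal_scope.

Lemma measurable_affine2 (a b : R) :
  measurable_fun [set: R * R] (fun z : R * R => (a * z.1 + b * z.2)%R).
Proof.
by apply: measurable_funD; apply: measurable_funM.
Qed.

(* A rotation factors into two one-variable affine substitutions and, when
   [c = 0], it is a coordinate swap up to sign. *)
Lemma ge0_integral_lebesgue_rot (c s : R) (K : R * R -> \bar R) :
  (c ^+ 2 + s ^+ 2 = 1)%R -> measurable_fun [set: R * R] K ->
  (forall z, 0 <= K z) ->
  \int[mu]_x \int[mu]_y K (c * x - s * y, s * x + c * y)%R =
  \int[mu]_x \int[mu]_y K (x, y).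
Proof.
move=> cs mK K0.
have mKaff (a b a' b' : R) : measurable_fun [set: R * R]
    (fun z : R * R => K (a * z.1 + b * z.2, a' * z.1 + b' * z.2)%R).
  apply: measurableT_comp => //; apply: measurable_fun_pair;
    exact: measurable_affine2.
have mK1 (a b a' b' : R) : measurable_fun [set: R]
    (fun x : R => K (a * x + b, a' * x + b')%R).
  by apply: measurableT_comp => //; apply: measurable_fun_pair;
    apply: measurable_funD => //; apply: measurable_funM.
have [c0|c0] := eqVneq c 0%R.
  have s0 : s != 0%R.
    by apply: contra_eq_neq cs => ->; rewrite c0 expr0n addr0 eq_sym oner_eq0.
  have s1 : `|s|%R = 1%R.
    by apply/eqP; rewrite -(@eqrXn2 _ 2)// real_normK ?num_real// expr1n -cs c0 expr0n add0r.
  transitivity (\int[mu]_x \int[mu]_y K (y, s * x)%R).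
    apply: eq_integral => x _.
    rewrite -[RHS]mul1e -[in RHS](invr1 R) -[in RHS]s1 -[in RHS](normrN s).
    rewrite -(ge0_integral_scale (f := fun y => K (y, (s * x)%R))) ?oppr_eq0//.
      by apply: eq_integral => y _; rewrite c0 !mul0r sub0r addr0 mulNr.
    have := mK1 1%R 0%R 0%R (s * x)%R.
    by apply: eq_measurable_fun => y _; rewrite mul1r mul0r addr0 add0r.
  transitivity (\int[mu]_y \int[mu]_x K (y, s * x)%R).
    apply: (@fubini_tonelli _ _ _ _ _ mu mu (fun z => K (z.2, s * z.1)%R)) => //.
    have := mKaff 0%R 1%R s 0%R.
    by apply: eq_measurable_fun => y _; rewrite mul1r !mul0r addr0 add0r.
  apply: eq_integral => y _ /=.
  have mf : measurable_fun [set: R] (fun x : R => K (y, x)).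
    have := mK1 0%R y 1%R 0%R.
    by apply: eq_measurable_fun => z _; rewrite mul1r mul0r addr0 add0r.
  by rewrite (ge0_integral_scale (f := fun x => K (y, x)))// s1 invr1 mul1e.
transitivity (\int[mu]_y \int[mu]_x K (c * x - s * y, s * x + c * y)%R).
  apply: (@fubini_tonelli _ _ _ _ _ mu mu
    (fun z => K (c * z.1 - s * z.2, s * z.1 + c * z.2)%R)) => //.
  have := mKaff c (- s)%R s c.
  by apply: eq_measurable_fun => y _; rewrite mulNr.
(* With [x' = c * x - s * y], the second coordinate is [y / c + (s / c) * x'], since
   [1 - s ^+ 2 = c ^+ 2]. For fixed [y] this is an affine substitution in [x]; after exchanging the
   integrals, a second one in [y] restores the factor [|c|]. *)
have E1 (x y : R) : K (c * x - s * y, s * x + c * y)%R =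
    (fun x' => K (x', (c^-1 * y + (s / c) * x')%R)) (c * x + (- (s * y)))%R.
  congr (K (_, _)); rewrite -[LHS](mulKf c0) -[in RHS](mul1r (c^-1 * y)%R) -cs.
  by field.
transitivity (\int[mu]_y (`|c|^-1%:E * \int[mu]_x K (x, (c^-1 * y + (s / c) * x)%R))).
  apply: eq_integral => y _ /=.
  rewrite -(ge0_integral_affine (- (s * y))%R
    (f := fun x => K (x, (c^-1 * y + (s / c) * x)%R)))//.
    by apply: eq_integral => x _; exact: E1.
  have := mK1 1%R 0%R (s / c)%R (c^-1 * y)%R.
  by apply: eq_measurable_fun => z _; rewrite mul1r addr0 [in RHS]addrC.
have mS : measurable_fun [set: R * R]
   (fun z : R * R => K (z.1, (c^-1 * z.2 + s / c * z.1)%R)).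
  have := mKaff 1%R 0%R (s / c)%R (c^-1)%R.
  by apply: eq_measurable_fun => z _; rewrite mul1r mul0r addr0 [in RHS]addrC.
rewrite ge0_integralZl//; last 2 first.
- exact: (@measurable_fun_fubini_tonelli_G _ _ _ _ _ mu
    (fun z : R * R => K (z.1, (c^-1 * z.2 + s / c * z.1)%R))).
- by move=> y _; exact: integral_ge0.
rewrite -(@fubini_tonelli _ _ _ _ _ mu mu
  (fun z => K (z.1, c^-1 * z.2 + s / c * z.1)%R))//.
rewrite -ge0_integralZl//; last 2 first.
- exact: (@measurable_fun_fubini_tonelli_F _ _ _ _ _ mu
    (fun z : R * R => K (z.1, (c^-1 * z.2 + s / c * z.1)%R))).
- by move=> y _; exact: integral_ge0.
apply: eq_integral => x _ /=.
rewrite (ge0_integral_affine _ (f := fun y => K (x, y))) ?invr_eq0//; last first.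
  have := mK1 0%R x 1%R 0%R.
  by apply: eq_measurable_fun => z _; rewrite mul1r mul0r addr0 add0r.
by rewrite muleA -EFinM normfV invrK mulVf ?mul1e// normr_eq0.
Qed.

(** The planar density depends on [x ^+ 2 + y ^+ 2] alone, so the invariance of Lebesgue measure
    carries over. *)
Lemma ge0_integral_gauss_rot (c s : R) (H : R * R -> \bar R) :
  (c ^+ 2 + s ^+ 2 = 1)%R -> measurable_fun [set: R * R] H ->
  (forall z, 0 <= H z) ->
  \int[gauss]_x \int[gauss]_y H (c * x - s * y, s * x + c * y)%R =
  \int[gauss]_x \int[gauss]_y H (x, y).
Proof.
move=> cs mH H0.
pose D z : R := (gauss_density z.1 * gauss_density z.2)%R.
have mg := @measurable_gauss_density R.
have mD : measurable_fun [set: R * R] D.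
  by apply: measurable_funM; apply: measurableT_comp => //.
have D0 z : (0 <= D z)%R by rewrite mulr_ge0 ?gauss_density_ge0.
have toLeb (L : R * R -> \bar R) : measurable_fun [set: R * R] L ->
    (forall z, 0 <= L z) -> \int[gauss]_x \int[gauss]_y L (x, y) =
    \int[mu]_x \int[mu]_y (L (x, y) * (D (x, y))%:E).
  move=> mL L0.
  rewrite ge0_integral_gauss; last 2 first.
  - exact: (@measurable_fun_fubini_tonelli_F _ _ _ _ _ gauss L).
  - by move=> x; exact: integral_ge0.
  apply: eq_integral => x _.
  have mLx : measurable_fun [set: R] (fun y : R => L (x, y)).
    exact: measurableT_comp.
  rewrite ge0_integral_gauss// -ge0_integralZr//.
  - by apply: eq_integral => y _; rewrite -muleA -EFinM mulrC.
  - by apply: emeasurable_funM => //; exact/measurable_EFinP.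
  - by move=> y _; rewrite mule_ge0// lee_fin gauss_density_ge0.
  - by rewrite lee_fin gauss_density_ge0.
transitivity (\int[mu]_x \int[mu]_y
    (H (c * x - s * y, s * x + c * y)%R * (D (x, y))%:E)).
  apply: (toLeb (fun z => H (c * z.1 - s * z.2, s * z.1 + c * z.2)%R)) => //.
  apply: measurableT_comp => //; apply: measurable_fun_pair.
    have := measurable_affine2 c (- s).
    by apply: eq_measurable_fun => y _; rewrite mulNr.
  exact: measurable_affine2.
apply: etrans (esym (toLeb H mH H0)).
transitivity (\int[mu]_x \int[mu]_y (H (c * x - s * y, s * x + c * y)%R *
    (D (c * x - s * y, s * x + c * y)%R)%:E)).
  apply: eq_integral => x _; apply: eq_integral => y _ /=.
  by rewrite /D /= gauss_density_rot.
apply: (ge0_integral_lebesgue_rot (K := fun z => H z * (D z)%:E) cs).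
- by apply: emeasurable_funM => //; exact/measurable_EFinP.
- by move=> z; rewrite mule_ge0// lee_fin.
Qed.

Lemma ge0_integral_gaussN (f : R -> \bar R) : measurable_fun [set: R] f ->
  (forall x, 0 <= f x) -> \int[gauss]_x f (- x)%R = \int[gauss]_x f x.
Proof.
move=> mf f0; rewrite !ge0_integral_gauss//; last exact: measurableT_comp.
have n1 : ((-1)%R : R) != 0%R by rewrite oppr_eq0 oner_eq0.
have mfg : measurable_fun [set: R] (fun x => f x * (gauss_density x)%:E).
  by apply: emeasurable_funM => //; apply/measurable_EFinP; exact: measurable_gauss_density.
have fg0 x : 0 <= f x * (gauss_density x)%:E.
  by rewrite mule_ge0// lee_fin gauss_density_ge0.
have := ge0_integral_scale n1 mfg fg0.
rewrite normrN1 invr1 mul1e => <-.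
by apply: eq_integral => x _; rewrite mulN1r /gauss_density sqrrN.
Qed.

End PlaneRotation.

(** * Orthogonal matrices preserve the Gaussian law *)

Section OrthogonalInvariance.
Context {R : realType}.
Local Notation gauss := (@normal_prob R 0 1).

(** Orthogonality is bundled with invariance so that the class is closed under transposition: the
    transpose is then the inverse. *)
Definition gauss_invariant n (Q : 'M[R]_n) :=
  orthogonal_mx Q /\ forall F : 'cV[R]_n -> \bar R,
    measurable_fun setT F -> (forall x, 0 <= F x)%E ->
    (\int[gauss_mx n 1]_x F (Q *m x) = \int[gauss_mx n 1]_x F x)%E.

Lemma orthogonal_mx_unit n (Q : 'M[R]_n) : orthogonal_mx Q -> Q *m Q^T = 1%:M.
Proof. exact: mulmx1C. Qed.

Lemma orthogonal_mx_tr n (Q : 'M[R]_n) : orthogonal_mx Q -> orthogonal_mx Q^T.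
Proof. by move=> /orthogonal_mx_unit; rewrite /orthogonal_mx trmxK. Qed.

Lemma orthogonal_mxM n (Q1 Q2 : 'M[R]_n) :
  orthogonal_mx Q1 -> orthogonal_mx Q2 -> orthogonal_mx (Q1 *m Q2).
Proof.
move=> q1 q2; rewrite /orthogonal_mx trmx_mul mulmxA -(mulmxA _ Q1^T) q1.
by rewrite mulmx1.
Qed.

Lemma measurable_mulmxl m n p (Q : 'M[R]_(m, n)) :
  measurable_fun setT (fun x : 'M[R]_(n, p) => Q *m x).
Proof. exact: measurable_mulmx. Qed.

Lemma gauss_invariantM n (Q1 Q2 : 'M[R]_n) :
  gauss_invariant Q1 -> gauss_invariant Q2 -> gauss_invariant (Q1 *m Q2).
Proof.
move=> [q1 i1] [q2 i2]; split; first exact: orthogonal_mxM.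
move=> F mF F0; rewrite -[RHS]i1// -[RHS]i2//.
  by apply: eq_integral => x _; rewrite mulmxA.
by apply: measurableT_comp => //; exact: measurable_mulmxl.
Qed.

Lemma gauss_invariant1 n : gauss_invariant (1%:M : 'M[R]_n).
Proof.
split; first by rewrite /orthogonal_mx trmx1 mulmx1.
by move=> F _ _; apply: eq_integral => x _; rewrite mul1mx.
Qed.

Lemma gauss_invariant_tr n (Q : 'M[R]_n) :
  gauss_invariant Q -> gauss_invariant Q^T.
Proof.
move=> [oQ iQ]; split; first exact: orthogonal_mx_tr.
move=> F mF F0; rewrite -[LHS]iQ//.
  by apply: eq_integral => x _; rewrite mulmxA oQ mul1mx.
by apply: measurableT_comp => //; exact: measurable_mulmxl.
Qed.

Lemma gauss_invariant_block n1 n2 (Q1 : 'M[R]_n1) (Q2 : 'M[R]_n2) :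
  gauss_invariant Q1 -> gauss_invariant Q2 ->
  gauss_invariant (block_mx Q1 0 0 Q2).
Proof.
move=> [q1 i1] [q2 i2]; split.
  rewrite /orthogonal_mx tr_block_mx mulmx_block !trmx0 !mul0mx !mulmx0.
  by rewrite q1 q2 !addr0 add0r -scalar_mx_block.
move=> F mF F0.
have mFQ : measurable_fun setT (fun x => F (block_mx Q1 0 0 Q2 *m x)).
  by apply: measurableT_comp => //; exact: measurable_mulmxl.
apply: etrans (integral_gauss_col_mx mFQ _) _ => //.
apply/esym; apply: etrans (integral_gauss_col_mx mF F0) _; apply/esym.
rewrite -[RHS]i1; last 2 first.
- apply: (@measurable_fun_fubini_tonelli_F _ _ _ _ _ (gauss_mx n2 1)
    (fun w => F (col_mx w.1 w.2))) => //.
  by apply: measurableT_comp => //; exact: measurable_col_mx.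
- by move=> x; exact: integral_ge0.
apply: eq_integral => x _; rewrite -[RHS]i2//.
  apply: eq_integral => y _; rewrite mul_block_col !mul0mx.
  by rewrite addr0 add0r.
by apply: measurableT_comp => //; exact: measurable_col_mx.
Qed.

Lemma gauss_invariantN1 : gauss_invariant ((-1)%:M : 'M[R]_1).
Proof.
split; first by rewrite /orthogonal_mx tr_scalar_mx -scalar_mxM mulrNN mulr1.
move=> F mF F0; rewrite !integral_gauss_mx11//; last first.
  by apply: measurableT_comp => //; exact: measurable_mulmxl.
rewrite -[RHS]ge0_integral_gaussN//; last first.
  by apply: measurableT_comp => //; exact: measurable_scalar_mx11.
by apply: eq_integral => x _; rewrite -scalar_mxM mulN1r.
Qed.

Definition rot_mx (c s : R) : 'M[R]_(1 + 1) :=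
  block_mx c%:M (- s)%:M s%:M c%:M.

Lemma gauss_invariant_rot (c s : R) : c ^+ 2 + s ^+ 2 = 1 ->
  gauss_invariant (rot_mx c s).
Proof.
move=> cs; split.
  rewrite /orthogonal_mx tr_block_mx mulmx_block !tr_scalar_mx -!scalar_mxM.
  rewrite -!raddfD/= -!expr2 cs mulrN mulrC addNr mulNr mulrC addNr.
  by rewrite sqrrN addrC cs raddf0 -scalar_mx_block.
move=> F mF F0.
have to1 (L : 'cV[R]_(1 + 1) -> \bar R) : measurable_fun setT L ->
    (forall x, 0 <= L x)%E -> (\int[gauss_mx (1 + 1) 1]_x L x =
     \int[gauss]_x \int[gauss]_y L (col_mx x%:M y%:M))%E.
  move=> mL L0; rewrite integral_gauss_col_mx// integral_gauss_mx11; last 2 first.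
  - apply: (@measurable_fun_fubini_tonelli_F _ _ _ _ _ (gauss_mx 1 1)
      (fun w => L (col_mx w.1 w.2))) => //.
    by apply: measurableT_comp => //; exact: measurable_col_mx.
  - by move=> x; exact: integral_ge0.
  apply: eq_integral => x _; rewrite integral_gauss_mx11//.
  by apply: measurableT_comp => //; exact: measurable_col_mx.
apply: etrans (to1 _ _ _) _ => //.
  by apply: measurableT_comp => //; exact: measurable_mulmxl.
apply: etrans (esym (to1 F mF F0)).
have mH : measurable_fun [set: R * R] (fun z => F (col_mx z.1%:M z.2%:M)).
  apply: measurableT_comp => //; apply: measurable_col_mx;
    by apply: measurableT_comp => //; exact: measurable_scalar_mx11.
apply: etrans (ge0_integral_gauss_rot cs mH (fun=> F0 _)).
apply: eq_integral => x _; apply: eq_integral => y _; congr F.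
by rewrite mul_block_col -!scalar_mxM -!raddfD/= mulNr.
Qed.

(** Givens elimination: the tail of [v] is first rotated onto one coordinate [b], then a plane
    rotation merges [b] into the leading entry [a]. *)
Lemma gauss_invariant_givens n (v : 'cV[R]_(1 + n)) :
  exists Q r, gauss_invariant Q /\ Q *m v = col_mx r%:M 0.
Proof.
elim: n v => [|n ih] v.
  exists 1%:M, (v 0 0); split; first exact: gauss_invariant1.
  rewrite mul1mx; apply/colP => i; rewrite ord1.
  by rewrite (_ : (0 : 'I_(1 + 0)) = lshift 0 0) ?col_mxEu ?mxE ?eqxx//; exact: val_inj.
have [Q' [b [iQ' Q'v]]] := ih (dsubmx v).
pose a := v 0 0; pose r := Num.sqrt (a ^+ 2 + b ^+ 2).
have usub : usubmx v = a%:M.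
  by apply/matrixP => i j; rewrite !ord1 !mxE eqxx mulr1n; congr (v _ _); apply: val_inj.
have vE : block_mx 1%:M 0 0 Q' *m (v : 'cV[R]_(1 + (1 + n))) = col_mx a%:M (col_mx b%:M 0).
  by rewrite -[v]vsubmxK mul_block_col !mul0mx mul1mx addr0 add0r Q'v usub.
pose B1 : 'M[R]_(1 + (1 + n)) := block_mx 1%:M 0 0 Q'.
have iB : gauss_invariant B1.
  by apply: gauss_invariant_block => //; exact: gauss_invariant1.
(* If [r = 0] there is no angle to rotate by, but then [b = 0] already. *)
have [r0|r0] := eqVneq r 0.
  have : a ^+ 2 + b ^+ 2 == 0.
    by rewrite eq_le -sqrtr_eq0 -/r r0 eqxx addr_ge0 ?sqr_ge0.
  rewrite paddr_eq0 ?sqr_ge0// !sqrf_eq0 => /andP[/eqP a0 /eqP b0].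
  exists B1, a; split => //.
  by rewrite [LHS]vE b0 raddf0 col_mx0.
have r2 : a ^+ 2 + b ^+ 2 = r ^+ 2 by rewrite sqr_sqrtr// addr_ge0 ?sqr_ge0.
have cs : (a / r) ^+ 2 + (- (b / r)) ^+ 2 = 1.
  by rewrite sqrrN !expr_div_n -mulrDl r2 divff// expf_neq0.
pose B2 : 'M[R]_(1 + 1 + n) := block_mx (rot_mx (a / r) (- (b / r))) 0 0 1%:M.
exists (B2 *m (B1 : 'M[R]_(1 + 1 + n))), r; split.
  apply: gauss_invariantM => //; apply: (@gauss_invariant_block (1 + 1) n).
    exact: gauss_invariant_rot.
  exact: gauss_invariant1.
rewrite -mulmxA [X in B2 *m X]vE (@col_mxA _ 1 1 n) castmx_id /B2 mul_block_col !mul0mx.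
rewrite mul1mx addr0 add0r mul_block_col -!scalar_mxM -!raddfD/=.
have -> : a / r * a + - - (b / r) * b = r.
  by apply: (mulIf r0); rewrite -[RHS]expr2 -r2 opprK; field.
have -> : - (b / r) * a + a / r * b = 0 by rewrite mulNr; field.
rewrite raddf0 -[X in _ = col_mx _ X](@col_mx0 _ 1 n).
by rewrite (@col_mxA _ 1 1 n) castmx_id.
Qed.

(** Rotating the first column of [V] onto the first axis leaves an orthogonal matrix, hence with
    corner 1 or -1 and zeros along the rest of the first row; the remaining block is orthogonal and
    smaller. So [V] is a product of plane rotations and sign changes, and no multivariate change of
    variables is needed. *)
Lemma orthogonal_gauss_invariant n (V : 'M[R]_n) :
  orthogonal_mx V -> gauss_invariant V.
Proof.
elim: n V => [|n ih].
  move=> V qV.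
  rewrite (_ : V = 1%:M); first exact: gauss_invariant1.
  by rewrite [LHS]flatmx0 [RHS]flatmx0.
rewrite -[n.+1]/(1 + n)%N => V qV.
have [Q [r [iQ Qv]]] := gauss_invariant_givens (lsubmx V).
pose W := Q *m V.
have qW : orthogonal_mx W by apply: orthogonal_mxM => //; exact: iQ.1.
have LW : lsubmx W = col_mx r%:M 0.
  by rewrite /W -[X in Q *m X]hsubmxK mul_mx_row row_mxKl.
pose w := usubmx (rsubmx W); pose W' := dsubmx (rsubmx W).
have WE : W = block_mx r%:M w 0 W'.
  by rewrite -[LHS]hsubmxK LW -[rsubmx W]vsubmxK -block_mxEh.
move: qW; rewrite /orthogonal_mx WE tr_block_mx mulmx_block trmx0 !mul0mx !mulmx0.
rewrite (scalar_mx_block 1 n) !addr0 tr_scalar_mx => /eq_block_mx[rr rw _ ww].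
have r2 : r ^+ 2 = 1.
  by move/matrixP: rr => /(_ 0 0); rewrite -scalar_mxM !mxE !mulr1n.
have rn0 : r != 0 by apply: contra_eq_neq r2 => ->; rewrite expr0n eq_sym oner_eq0.
have w0 : w = 0.
  by move: rw; rewrite mul_scalar_mx => /eqP; rewrite scalemx_eq0 (negbTE rn0) => /eqP.
have iW : gauss_invariant W.
  rewrite WE w0; apply: gauss_invariant_block; last first.
    by apply: ih; move: ww; rewrite w0 mulmx0 add0r.
  move/eqP: r2; rewrite sqrf_eq1 => /orP[] /eqP ->; first exact: gauss_invariant1.
  exact: gauss_invariantN1.
have -> : V = Q^T *m W by rewrite /W mulmxA iQ.1 mul1mx.
by apply: gauss_invariantM => //; exact: gauss_invariant_tr.
Qed.

(** Columns are independent, so the one-column invariance is applied to one column at a time. *)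
Lemma integral_gauss_mull n l (Q : 'M[R]_n) (F : 'M[R]_(n, l) -> \bar R) :
  orthogonal_mx Q -> measurable_fun setT F -> (forall x, 0 <= F x)%E ->
  (\int[gauss_mx n l]_x F (Q *m x) = \int[gauss_mx n l]_x F x)%E.
Proof.
move=> qQ; elim: l F => [|l ih]; first move=> F _ _.
  by apply: eq_integral => x _; rewrite [Q *m x]thinmx0 [x in RHS]thinmx0.
rewrite -[l.+1]/(1 + l)%N => F mF F0.
have mFQ : measurable_fun setT (fun x : 'M[R]_(n, 1 + l) => F (Q *m x)).
  by apply: measurableT_comp => //; exact: measurable_mulmxl.
apply: etrans (integral_gauss_row_mx mFQ _) _ => //.
apply/esym; apply: etrans (integral_gauss_row_mx mF F0) _; apply/esym.
have mG : measurable_fun setT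
    (fun x : 'cV[R]_n => \int[gauss_mx n l]_y F (row_mx x y))%E.
  apply: (@measurable_fun_fubini_tonelli_F _ _ _ _ _ (gauss_mx n l)
    (fun w => F (row_mx w.1 w.2))) => //.
  by apply: measurableT_comp => //; exact: measurable_row_mx.
apply: etrans ((orthogonal_gauss_invariant qQ).2 _ mG _); last first.
  by move=> x; exact: integral_ge0.
apply: eq_integral => x _.
have mFx : measurable_fun setT (fun y : 'M[R]_(n, l) => F (row_mx (Q *m x) y)).
  by apply: measurableT_comp => //; exact: measurable_row_mx.
apply: etrans (ih _ mFx _) => //.
by apply: eq_integral => y _; rewrite mul_mx_row.
Qed.

Lemma integral_gauss_mulr n l (Q : 'M[R]_l) (F : 'M[R]_(n, l) -> \bar R) :
  orthogonal_mx Q -> measurable_fun setT F -> (forall x, 0 <= F x)%E ->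
  (\int[gauss_mx n l]_x F (x *m Q) = \int[gauss_mx n l]_x F x)%E.
Proof.
move=> qQ mF F0.
have mFQ : measurable_fun setT (fun x : 'M[R]_(n, l) => F (x *m Q)).
  by apply: measurableT_comp => //; exact: measurable_mulmx.
have mFT : measurable_fun setT (fun x : 'M[R]_(l, n) => F x^T).
  by apply: measurableT_comp => //; apply: measurable_trmx.
apply: etrans (integral_gauss_tr mFQ _) _ => //.
apply/esym; apply: etrans (integral_gauss_tr mF F0) _.
apply: etrans (esym (integral_gauss_mull (orthogonal_mx_tr qQ) mFT _)) _ => //.
by apply: eq_integral => x _; rewrite trmx_mul trmxK.
Qed.

(** LQ factorization, by rotating one row at a time. The last [p] columns of [Q] are orthogonal to
    the rows of [M]; in these coordinates the distance to the row space can be read off. *)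
Lemma exists_orthogonal_triangular a p (M : 'M[R]_(a, a + p)) :
  exists Q (L : 'M[R]_a), orthogonal_mx Q /\ M *m Q = row_mx L 0.
Proof.
elim: a M => [|a ih].
  move=> M; exists 1%:M, 0; split; first by rewrite /orthogonal_mx trmx1 mulmx1.
  by rewrite [LHS]flatmx0 [RHS]flatmx0.
rewrite -[a.+1]/(1 + a)%N -[(1 + a + p)%N]/(1 + (a + p))%N => M.
have [Q1 [r [iQ1 Q1v]]] := gauss_invariant_givens (usubmx M)^T.
pose M1 := M *m Q1^T.
have [Q2 [L [qQ2 Q2L]]] := ih (rsubmx (dsubmx M1)).
have M1E : M1 = col_mx (row_mx r%:M 0) (dsubmx M1).
  rewrite -[LHS]vsubmxK; congr col_mx.
  rewrite /M1 -[X in usubmx (X *m _)]vsubmxK.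
  rewrite mul_col_mx col_mxKu -[LHS]trmxK trmx_mul trmxK Q1v tr_col_mx.
  by rewrite tr_scalar_mx trmx0.
pose B : 'M[R]_(1 + (a + p)) := block_mx 1%:M 0 0 Q2.
exists (Q1^T *m B), (block_mx r%:M 0 (lsubmx (dsubmx M1)) L).
split.
  apply: orthogonal_mxM; first by apply: orthogonal_mx_tr; exact: iQ1.1.
  rewrite /orthogonal_mx tr_block_mx mulmx_block !trmx0 !mul0mx !mulmx0 trmx1.
  by rewrite mulmx1 qQ2 !addr0 add0r -scalar_mx_block.
rewrite mulmxA -/M1 {1}M1E mul_col_mx -{1}[dsubmx M1]hsubmxK.
rewrite !mul_row_block Q2L !mul0mx !mulmx0 !mulmx1 !addr0 add0r.
rewrite -[X in row_mx (block_mx _ _ _ _) X]col_mx0 /(block_mx r%:M) -block_mxEh.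
by rewrite -(@row_mx0 _ 1 a p) /block_mx !(@row_mxA _ _ 1 a p) !castmx_id.
Qed.

End OrthogonalInvariance.

(** * Frobenius norm and negative moments *)

Section RealMeasurability.
Context {R : realType} d (T : measurableType d).
Implicit Types f : T -> R.

Lemma measurable_fun_sqrt f :
  measurable_fun setT f -> measurable_fun setT (fun w => Num.sqrt (f w)).
Proof.
move=> mf; apply: (@measurableT_comp _ _ _ _ _ _ (@Num.sqrt R)) => //.
by apply: continuous_measurable_fun; exact: sqrt_continuous.
Qed.

Lemma measurable_fun_inv f :
  measurable_fun setT f -> measurable_fun setT (fun w => (f w)^-1).
Proof.
(* The square is nonnegative, where the real power -1 is the inverse; at a zero of [f] the factor
   [f w] makes both sides 0. *)
move=> mf; have -> : (fun w => (f w)^-1) = fun w => f w * ((f w ^+ 2) `^ (-1)).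
  apply/funext => w; rewrite powR_inv1 ?sqr_ge0// expr2 invfM.
  have [->|fw0] := eqVneq (f w) 0; first by rewrite invr0 !mulr0.
  by rewrite mulVKf.
apply: measurable_funM => //.
apply: (@measurableT_comp _ _ _ _ _ _ (@powR R ^~ (-1))); first exact: measurable_powR.
exact: measurable_funX.
Qed.

Lemma measurable_fun_normX (b : nat) f :
  measurable_fun setT f -> measurable_fun setT (fun w => `|f w| ^+ b).
Proof.
move=> mf; apply: (@measurableT_comp _ _ _ _ _ _ (fun x : R => `|x| ^+ b)) => //.
exact: measurable_normX.
Qed.

Lemma measurable_fun_gauss_density f :
  measurable_fun setT f -> measurable_fun setT (fun w => gauss_density (f w)).
Proof. exact: measurableT_comp (@measurable_gauss_density R). Qed.

End RealMeasurability.

Section FrobeniusNorm.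
Context {R : realType}.
Local Notation fnorm := (@frobenius_norm R _ _).

Lemma frobenius_norm_ge0 m n (M : 'M[R]_(m, n)) : 0 <= fnorm M.
Proof. exact: sqrtr_ge0. Qed.

Lemma frobenius_norm_sqr m n (M : 'M[R]_(m, n)) :
  fnorm M ^+ 2 = \sum_i \sum_j M i j ^+ 2.
Proof.
by rewrite sqr_sqrtr// sumr_ge0// => i _; rewrite sumr_ge0// => j _; rewrite sqr_ge0.
Qed.

Lemma frobenius_norm_sqrE m n (M : 'M[R]_(m, n)) : fnorm M ^+ 2 = \tr (M *m M^T).
Proof.
rewrite frobenius_norm_sqr; apply: eq_bigr => i _; rewrite mxE.
by apply: eq_bigr => j _; rewrite mxE expr2.
Qed.

Lemma frobenius_norm_tr m n (M : 'M[R]_(m, n)) : fnorm M^T = fnorm M.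
Proof.
congr Num.sqrt; rewrite exchange_big; apply: eq_bigr => i _.
by apply: eq_bigr => j _; rewrite mxE.
Qed.

Lemma frobenius_norm_mulr m n (M : 'M[R]_(m, n)) (Q : 'M[R]_n) :
  Q *m Q^T = 1%:M -> fnorm (M *m Q) = fnorm M.
Proof.
move=> qQ; apply/eqP; rewrite -(@eqrXn2 _ 2) ?frobenius_norm_ge0// !frobenius_norm_sqrE.
by rewrite trmx_mul mulmxA -(mulmxA M) qQ mulmx1.
Qed.

Lemma frobenius_norm_mull m n (M : 'M[R]_(m, n)) (Q : 'M[R]_m) :
  Q^T *m Q = 1%:M -> fnorm (Q *m M) = fnorm M.
Proof.
move=> qQ; rewrite -frobenius_norm_tr trmx_mul frobenius_norm_mulr ?frobenius_norm_tr//.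
by rewrite trmxK.
Qed.

Lemma frobenius_norm_sqr_row_mx m n1 n2 (A : 'M[R]_(m, n1)) (B : 'M[R]_(m, n2)) :
  fnorm (row_mx A B) ^+ 2 = fnorm A ^+ 2 + fnorm B ^+ 2.
Proof.
by rewrite !frobenius_norm_sqrE tr_row_mx mul_row_col linearD.
Qed.

Lemma frobenius_norm_sqr_col_mx m1 m2 n (A : 'M[R]_(m1, n)) (B : 'M[R]_(m2, n)) :
  fnorm (col_mx A B) ^+ 2 = fnorm A ^+ 2 + fnorm B ^+ 2.
Proof.
by rewrite -frobenius_norm_tr tr_col_mx frobenius_norm_sqr_row_mx !frobenius_norm_tr.
Qed.

Lemma frobenius_norm0 m n : fnorm (0 : 'M[R]_(m, n)) = 0.
Proof.
by apply/eqP; rewrite -(@eqrXn2 _ 2) ?frobenius_norm_ge0// frobenius_norm_sqrE mul0mx linear0 expr0n.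
Qed.

Lemma frobenius_norm_eq0 m n (M : 'M[R]_(m, n)) : (fnorm M == 0) = (M == 0).
Proof.
apply/eqP/eqP => [M0|->]; last exact: frobenius_norm0.
apply/matrixP => i j; apply/eqP; rewrite mxE -sqrf_eq0.
have : fnorm M ^+ 2 == 0 by rewrite M0 expr0n.
rewrite frobenius_norm_sqr psumr_eq0 => [/allP/(_ i (mem_index_enum _))|k _]; last first.
  by rewrite sumr_ge0// => ? _; exact: sqr_ge0.
rewrite psumr_eq0 => [/allP/(_ j (mem_index_enum _))//|k _].
exact: sqr_ge0.
Qed.

Lemma frobenius_norm_scalar (a : R) : fnorm (a%:M : 'M[R]_1) = `|a|.
Proof.
apply/eqP; rewrite -(@eqrXn2 _ 2) ?frobenius_norm_ge0// frobenius_norm_sqr !big_ord1.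
by rewrite mxE eqxx mulr1n real_normK ?num_real.
Qed.

Lemma measurable_frobenius_norm m n d (T : measurableType d) (X : T -> 'M[R]_(m, n)) :
  measurable_fun setT X -> measurable_fun setT (fun w => fnorm (X w)).
Proof.
move=> /measurable_mxP mX.
apply: measurable_fun_sqrt.
by apply: measurable_sum => i; apply: measurable_sum => j; exact: measurable_funX.
Qed.

End FrobeniusNorm.

(** * Laplace transform and negative moments of the Gaussian norm *)

Section NegativeMoments.
Context {R : realType}.
Local Notation fnorm := (@frobenius_norm R _ _).
Local Notation mu := (@lebesgue_measure R).
Local Notation gauss := (@normal_prob R 0 1).

Lemma gauss_laplace1 (s : R) :
  (\int[gauss]_x (expR (- ((s * x) ^+ 2 / 2)))%:E = (Num.sqrt (1 + s ^+ 2))^-1%:E)%E.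
Proof.
have w0 : 0 < Num.sqrt (1 + s ^+ 2) by rewrite sqrtr_gt0 ltr_pwDl ?sqr_ge0.
have mf : measurable_fun [set: R] (fun x => (expR (- ((s * x) ^+ 2 / 2)))%:E).
  apply/measurable_EFinP; apply: measurableT_comp => //; apply: measurable_funN.
  by apply: measurable_funM => //; apply: measurable_funX; exact: measurable_funM.
apply: etrans (ge0_integral_gauss mf _) _; first by move=> x; rewrite lee_fin expR_ge0.
have := ge0_integral_gauss_scale 0 w0; rewrite gauss_moment0 mule1 expr1 => <-.
apply: eq_integral => x _; rewrite expr0 mul1r -EFinM; congr EFin.
rewrite /gauss_density mulrCA -expRD; congr (_ * expR _).
rewrite !exprMn sqr_sqrtr; last by rewrite addr_ge0 ?sqr_ge0.
by rewrite -opprD -mulrDl; congr (- (_ / _)); ring.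
Qed.

(** Laplace transform of the chi-square law with [N] degrees of freedom, a product over coordinates;
    powers of a square root stand for half-integer exponents. *)
Lemma gauss_laplace N (s : R) :
  (\int[gauss_mx 1 N]_x (expR (- ((s * fnorm x) ^+ 2 / 2)))%:E =
   (Num.sqrt (1 + s ^+ 2) ^- N)%:E)%E.
Proof.
have mf n : measurable_fun [set: 'rV[R]_n] (fun x => (expR (- ((s * fnorm x) ^+ 2 / 2)))%:E).
  apply/measurable_EFinP; apply: measurableT_comp => //; apply: measurable_funN.
  apply: measurable_funM => //; apply: measurable_funX; apply: measurable_funM => //.
  exact: measurable_frobenius_norm.
have f0 n (x : 'rV[R]_n) : (0 <= (expR (- ((s * fnorm x) ^+ 2 / 2)))%:E)%E.
  by rewrite lee_fin expR_ge0.
elim: N => [|N ih].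
  rewrite expr0 invr1 -[RHS](@probability_setT _ _ _ (gauss_mx 1 0)) -[RHS]mul1e.
  rewrite -integral_cst//; apply: eq_integral => x _.
  by rewrite [x]thinmx0 frobenius_norm0 mulr0 expr0n mul0r oppr0 expR0.
apply: etrans (@integral_gauss_row_mx _ 1 1 N _ (mf _) (f0 _)) _.
set w := Num.sqrt _ in ih *.
transitivity (\int[gauss_mx 1 1]_x ((expR (- ((s * fnorm x) ^+ 2 / 2)))%:E * (w ^- N)%:E))%E.
  apply: eq_integral => x _; rewrite -ih -ge0_integralZl//; last exact: mf.
  apply: eq_integral => y _; rewrite -EFinM -expRD; congr (expR _)%:E.
  by rewrite !exprMn frobenius_norm_sqr_row_mx; field.
rewrite ge0_integralZr//; last 2 first.
- exact: mf.
- by rewrite lee_fin invr_ge0 exprn_ge0// sqrtr_ge0.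
apply: etrans (congr1 (fun z => z * _)%E (integral_gauss_mx11 (mf _) (f0 _))) _.
transitivity (w^-1%:E * (w ^- N)%:E)%E; last by rewrite -EFinM exprS invfM.
congr (_ * _)%E; rewrite -gauss_laplace1; apply: eq_integral => x _.
by rewrite frobenius_norm_scalar !exprMn real_normK ?num_real.
Qed.

(* [`|x| ^- b] is, up to a constant, the integral over [s] of
   [`|s| ^+ b.-1 * expR (- (s * `|x|) ^+ 2 / 2)]; by Tonelli the left side reduces to
   [gauss_laplace], whose value [(1 + s ^+ 2) ^ (- N / 2)] is in turn written as a
   Gaussian integral of [`|r| ^+ N.-1] and integrated over [s] first. *)
Lemma gauss_negative_moment N b : (0 < b)%N -> (b < N)%N ->
  ((\int[gauss_mx 1 N]_x (fnorm x ^- b)%:E) * gauss_moment R N.-1 <=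
   gauss_moment R (N.-1 - b))%E.
Proof.
move=> b0 bN; pose c := @normal_peak R 1.
have c0 : 0 <= c by exact: normal_peak_ge0.
have gE x : gauss_density x = c * expR (- (x ^+ 2 / 2)) :> R by [].
pose w (s : R) := Num.sqrt (1 + s ^+ 2).
have w0 s : 0 < w s by rewrite sqrtr_gt0 ltr_pwDl ?sqr_ge0.
have mb1 := gauss_moment_gt0 b.-1 : (0 < gauss_moment R b.-1)%E.
have mb2 := gauss_moment_lty b.-1 : (gauss_moment R b.-1 < +oo)%E.
have mg := @measurable_gauss_density R.
have mX := @measurable_normX R.
have mN : measurable_fun [set: 'rV[R]_N] (fun x => fnorm x).
  exact: measurable_frobenius_norm.
(* Only an inequality, because at [q = 0] the convention [0^-1 = 0] makes the left side vanish. *)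
have scl q : 0 <= q -> ((q ^- b)%:E * gauss_moment R b.-1 <=
    \int[mu]_s (`|s| ^+ b.-1 * gauss_density (q * s))%:E)%E.
  rewrite le_eqVlt => /predU1P[<-|q0].
    rewrite expr0n gtn_eqF// invr0 mul0e; apply: integral_ge0 => s _.
    by rewrite lee_fin mulr_ge0 ?exprn_ge0 ?gauss_density_ge0.
  by rewrite ge0_integral_gauss_scale// prednK.
pose I := (\int[mu]_s (`|s| ^+ b.-1 * (c * w s ^- N))%:E)%E.
have step1 : ((\int[gauss_mx 1 N]_x (fnorm x ^- b)%:E) * gauss_moment R b.-1 <= I)%E.
  have mK : measurable_fun [set: 'rV[R]_N * R]
      (fun z => (`|z.2| ^+ b.-1 * gauss_density (fnorm z.1 * z.2))%:E).
    apply/measurable_EFinP; apply: measurable_funM; first exact: measurable_fun_normX.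
    apply: measurable_fun_gauss_density; apply: measurable_funM => //.
    exact: measurableT_comp.
  have K0 (z : 'rV[R]_N * R) :
      (0 <= (`|z.2| ^+ b.-1 * gauss_density (fnorm z.1 * z.2))%:E)%E.
    by rewrite lee_fin mulr_ge0 ?exprn_ge0 ?gauss_density_ge0.
  have mV : measurable_fun [set: 'rV[R]_N] (fun x => (fnorm x ^- b)%:E).
    apply/measurable_EFinP; apply: measurable_fun_inv; exact: measurable_funX.
  have V0 (x : 'rV[R]_N) : (0 <= (fnorm x ^- b)%:E)%E.
    by rewrite lee_fin invr_ge0 exprn_ge0// frobenius_norm_ge0.
  apply: (@le_trans _ _ (\int[gauss_mx 1 N]_x \int[mu]_s
      (`|s| ^+ b.-1 * gauss_density (fnorm x * s))%:E)%E).
    rewrite -ge0_integralZr//; last exact: ltW.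
    apply: ge0_le_integral => //.
    - by move=> x _; rewrite mule_ge0// ltW.
    - by apply: emeasurable_funM.
    - exact: (@measurable_fun_fubini_tonelli_F _ _ _ _ _ mu _ mK K0).
    - by move=> x _; apply: scl; exact: frobenius_norm_ge0.
  rewrite le_eqVlt; apply/orP; left; apply/eqP.
  apply: etrans (fubini_tonelli (m1 := gauss_mx 1 N) (m2 := mu) _ mK K0) _.
  apply: eq_integral => s _ /=; rewrite mulrA EFinM -(gauss_laplace N s).
  rewrite -ge0_integralZl//.
  - apply: eq_integral => x _; rewrite -EFinM; congr EFin.
    by rewrite gE mulrA [in RHS](mulrC s).
  - apply/measurable_EFinP; apply: measurableT_comp => //; apply: measurable_funN.
    by apply: measurable_funM => //; apply: measurable_funX; exact: measurable_funM.
  - by rewrite lee_fin mulr_ge0 ?exprn_ge0.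
have step2 : (I * gauss_moment R N.-1 <= gauss_moment R (N.-1 - b) * gauss_moment R b.-1)%E.
  have mK : measurable_fun [set: R * R] (fun z => (`|z.1| ^+ b.-1 *
      (`|z.2| ^+ N.-1 * (gauss_density z.2 * gauss_density (`|z.2| * z.1))))%:E).
    apply/measurable_EFinP; apply: measurable_funM; first exact: measurable_fun_normX.
    apply: measurable_funM; first exact: measurable_fun_normX.
    apply: measurable_funM; apply: measurable_fun_gauss_density => //.
    apply: measurable_funM => //; exact: (@measurable_fun_normX _ _ _ 1).
  have K0 (z : R * R) : (0 <= (`|z.1| ^+ b.-1 *
      (`|z.2| ^+ N.-1 * (gauss_density z.2 * gauss_density (`|z.2| * z.1))))%:E)%E.
    by rewrite lee_fin !mulr_ge0 ?exprn_ge0 ?gauss_density_ge0.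
  have mw : measurable_fun [set: R] w.
    by apply: measurable_fun_sqrt; apply: measurable_funD => //; exact: measurable_funX.
  have -> : (I * gauss_moment R N.-1 = \int[mu]_s \int[mu]_r (`|s| ^+ b.-1 *
      (`|r| ^+ N.-1 * (gauss_density r * gauss_density (`|r| * s))))%:E)%E.
    rewrite -ge0_integralZr//; last 3 first.
    - apply/measurable_EFinP; apply: measurable_funM; first exact: mX.
      by apply: measurable_funM => //; apply: measurable_fun_inv; exact: measurable_funX.
    - by move=> s _; rewrite lee_fin !mulr_ge0 ?exprn_ge0// invr_ge0 exprn_ge0// ltW.
    - exact: gauss_moment_ge0.
    apply: eq_integral => s _; rewrite mulrA EFinM -muleA.
    have := ge0_integral_gauss_scale N.-1 (w0 s); rewrite prednK ?(ltn_trans b0)// => <-.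
    rewrite -ge0_integralZl//.
    - apply: eq_integral => r _; rewrite -EFinM; congr EFin.
      rewrite -mulrA; congr (_ * _); rewrite mulrCA; congr (_ * _).
      (* The identity [(1 + s ^+ 2) * r ^+ 2 = r ^+ 2 + (r * s) ^+ 2] splits the density at
         [w s * r] into one factor in [r] and one in [|r| * s]; the latter is what the integral over
         [s] evaluates. *)
      rewrite !gE mulrACA -expRD -mulrA; congr (_ * (_ * expR _)).
      rewrite !exprMn sqr_sqrtr ?addr_ge0 ?sqr_ge0// real_normK ?num_real//.
      by rewrite -opprD -mulrDl; congr (- (_ / _)); ring.
    - apply/measurable_EFinP; apply: measurable_funM; first exact: mX.
      by apply: measurable_fun_gauss_density; exact: measurable_funM.
    - by move=> r _; rewrite lee_fin mulr_ge0 ?exprn_ge0 ?gauss_density_ge0.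
    - by rewrite lee_fin mulr_ge0 ?exprn_ge0.
  apply: (le_trans (_ : _ <= \int[mu]_r \int[mu]_s (`|s| ^+ b.-1 *
      (`|r| ^+ N.-1 * (gauss_density r * gauss_density (`|r| * s))))%:E)%E).
    by rewrite (fubini_tonelli (m1 := mu) (m2 := mu) _ mK K0).
  rewrite gauss_momentE -ge0_integralZr//; last 3 first.
  - by apply/measurable_EFinP; apply: measurable_funM; [exact: mX|exact: mg].
  - by move=> r _; rewrite lee_fin mulr_ge0 ?exprn_ge0 ?gauss_density_ge0.
  - exact: gauss_moment_ge0.
  apply: ge0_le_integral => //.
  - by move=> r _; apply: integral_ge0 => s _; exact: (K0 (s, r)).
  - exact: (@measurable_fun_fubini_tonelli_G _ _ _ _ _ mu _ mK K0).
  - by apply: emeasurable_funM => //; apply/measurable_EFinP; apply: measurable_funM; [exact: mX|exact: mg].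
  move=> r _.
  apply: (@le_trans _ _ (\int[mu]_s ((`|r| ^+ N.-1 * gauss_density r)%:E *
    (`|s| ^+ b.-1 * gauss_density (`|r| * s))%:E))%E).
    rewrite le_eqVlt; apply/orP; left; apply/eqP; apply: eq_integral => s _.
    by rewrite -EFinM; congr EFin; ring.
  rewrite ge0_integralZl//; last 3 first.
  - apply/measurable_EFinP; apply: measurable_funM; first exact: mX.
    by apply: measurable_fun_gauss_density; exact: measurable_funM.
  - by move=> s _; rewrite lee_fin mulr_ge0 ?exprn_ge0 ?gauss_density_ge0.
  - by rewrite lee_fin mulr_ge0 ?exprn_ge0 ?gauss_density_ge0.
  have [->|r0] := eqVneq r 0.
    have N1 : (N.-1 == 0)%N = false by lia.
    rewrite normr0 [X in (X * _)%:E](expr0n _ N.-1) N1 mul0r mul0e mule_ge0 ?(ltW mb1)//.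
    by rewrite lee_fin mulr_ge0 ?exprn_ge0 ?gauss_density_ge0.
  rewrite ge0_integral_gauss_scale ?normr_gt0// prednK// muleA -EFinM.
  rewrite lee_wpmul2r ?(ltW mb1)// lee_fin.
  have bN1 : (b <= N.-1)%N by rewrite -ltnS prednK// (ltn_trans b0).
  have rb0 : `|r| ^+ b != 0 by rewrite expf_neq0// normr_eq0.
  rewrite le_eqVlt; apply/orP; left; apply/eqP.
  by rewrite -{1}(subnK bN1) exprD; field.
(* The auxiliary moment of order [b.-1] occurs on both sides and cancels, being positive and
   finite. *)
have bfin : gauss_moment R b.-1 \is a fin_num by rewrite ge0_fin_numE// ltW.
rewrite -(lee_pmul2r bfin mb1) muleAC; apply: le_trans step2.
by rewrite lee_wpmul2r// gauss_moment_ge0.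
Qed.

End NegativeMoments.

Section GaussianMatrixLaws.
Context {R : realType}.
Local Notation fnorm := (@frobenius_norm R _ _).
Local Notation gauss := (@normal_prob R 0 1).

Lemma gauss_prob_set1 (x : R) : gauss [set x] = 0%E.
Proof. by rewrite /normal_prob integral_set1. Qed.

Lemma gauss_mx_set0 n : (0 < n)%N -> gauss_mx 1 n [set (0 : 'rV[R]_n)] = 0%E.
Proof.
case: n => // n _.
have -> : [set 0 : 'rV[R]_n.+1] = id @^-1` mx_box (fun _ _ => [set 0]).
  apply/seteqP; split => [M /= -> i j|M /= M0]; first by rewrite mxE.
  by apply/matrixP => i j; rewrite mxE; exact: M0.
rewrite (gauss_mxP 1 n.+1).2// big_ord1 big_ord_recl.
by rewrite [X in (X * _)%E]gauss_prob_set1 mul0e.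
Qed.

Lemma is_gaussian_row m n (i : 'I_m) :
  is_gaussian (gauss_mx m n) (fun M : 'M[R]_(m, n) => row i M).
Proof.
split.
  apply/measurable_mxP => i' j; under eq_fun do rewrite mxE.
  exact: measurable_mx_entry.
move=> B mB.
have -> : (fun M : 'M[R]_(m, n) => row i M) @^-1` mx_box B =
    id @^-1` mx_box (fun i' j => if i' == i then B 0 j else setT).
  apply/seteqP; split => M /= BM i' j.
    by case: eqP => // ->; have := BM 0 j; rewrite mxE.
  by rewrite ord1 mxE; have := BM i j; rewrite eqxx.
rewrite (gauss_mxP m n).2; last by move=> i' j; case: ifP.
rewrite big_ord1 (bigD1 i)//= [X in (_ * X)%E]big1 ?mule1//.
  by apply: eq_bigr => j _; rewrite eqxx.
move=> i' /negbTE ->; apply: big1 => j _; exact: probability_setT.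
Qed.

(** A rotation taking [c] to a multiple of the first axis turns the linear form into [fnorm c] times
    one standard Gaussian, up to sign. *)
Lemma gauss_moment_linear l b (c : 'cV[R]_l) :
  (\int[gauss_mx 1 l]_x (`|(x *m c) 0 0| ^+ b)%:E =
   (fnorm c ^+ b)%:E * gauss_moment R b)%E.
Proof.
case: l c => [|l] c.
  rewrite [c]flatmx0 frobenius_norm0.
  under eq_integral do rewrite mulmx0 mxE normr0.
  rewrite integral_cst// [X in (_ * X)%E]probability_setT mule1.
  case: b => [|b]; first by rewrite gauss_moment0 mule1.
  by rewrite expr0n mul0e.
move: c; rewrite -[l.+1]/(1 + l)%N => c.
have [Q [r [iQ Qc]]] := gauss_invariant_givens c.
have qQ := iQ.1.
have cr : fnorm c = `|r|.
  rewrite -(frobenius_norm_mull c qQ) Qc; apply/eqP.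
  rewrite -(@eqrXn2 _ 2) ?frobenius_norm_ge0// frobenius_norm_sqr_col_mx.
  by rewrite frobenius_norm0 expr0n addr0 frobenius_norm_scalar.
have mF m (v : 'cV[R]_m) :
    measurable_fun [set: 'rV[R]_m] (fun x => (`|(x *m v) 0 0| ^+ b)%:E).
  apply/measurable_EFinP; apply: measurable_fun_normX.
  apply: (measurableT_comp (@measurable_mx_entry R 1 1 0 0)).
  exact: measurable_mulmx.
have F0 m (v : 'cV[R]_m) (x : 'rV[R]_m) : (0 <= (`|(x *m v) 0 0| ^+ b)%:E)%E.
  by rewrite lee_fin exprn_ge0.
apply: etrans (esym (integral_gauss_mulr qQ (mF _ c) (F0 _ c))) _.
transitivity (\int[gauss_mx 1 (1 + l)]_x (`|(x *m col_mx r%:M 0) 0 0| ^+ b)%:E)%E.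
  by apply: eq_integral => x _; rewrite -Qc mulmxA.
apply: etrans (integral_gauss_row_mx (mF _ _) (F0 _ _)) _.
transitivity (\int[gauss_mx 1 1]_x (`|(x *m (r%:M : 'M[R]_1)) 0 0| ^+ b)%:E)%E.
  apply: eq_integral => x _.
  under eq_integral do rewrite mul_row_col mulmx0 addr0.
  by rewrite integral_cst// [X in (_ * X)%E]probability_setT mule1.
apply: etrans (integral_gauss_mx11 (mF _ _) (F0 _ _)) _.
rewrite cr /gauss_moment -ge0_integralZl//.
- apply: eq_integral => x _; rewrite -scalar_mxM mxE eqxx mulr1n normrM exprMn.
  by rewrite EFinM muleC.
- by apply/measurable_EFinP; exact: measurable_normX.
Qed.

(** Independence is used with the full index set, first among the columns and then inside each of
    them. *)
Lemma std_gaussian_mx_is_gaussian d (T : measurableType d) (P : probability T R)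
    m n (G : T -> 'M[R]_(m, n)) : std_gaussian_mx P G -> is_gaussian P G.
Proof.
move=> [Gcol Gind].
have cE (M : 'M[R]_(m, n)) i j : tnth (col_tuple M j) i = M i j.
  by rewrite tnth_mktuple.
split.
  apply/measurable_mxP => i j; have [+ _] := Gcol j.
  move=> /(_ i)[mG _]; apply: eq_measurable_fun mG => w _; exact: cE.
move=> B mB; rewrite exchange_big/=.
pose C (j : 'I_n) : set (m.-tuple R) := [set t | forall i, B i j (tnth t i)].
have CE j : C j = \bigcap_(i in [set: 'I_m]) ((fun t => tnth t i) @^-1` B i j).
  by apply/seteqP; split => [t Ct i _|t Ct i]; exact: Ct.
have mC j : measurable (C j).
  rewrite CE; apply: fin_bigcap_measurable => // i _.
  by rewrite -[X in measurable X]setTI; exact: measurable_tnth.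
have := Gind [set: 'I_n]%SET C mC.
have -> : \bigcap_(j in [set` [set: 'I_n]%SET]) ((fun w => col_tuple (G w) j) @^-1` C j)
   = G @^-1` mx_box B.
  apply/seteqP; split => [w Cw i j|w Bw j _ i]; last by rewrite cE; exact: Bw.
  by have := Cw j; rewrite /= inE => /(_ isT)/(_ i); rewrite cE.
move=> ->; apply: eq_big => [j|j _]; first by rewrite finset.in_setT.
have [Gstd Gi] := Gcol j.
have := Gi [set: 'I_m]%SET (fun i => B i j) (fun i => mB i j).
have -> : \bigcap_(i in [set` [set: 'I_m]%SET])
    ((fun w => tnth (col_tuple (G w) j) i) @^-1` B i j)
   = (fun w => col_tuple (G w) j) @^-1` C j.
  apply/seteqP; split => [w Cw i|w Bw i _]; last exact: Bw.
  by have := Cw i; rewrite /= inE => /(_ isT).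
move=> ->; apply: eq_big => [i|i _]; first by rewrite finset.in_setT.
by have [_ ->] := Gstd i.
Qed.

End GaussianMatrixLaws.

(** * Gram determinants and right inverses *)

Section RightInverse.
Context {R : realType}.
Local Notation fnorm := (@frobenius_norm R _ _).

Definition gram m n (W : 'M[R]_(m, n)) : 'M[R]_m := W *m W^T.

(* On matrices without full row rank the inverse of the determinant is [0], so
   [right_inv W = 0]; being rational, it is measurable everywhere. *)
Definition right_inv m n (W : 'M[R]_(m, n)) : 'M[R]_(n, m) :=
  W^T *m ((\det (gram W))^-1 *: \adj (gram W)).

Lemma mulmx_right_inv m n (W : 'M[R]_(m, n)) :
  \det (gram W) != 0 -> W *m right_inv W = 1%:M.
Proof.
by move=> d0; rewrite mulmxA -scalemxAr mul_mx_adj scale_scalar_mx mulVf.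
Qed.

Lemma right_inv_invmx m n (W : 'M[R]_(m, n)) :
  \det (gram W) != 0 -> right_inv W = W^T *m invmx (gram W).
Proof. by move=> d0; rewrite /right_inv /invmx unitmxE unitfE d0. Qed.

Lemma right_inv0 m n (W : 'M[R]_(m, n)) : \det (gram W) = 0 -> right_inv W = 0.
Proof. by move=> d0; rewrite /right_inv d0 invr0 scale0r mulmx0. Qed.

(** The columns of the right inverse have the inverse of [gram W] as Gram matrix, whose diagonal is
    given by Cramer's rule. The formula survives the singular case, where both sides are 0. *)
Lemma frobenius_norm_sqr_col_right_inv m n (W : 'M[R]_(m, n)) j :
  fnorm (col j (right_inv W)) ^+ 2 = \adj (gram W) j j / \det (gram W).
Proof.
have [d0|d0] := eqVneq (\det (gram W)) 0.
  by rewrite right_inv0// col0 frobenius_norm0 expr0n d0 invr0 mulr0.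
set S := (\det (gram W))^-1 *: \adj (gram W).
have KS : gram W *m S = 1%:M.
  by rewrite -scalemxAr mul_mx_adj scale_scalar_mx mulVf.
have CC : (right_inv W)^T *m right_inv W = S^T.
  by rewrite /right_inv -/S trmx_mul trmxK mulmxA -(mulmxA S^T) -(mulmxA S^T) KS mulmx1.
rewrite frobenius_norm_sqr.
transitivity (((right_inv W)^T *m right_inv W) j j).
  rewrite [RHS]mxE; apply: eq_bigr => i _; rewrite big_ord1 !mxE expr2; congr (_ * _);
  by rewrite !mxE.
by rewrite CC !mxE mulrC.
Qed.

Lemma adj_gram_col_mx a n (y : 'rV[R]_n) (M : 'M[R]_(a, n)) :
  \adj (gram (col_mx y M)) 0 0 = \det (gram M).
Proof.
rewrite mxE /cofactor addn0 expr0 mul1r; congr (\det _).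
apply/matrixP => i j; rewrite /gram tr_col_mx mul_col_row 2!mxE.
have lE (k : 'I_a) : lift 0 k = rshift 1 k :> 'I_(1 + a) by apply: val_inj.
by rewrite !lE block_mxEdr.
Qed.

Lemma det_gram_mulr m n (W : 'M[R]_(m, n)) (Q : 'M[R]_n) :
  orthogonal_mx Q -> gram (W *m Q) = gram W.
Proof.
move=> qQ; rewrite /gram trmx_mul mulmxA -(mulmxA W) orthogonal_mx_unit//.
by rewrite mulmx1.
Qed.

(* With [M *m Q = [L 0]], the squared distance from [y] to the row space of [M]
   is the squared norm of the last columns of [y *m Q]. *)
Lemma det_gram_col_mx a p (y : 'rV[R]_(a + p)) (M : 'M[R]_(a, a + p)) Q L :
  orthogonal_mx Q -> M *m Q = row_mx L 0 -> \det (gram M) != 0 ->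
  \det (gram (col_mx y M)) = fnorm (rsubmx (y *m Q)) ^+ 2 * \det (gram M).
Proof.
move=> qQ MQ dM; rewrite -(det_gram_mulr (col_mx y M) qQ) -(det_gram_mulr M qQ).
rewrite mul_col_mx MQ -[y *m Q]hsubmxK row_mxKr.
set y1 := lsubmx _; set y2 := rsubmx _.
have gL : gram (row_mx L (0 : 'M[R]_(a, p))) = L *m L^T.
  by rewrite /gram tr_row_mx mul_row_col trmx0 mulmx0 addr0.
have uL : L \in unitmx.
  move: dM; rewrite -(det_gram_mulr M qQ) MQ gL det_mulmx det_tr mulf_eq0 orbb.
  by rewrite unitmxE unitfE.
pose E : 'M[R]_(1 + a) := block_mx 1%:M (- y1 *m invmx L) 0 1%:M.
have dE : \det E = 1 by rewrite det_ublock !det1 mulr1.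
have EW : E *m col_mx (row_mx y1 y2) (row_mx L 0) = col_mx (row_mx 0 y2) (row_mx L 0).
  rewrite mul_block_col !mul1mx mul0mx add0r mul_mx_row -mulmxA mulVmx// mulmx1 mulmx0.
  by rewrite add_row_mx subrr addr0.
have -> : \det (gram (col_mx (row_mx y1 y2) (row_mx L 0))) =
    \det (gram (col_mx (row_mx 0 y2) (row_mx L (0 : 'M[R]_(a, p))))).
  rewrite -EW /gram trmx_mul mulmxA -(mulmxA E) !det_mulmx det_tr dE mul1r.
  by rewrite mulr1.
rewrite gL /gram tr_col_mx !tr_row_mx mul_col_row !mul_row_col !trmx0.
rewrite !mulmx0 !mul0mx !addr0 !add0r det_ublock; congr (_ * _).
by rewrite frobenius_norm_sqrE det_mx11 /mxtrace big_ord1.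
Qed.

(** The ratio of the two Gram determinants is the squared distance from [y] to the row space of [M].
    For Gaussian [y] this distance is the norm of a Gaussian vector with [p] coordinates. *)
Lemma frobenius_norm_col_right_inv a p (y : 'rV[R]_(a + p)) (M : 'M[R]_(a, a + p)) Q L :
  orthogonal_mx Q -> M *m Q = row_mx L 0 -> \det (gram M) != 0 ->
  fnorm (col 0 (right_inv (col_mx y M))) = (fnorm (rsubmx (y *m Q)))^-1.
Proof.
move=> qQ MQ dM; apply/eqP.
rewrite -(@eqrXn2 _ 2) ?invr_ge0 ?frobenius_norm_ge0//.
rewrite frobenius_norm_sqr_col_right_inv adj_gram_col_mx (det_gram_col_mx y qQ MQ dM).
by rewrite invfM mulrCA divff// mulr1 exprVn.
Qed.

Lemma frobenius_norm_col_right_inv_eq0 a n (y : 'rV[R]_n) (M : 'M[R]_(a, n)) :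
  \det (gram M) = 0 -> fnorm (col 0 (right_inv (col_mx y M))) = 0.
Proof.
move=> dM; apply/eqP; rewrite -sqrf_eq0 frobenius_norm_sqr_col_right_inv.
by rewrite adj_gram_col_mx dM mul0r.
Qed.

Lemma invmx_conj_orthogonal m (Q K : 'M[R]_m) :
  orthogonal_mx Q -> K \in unitmx -> invmx (Q *m K *m Q^T) = Q *m invmx K *m Q^T.
Proof.
move=> qQ uK; have qQ' := orthogonal_mx_unit qQ.
have e : Q *m K *m Q^T *m (Q *m invmx K *m Q^T) = 1%:M.
  by rewrite !mulmxA -(mulmxA _ Q^T Q) qQ mulmx1 mulmxK.
have [u _] := mulmx1_unit e.
by apply: (can_inj (mulKmx u)); rewrite mulmxV// e.
Qed.

(** Applied to a transposition of rows, it exchanges columns of the right inverse and so reduces any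
    column to the first. *)
Lemma right_inv_mull m n (Q : 'M[R]_m) (W : 'M[R]_(m, n)) :
  orthogonal_mx Q -> right_inv (Q *m W) = right_inv W *m Q^T.
Proof.
move=> qQ; have qQ' := orthogonal_mx_unit qQ.
have gQ : gram (Q *m W) = Q *m gram W *m Q^T by rewrite /gram trmx_mul !mulmxA.
have dQ : \det (gram (Q *m W)) = \det (gram W).
  by rewrite gQ !det_mulmx mulrAC -det_mulmx qQ' det1 mul1r.
have [d0|d0] := eqVneq (\det (gram W)) 0.
  by rewrite !right_inv0 ?dQ// mul0mx.
rewrite !right_inv_invmx ?dQ// trmx_mul -!mulmxA; congr (_ *m _).
have uK : gram W \in unitmx by rewrite unitmxE unitfE.
rewrite gQ invmx_conj_orthogonal//.
by rewrite !mulmxA qQ mul1mx.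
Qed.

Lemma measurable_gram m n : measurable_fun setT (@gram m n).
Proof. by apply: measurable_mulmx => //; apply: measurable_trmx. Qed.

Lemma measurable_right_inv m n : measurable_fun setT (@right_inv m n).
Proof.
apply: measurable_mulmx; first exact: measurable_trmx.
apply/measurable_mxP => i j; under eq_fun do rewrite mxE.
apply: measurable_funM.
  by apply: measurable_fun_inv; apply: measurable_determinant; exact: measurable_gram.
apply: (measurableT_comp (@measurable_mx_entry R m m i j)).
by apply: measurable_adjugate; exact: measurable_gram.
Qed.

Lemma measurable_col m n j : measurable_fun setT (fun M : 'M[R]_(m, n) => col j M).
Proof.
by apply/measurable_mxP => i k; under eq_fun do rewrite mxE; exact: measurable_mx_entry.
Qed.

End RightInverse.

(** * Moments of the right inverse and almost sure full row rank *)

Section InverseMoments.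
Context {R : realType}.
Local Notation fnorm := (@frobenius_norm R _ _).

Lemma measurable_col_right_inv_normX k l b j :
  measurable_fun [set: 'M[R]_(k, l)] (fun W => (fnorm (col j (right_inv W)) ^+ b)%:E).
Proof.
apply/measurable_EFinP; apply: measurable_funX; apply: measurable_frobenius_norm.
by apply: measurableT_comp; [exact: measurable_col|exact: measurable_right_inv].
Qed.

Lemma measurable_rsubmx m n1 n2 :
  measurable_fun setT (fun M : 'M[R]_(m, n1 + n2) => rsubmx M).
Proof.
by apply/measurable_mxP => i k; under eq_fun do rewrite mxE; exact: measurable_mx_entry.
Qed.

Lemma integral_gauss_rsubmx n1 n2 (F : 'rV[R]_n2 -> \bar R) :
  measurable_fun setT F -> (forall x, 0 <= F x)%E ->
  (\int[gauss_mx 1 (n1 + n2)]_y F (rsubmx y) = \int[gauss_mx 1 n2]_y F y)%E.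
Proof.
move=> mF F0.
have mFr : measurable_fun setT (fun y : 'rV[R]_(n1 + n2) => F (rsubmx y)).
  by apply: measurableT_comp => //; exact: measurable_rsubmx.
apply: etrans (integral_gauss_row_mx mFr (fun=> F0 _)) _.
transitivity (\int[gauss_mx 1 n1]_x (cst (\int[gauss_mx 1 n2]_y F y) x))%E.
  apply: eq_integral => x _; apply: eq_integral => y _.
  by rewrite row_mxKr.
by rewrite integral_cst// [X in (_ * X)%E]probability_setT mule1.
Qed.

(** The first row [y] is integrated with the others, [M], held fixed: after rotation by [Q] the
    integrand depends on the last [p] coordinates alone, and [gauss_negative_moment] applies. A
    singular [M] contributes 0. *)
Lemma gauss_inverse_moment0 a p b : (0 < b)%N -> (b < p)%N ->
  ((\int[gauss_mx (1 + a) (a + p)]_W (fnorm (col 0 (right_inv W)) ^+ b)%:E)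
     * gauss_moment R p.-1 <= gauss_moment R (p.-1 - b))%E.
Proof.
move=> b0 bp; apply: le_trans (gauss_negative_moment b0 bp).
rewrite lee_wpmul2r ?gauss_moment_ge0//.
have mF := @measurable_col_right_inv_normX (1 + a) (a + p) b 0.
have F0 (W : 'M[R]_(1 + a, a + p)) : (0 <= (fnorm (col 0 (right_inv W)) ^+ b)%:E)%E.
  by rewrite lee_fin exprn_ge0// frobenius_norm_ge0.
have mV : measurable_fun [set: 'rV[R]_p] (fun x => (fnorm x ^- b)%:E).
  apply/measurable_EFinP; apply: measurable_fun_inv; apply: measurable_funX.
  exact: measurable_frobenius_norm.
have V0 (x : 'rV[R]_p) : (0 <= (fnorm x ^- b)%:E)%E.
  by rewrite lee_fin invr_ge0 exprn_ge0// frobenius_norm_ge0.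
apply: (le_trans (_ : _ <= \int[gauss_mx a (a + p)]_M
    (cst (\int[gauss_mx 1 p]_x (fnorm x ^- b)%:E) M))%E); last first.
  by rewrite integral_cst// [X in (_ * X)%E]probability_setT mule1.
rewrite (integral_gauss_col_mx_swap mF F0); apply: ge0_le_integral => //.
- by move=> M _; exact: integral_ge0.
- apply: (@measurable_fun_fubini_tonelli_G _ _ _ _ _ (gauss_mx 1 (a + p))
    (fun w => (fnorm (col 0 (right_inv (col_mx w.1 w.2))) ^+ b)%:E)) => //.
  by apply: (measurableT_comp mF); exact: measurable_col_mx.
- move=> M _; have [dM|dM] := eqVneq (\det (gram M)) 0.
    rewrite integral0_eq ?integral_ge0// => y _.
    by rewrite frobenius_norm_col_right_inv_eq0// expr0n gtn_eqF.
  have [Q [L [qQ MQ]]] := exists_orthogonal_triangular M.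
  rewrite le_eqVlt; apply/orP; left; apply/eqP.
  transitivity (\int[gauss_mx 1 (a + p)]_y (fnorm (rsubmx (y *m Q)) ^- b)%:E)%E.
    apply: eq_integral => y _.
    by rewrite (frobenius_norm_col_right_inv y qQ MQ dM) exprVn.
  apply: etrans (integral_gauss_mulr qQ (F := fun y => (fnorm (rsubmx y) ^- b)%:E) _ _) _ => //.
    by apply: (measurableT_comp mV); exact: measurable_rsubmx.
  exact: etrans (@integral_gauss_rsubmx a p _ mV V0) _.
Qed.

Lemma gauss_inverse_moment a p b j : (0 < b)%N -> (b < p)%N ->
  ((\int[gauss_mx (1 + a) (a + p)]_W (fnorm (col j (right_inv W)) ^+ b)%:E)
     * gauss_moment R p.-1 <= gauss_moment R (p.-1 - b))%E.
Proof.
move=> b0 bp; apply: le_trans (gauss_inverse_moment0 a b0 bp).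
rewrite lee_wpmul2r ?gauss_moment_ge0// le_eqVlt; apply/orP; left; apply/eqP.
pose Q : 'M[R]_(1 + a) := tperm_mx 0 j.
have qQ : orthogonal_mx Q.
  by rewrite /orthogonal_mx /Q tr_tperm_mx /tperm_mx -perm_mxM tperm2 perm_mx1.
have mF := @measurable_col_right_inv_normX (1 + a) (a + p) b j.
apply: etrans (esym (integral_gauss_mull qQ mF _)) _.
  by move=> W; rewrite lee_fin exprn_ge0// frobenius_norm_ge0.
apply: eq_integral => W _; congr ((fnorm _ ^+ _)%:E).
rewrite right_inv_mull// /Q tr_tperm_mx -xcolE.
by apply/colP => i; rewrite !mxE tpermR.
Qed.

Lemma measurable_det_gram0 m n :
  measurable [set W : 'M[R]_(m, n) | \det (gram W) = 0].
Proof.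
have md : measurable_fun setT (fun W : 'M[R]_(m, n) => \det (gram W)).
  by apply: measurable_determinant; exact: measurable_gram.
by rewrite -[X in measurable X]setTI; apply: (md measurableT [set 0]).
Qed.

(** Induction on the number of rows: over a nonsingular [M], the enlarged Gram determinant vanishes
    only if the coordinates of [y *m Q] beyond the first [a] do, an event of probability 0. *)
Lemma gauss_mx_det_gram0 a l : (a <= l)%N ->
  gauss_mx a l [set W : 'M[R]_(a, l) | \det (gram W) = 0] = 0%E.
Proof.
elim: a l => [|a ih] l al.
  rewrite (_ : [set _ | _] = set0) ?measure0//.
  by apply/seteqP; split => // W /=; rewrite det_mx00 => /eqP; rewrite oner_eq0.
(* The successor guarantees at least one coordinate outside the row space of [M]. *)
have [p lE] : exists p, l = (a + p.+1)%N.
  by exists (l - a).-1; rewrite prednK ?subn_gt0// subnKC// ltnW.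
subst l; move=> {al}; have {}ih := ih (a + p.+1)%N (leq_addr _ _).
pose S m n := [set W : 'M[R]_(m, n) | \det (gram W) = 0].
have mI m n : measurable_fun setT (fun W : 'M[R]_(m, n) => (\1_(S m n) W)%:E : \bar R).
  by apply/measurable_EFinP; apply: measurable_indic; exact: measurable_det_gram0.
have I0 m n (W : 'M[R]_(m, n)) : (0 <= (\1_(S m n) W)%:E :> \bar R)%E by rewrite lee_fin.
have <- : (\int[gauss_mx (1 + a) (a + p.+1)]_W (\1_(S (1 + a)%N (a + p.+1)%N) W)%:E =
    gauss_mx (1 + a) (a + p.+1) (S (1 + a)%N (a + p.+1)%N))%E.
  by rewrite integral_indic// ?setIT//; exact: measurable_det_gram0.
apply/eqP; rewrite eq_le integral_ge0 ?andbT//.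
apply: (le_trans (_ : _ <= \int[gauss_mx a (a + p.+1)]_M (\1_(S a (a + p.+1)%N) M)%:E)%E);
  last first.
  rewrite integral_indic//; last exact: measurable_det_gram0.
  by rewrite setIT [X in (X <= _)%E]ih.
apply: le_trans (_ : _ <= \int[gauss_mx a (a + p.+1)]_M
  \int[gauss_mx 1 (a + p.+1)]_y (\1_(S (1 + a)%N (a + p.+1)%N) (col_mx y M))%:E)%E _.
  by rewrite (@integral_gauss_col_mx_swap _ 1 a _ _ (mI _ _) (I0 _ _)).
apply: ge0_le_integral => //.
- by move=> M _; exact: integral_ge0.
- apply: (@measurable_fun_fubini_tonelli_G _ _ _ _ _ (gauss_mx 1 (a + p.+1))
    (fun w => (\1_(S (1 + a)%N (a + p.+1)%N) (col_mx w.1 w.2))%:E)) => //.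
  by apply: (measurableT_comp (mI _ _)); exact: measurable_col_mx.
- exact: mI.
move=> M _; have [dM|dM] := eqVneq (\det (gram M)) 0.
  rewrite [in leRHS]indicE mem_set//.
  apply: (@le_trans _ _ (\int[gauss_mx 1 (a + p.+1)]_y (cst 1 y))%E).
    apply: ge0_le_integral => //.
    - by apply: (measurableT_comp (mI _ _)); exact: measurable_col_mx.
    - by move=> y _; rewrite lee_fin indicE; case: (_ \in _).
  by rewrite integral_cst// [X in (_ * X)%E]probability_setT mule1.
have [Q [L [qQ MQ]]] := exists_orthogonal_triangular M.
have mZ : measurable [set (0 : 'rV[R]_p.+1)].
  rewrite (_ : [set 0] = mx_box (fun _ _ => [set 0])); first exact: measurable_mx_box.
  apply/seteqP; split => [y /= -> i j|y /= y0]; first by rewrite mxE.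
  by apply/matrixP => i j; rewrite mxE; exact: y0.
have mJ : measurable_fun setT (fun y : 'rV[R]_p.+1 => (\1_[set 0] y)%:E : \bar R).
  by apply/measurable_EFinP; exact: measurable_indic.
have J0 (y : 'rV[R]_p.+1) : (0 <= (\1_[set 0] y)%:E :> \bar R)%E by rewrite lee_fin.
rewrite [leLHS](_ : _ = 0%E) //.
transitivity (\int[gauss_mx 1 (a + p.+1)]_y (\1_[set 0] (rsubmx (y *m Q)))%:E)%E.
  apply: eq_integral => y _; congr (_%:E); rewrite !indicE; congr ((nat_of_bool _)%:R).
  have dE := det_gram_col_mx y qQ MQ dM.
  apply/idP/idP => /set_mem yS; apply/mem_set.
    have /eqP : \det (gram (col_mx y M)) = 0 := yS.
    by rewrite dE mulf_eq0 (negbTE dM) orbF sqrf_eq0 frobenius_norm_eq0 => /eqP.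
  change (\det (gram (col_mx y M)) = 0).
  by rewrite dE (yS : rsubmx _ = 0) frobenius_norm0 expr0n mul0r.
apply: etrans (integral_gauss_mulr qQ (F := fun y => (\1_[set 0] (rsubmx y))%:E) _ _) _ => //.
  by apply: (measurableT_comp mJ); exact: measurable_rsubmx.
apply: etrans (@integral_gauss_rsubmx a p.+1 _ mJ J0) _.
rewrite integral_indic// setIT; exact: gauss_mx_set0.
Qed.

(** For a fixed upper block the entry is a linear form in an independent Gaussian row, with
    coefficient vector a column of the right inverse; [gauss_moment_linear] separates the two
    moments. *)
Lemma gauss_ratio_moment a p q b (i : 'I_q) (j : 'I_(1 + a)) : (0 < b)%N -> (b < p)%N ->
  ((\int[gauss_mx (1 + a + q) (a + p)]_M
     (`|(row i (dsubmx M) *m right_inv (usubmx M)) 0 j| ^+ b)%:E)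
   * gauss_moment R p.-1 <= gauss_moment R b * gauss_moment R (p.-1 - b))%E.
Proof.
move=> b0 bp.
have mD : measurable_fun setT (fun M : 'M[R]_(1 + a + q, a + p) => row i (dsubmx M)).
  by apply/measurable_mxP => i' k; under eq_fun do rewrite !mxE; exact: measurable_mx_entry.
have mU : measurable_fun setT (fun M : 'M[R]_(1 + a + q, a + p) => usubmx M).
  by apply/measurable_mxP => i' k; under eq_fun do rewrite !mxE; exact: measurable_mx_entry.
have mH : measurable_fun setT (fun M : 'M[R]_(1 + a + q, a + p) =>
    (`|(row i (dsubmx M) *m right_inv (usubmx M)) 0 j| ^+ b)%:E).
  apply/measurable_EFinP; apply: measurable_fun_normX.
  apply: (measurableT_comp (@measurable_mx_entry R 1 (1 + a) 0 j)).
  apply: measurable_mulmx => //.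
  by apply: measurableT_comp => //; exact: measurable_right_inv.
have H0 (M : 'M[R]_(1 + a + q, a + p)) :
    (0 <= (`|(row i (dsubmx M) *m right_inv (usubmx M)) 0 j| ^+ b)%:E)%E.
  by rewrite lee_fin exprn_ge0.
apply: (@le_trans _ _ ((\int[gauss_mx (1 + a) (a + p)]_W
  ((fnorm (col j (right_inv W)) ^+ b)%:E * gauss_moment R b)) * gauss_moment R p.-1)%E); last first.
  rewrite ge0_integralZr//; last 3 first.
  - exact: measurable_col_right_inv_normX.
  - by move=> W _; rewrite lee_fin exprn_ge0// frobenius_norm_ge0.
  - exact: gauss_moment_ge0.
  rewrite muleAC muleC lee_wpmul2l ?gauss_moment_ge0//.
  exact: gauss_inverse_moment.
rewrite lee_wpmul2r ?gauss_moment_ge0// le_eqVlt; apply/orP; left; apply/eqP.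
apply: etrans (integral_gauss_col_mx mH H0) _.
apply: eq_integral => W _; rewrite -gauss_moment_linear.
pose F (x : 'rV[R]_(a + p)) := (`|(x *m col j (right_inv W)) 0 0| ^+ b)%:E.
have mF : measurable_fun setT F.
  apply/measurable_EFinP; apply: measurable_fun_normX.
  apply: (measurableT_comp (@measurable_mx_entry R 1 1 0 0)).
  exact: measurable_mulmx.
have F0 x : (0 <= F x)%E by rewrite lee_fin exprn_ge0.
apply: (etrans _ (integral_is_gaussian (is_gaussian_row (a + p) i) mF F0)).
apply: eq_integral => x _; congr ((`|_| ^+ _)%:E).
rewrite col_mxKd col_mxKu [LHS]mxE [RHS]mxE; apply: eq_bigr => k _.
by congr (_ * _); rewrite [RHS]mxE.
Qed.

End InverseMoments.

(** * Moment estimates *)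

Section MomentBounds.
Context {R : realType}.

Definition gmom (b : nat) : R := fine (gauss_moment R b).

Lemma gmomE b : gauss_moment R b = (gmom b)%:E.
Proof. by rewrite fineK// ge0_fin_numE ?gauss_moment_lty ?gauss_moment_ge0. Qed.

Lemma gmom_gt0 b : 0 < gmom b.
Proof. by rewrite -lte_fin -gmomE gauss_moment_gt0. Qed.

Lemma gmom0 : gmom 0 = 1.
Proof. by rewrite /gmom gauss_moment0. Qed.

Lemma gmomSS b : gmom b.+2 = b.+1%:R * gmom b.
Proof. by apply: EFin_inj; rewrite -gmomE gauss_momentSS gmomE. Qed.

Lemma gmom_sub2 b : (2 <= b)%N -> gmom b = (b - 1)%:R * gmom (b - 2).
Proof. by case: b => [|[|b]]// _; rewrite gmomSS !subSS !subn0. Qed.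

Lemma gmom2 : gmom 2 = 1.
Proof. by rewrite gmomSS gmom0 mulr1. Qed.

(** This moment is the product of the [q] odd numbers below [2 q], whose mean is [q]. *)
Lemma gmom_double_le q : gmom q.*2 <= q%:R ^+ q.
Proof.
elim: q => [|q ih]; first by rewrite gmom0 expr0.
rewrite doubleS gmomSS; apply: (@le_trans _ _ ((q.*2).+1%:R * q%:R ^+ q)).
  by rewrite ler_pM2l// ltr0Sn.
(* The first two binomial terms; at base [q.+1] and exponent [q.+1] they give a factor 2, enough for
   the next odd number. *)
have bern n : (q ^ n.+1 + n.+1 * q ^ n <= q.+1 ^ n.+1)%N.
  elim: n => [|n ihn]; first by rewrite !expn1 expn0 muln1 addn1.
  rewrite (expnS q.+1); apply: leq_trans (leq_mul (leqnn _) ihn).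
  by rewrite !(expnS q); nia.
rewrite -!natrX -natrM ler_nat.
case: q {ih} bern => [//|q] bern; rewrite (expnS q.+2); apply: leq_trans (leq_mul (leqnn _) (bern q)).
by rewrite -mul2n (expnS q.+1); nia.
Qed.

(** Descending from [p] by twos produces [q] factors, the smallest being [p - 2 q + 1]. *)
Lemma gmom_sub_le p q : (q.*2 <= p)%N ->
  (p - q.*2).+1%:R ^+ q * gmom (p - q.*2) <= gmom p.
Proof.
elim: q p => [|q ih] p; first by rewrite subn0 expr0 mul1r.
case: p => [|[|p]]; rewrite ?doubleS// !ltnS => qp.
rewrite gmomSS !subSS exprSr -mulrA mulrCA.
apply: (@le_trans _ _ (p.+1%:R * ((p - q.*2).+1%:R ^+ q * gmom (p - q.*2)))).
  rewrite ler_wpM2r//; last by rewrite ler_nat ltnS leq_subr.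
  by rewrite mulr_ge0 ?exprn_ge0// ltW// gmom_gt0.
by rewrite ler_pM2l ?ltr0Sn// ih.
Qed.

(** From [1 - x <= exp (- x)] at [x = 1/32], followed by five squarings with each intermediate value
    rounded up. *)
Lemma expR1_le : expR 1 <= 14 / 5 :> R.
Proof.
have h : expR (32^-1) <= 32 / 31 :> R.
  have := @expR_ge1Dx R (- 32^-1); rewrite expRN => e1.
  rewrite -[leLHS]invrK -[leRHS]invrK lef_pV2 ?posrE ?invr_gt0 ?expR_gt0//.
  by rewrite invf_div; apply: le_trans e1; lra.
have sq (x a b : R) : 0 <= x -> x <= a -> a * a <= b -> x * x <= b.
  by move=> x0 xa; apply: le_trans; exact: ler_pM.
have -> : 1 = 32%:R * 32^-1 :> R by field.
rewrite expRM_natl (exprM _ 2 16) (exprM _ 2 8) (exprM _ 2 4) (exprM _ 2 2) !expr2.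
have e0 := @expR_ge0 R (32^-1).
apply: (sq _ (16631 / 10000)); [by rewrite !mulr_ge0| |lra].
apply: (sq _ (12896 / 10000)); [by rewrite !mulr_ge0| |lra].
apply: (sq _ (11356 / 10000)); [by rewrite !mulr_ge0| |lra].
apply: (sq _ (10656 / 10000)); [by rewrite !mulr_ge0| |lra].
by apply: (sq _ (32 / 31)) => //; lra.
Qed.

Lemma expR_nat_le n (c : R) : (14 / 5) ^+ n <= c -> c^-1 <= expR (- n%:R).
Proof.
move=> nc; have e0 := @expR_gt0 R n%:R.
have : expR n%:R <= c.
  apply: le_trans nc; rewrite -[X in expR X]mulr1 expRM_natl.
  by apply: lerXn2r expR1_le; rewrite nnegrE ?expR_ge0.
by move=> ec; rewrite expRN lef_pV2 ?posrE// (lt_le_trans e0).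
Qed.

(** By convexity the graph lies above its tangent at [x = 2 c]. *)
Lemma expR_tangent (c x : R) : expR (- c) * (1 + c - x / 2) <= expR (- (x / 2)).
Proof.
rewrite [in leRHS](_ : - (x / 2) = - c + (c - x / 2)); last by rewrite addrA addNr add0r.
by rewrite expRD ler_pM2l ?expR_gt0// -[1 + c - _]addrA expR_ge1Dx.
Qed.

Lemma root_expR_le n m (c : R) : (0 < m)%N -> 0 <= c ->
  c ^+ m * (14 / 5) ^+ n <= 1 -> c <= expR (- (n%:R / m%:R)).
Proof.
move=> m0 c0 h; rewrite -(@ler_pXn2r _ m) ?nnegrE ?expR_ge0// -expRM_natl.
have -> : m%:R * - (n%:R / m%:R) = - n%:R :> R by field; rewrite pnatr_eq0 -lt0n.
apply: le_trans (expR_nat_le (lexx _)).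
by rewrite -[leRHS]div1r ler_pdivlMr// exprn_gt0.
Qed.

(** The bound starts at 3, where [exp 2 <= 8] gives [exp 4 <= 4 ^ 3]; at 2 it is false. *)
Lemma pow4_expR q : (3 <= q)%N -> expR (q.+1%:R) <= 4 ^+ q :> R.
Proof.
have e1 := expR1_le; have e0 := @expR_gt0 R 1.
elim: q => [//|q ih]; rewrite leq_eqVlt => /predU1P[<-|]; last first.
  rewrite ltnS => /ih {}ih; rewrite -nat1r expRD exprS ler_pM ?expR_ge0//.
  by apply: le_trans e1 _; lra.
rewrite -[X in expR X]mulr1 expRM_natl (exprM _ 2 2) !expr2.
have : expR 1 * expR 1 <= 8 :> R by nra.
set y := expR 1 * expR 1; have y0 : 0 <= y by rewrite mulr_ge0// ltW.
by move=> y8; rewrite !exprS expr0; nra.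
Qed.

(** The second-order bound needs [N / (3 * (N - 2))] on the left, which is 5/9 at the smallest
    admissible [N = 5]. The tangent is taken at [x = 3/2]. *)
Lemma mul_expR_ge_small (x : R) : 1 <= x -> x <= 2 -> 5 / 9 <= x * expR (- (x / 2)).
Proof.
move=> x1 x2.
have e : 4 / 9 <= expR (- (3%:R / 4%:R)) :> R.
  by apply: root_expR_le => //; rewrite !exprS !expr0; lra.
have := expR_tangent (3%:R / 4%:R) x; set E := expR (- (x / 2)) => h.
have : 4 / 9 * (1 + 3 / 4 - x / 2) <= E.
  by apply: le_trans h; rewrite ler_wpM2r//; lra.
by nra.
Qed.

(** Here [3 * x <= N] forces [N >= 7], where [N / (3 * (N - 2))] is 7/15. The tangent is taken at
    [x = 10/3]. *)
Lemma mul_expR_ge_mid (x : R) : 2 <= x -> x <= 4 -> 7 / 15 <= x * expR (- (x / 2)).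
Proof.
move=> x1 x2.
have e : 7 / 40 <= expR (- (5%:R / 3%:R)) :> R.
  by apply: root_expR_le => //; rewrite !exprS !expr0; lra.
have := expR_tangent (5%:R / 3%:R) x; set E := expR (- (x / 2)) => h.
have : 7 / 40 * (1 + 5 / 3 - x / 2) <= E.
  by apply: le_trans h; rewrite ler_wpM2r//; lra.
by nra.
Qed.

(** For order 4: when [N >= 12] the other factor is at least 5, and [5 * (3 / 5)] is the fourth
    Gaussian moment. *)
Lemma sqr_mul_expR_ge (x : R) : 4 <= x -> x <= 6 -> 3 / 5 <= x ^+ 2 * expR (- (x / 2)).
Proof.
move=> x1 x2.
have e : 4 / 100 <= expR (- 3%:R) :> R.
  by rewrite -[leLHS]invrK; apply: expR_nat_le; rewrite !exprS expr0; lra.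
have h : 4 / 100 <= expR (- (x / 2)).
  by apply: le_trans e _; rewrite ler_expR; lra.
have : 16 <= x ^+ 2 by rewrite expr2; nra.
by nra.
Qed.

(* Here [x = u ^+ 2]: below [N / 3] a moment of order about [x] already yields
   [expR (- (x / 2))], and above it the top order [b = p] yields [t ^- p]. *)
Lemma exists_tail_moment (p : nat) (x t Y : R) :
  (4 <= p)%N -> 1 <= x -> 1 <= t -> 0 <= Y -> Y ^+ 2 = 3 * x * t ^+ 2 / p.+1%:R ->
  exists b, [/\ (2 <= b)%N, (b <= p)%N &
    gmom b * gmom (p - b) <= gmom p * (Y ^+ b * (expR (- (x / 2)) + t ^- p))].
Proof.
move=> p4 x1 t1 Y0 Y2; set N : R := p.+1%:R in Y2.
have N5 : 5 <= N by rewrite ler_nat.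
have N0 : 0 < N by rewrite ltr0Sn.
have t2 : 1 <= t ^+ 2 by rewrite exprn_ege1.
have xN : 3 * x / N <= Y ^+ 2.
  by rewrite Y2 ler_pM2r ?invr_gt0// ler_peMr//; lra.
have tp0 : 0 <= t ^- p by rewrite invr_ge0 exprn_ge0//; lra.
have E0 := @expR_gt0 R (- (x / 2)); set E := expR (- (x / 2)) in E0 *.
have [xlarge|xsmall] := leP (N / 3) x.
  (* The ratio of moments is 1 at the top order, and [3 * x >= N] gives [Y >= t]. *)
  exists p; split; [exact: leq_trans p4|exact: leqnn|].
  rewrite subnn gmom0 ler_pM2l ?gmom_gt0//.
  have tY : t <= Y.
    rewrite -(@ler_pXn2r _ 2) ?nnegrE//; last lra.
    rewrite Y2 mulrAC ler_peMl//; first lra.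
    by rewrite ler_pdivlMr//; lra.
  rewrite mulrDr; apply: le_trans (_ : Y ^+ p * t ^- p <= _); last first.
    by rewrite lerDr mulr_ge0 ?exprn_ge0// ltW.
  rewrite ler_pdivlMr ?exprn_gt0//; last lra.
  by rewrite mul1r lerXn2r ?nnegrE//; lra.
have {}xsmall : 3 * x <= N by rewrite mulrC -ler_pdivlMr// ltW.
suff [b [b2 bp h]] : exists b, [/\ (2 <= b)%N, (b <= p)%N &
    gmom b * gmom (p - b) <= gmom p * (Y ^+ b * E)].
  exists b; split => //; apply: le_trans h _.
  by rewrite ler_pM2l ?gmom_gt0// ler_wpM2l ?exprn_ge0// lerDl.
have pN : p%:R = N - 1 by rewrite /N -natr1 addrK.
have [x4|x4] := leP x 4.
  exists 2%N; split => //; first exact: leq_trans p4.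
  have -> : gmom p = (N - 2) * gmom (p - 2).
    rewrite gmom_sub2 ?(leq_trans _ p4)// natrB ?(leq_trans _ p4)//.
    by congr (_ * _); rewrite pN; lra.
  rewrite gmom2 mulrAC ler_pM2r ?gmom_gt0//.
  have fx : N / (3 * (N - 2)) <= x * E.
    have [x2|x2] := leP x 2.
      apply: le_trans (mul_expR_ge_small x1 x2).
      by rewrite ler_pdivrMr; lra.
    apply: le_trans (mul_expR_ge_mid (ltW x2) x4).
    have N7 : 7 <= N.
      have N6 : 6 < N by lra.
      by move: N6; rewrite ltr_nat ler_nat.
    by rewrite ler_pdivrMr; lra.
  move: fx; rewrite ler_pdivrMr; last lra.
  move=> fx; apply: le_trans (_ : (N - 2) * (3 * x / N * E) <= _); last first.
    by rewrite ler_wpM2l; [|lra|rewrite ler_wpM2r// ltW].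
  rewrite -(ler_pM2r N0) mul1r; apply: le_trans fx _.
  by rewrite le_eqVlt; apply/orP; left; apply/eqP; field; lra.
have [x6|x6] := leP x 6.
  have N12 : 12 <= N.
    have N11 : 11 < N by lra.
    by move: N11; rewrite ltr_nat ler_nat.
  exists 4%N; split => //.
  have -> : gmom p = (N - 2) * (N - 4) * gmom (p - 4).
    rewrite gmom_sub2 ?(leq_trans _ p4)// (@gmom_sub2 (p - 2)) ?leq_subRL ?(leq_trans _ p4)//.
    rewrite -!subnDA !natrB ?(leq_trans _ p4)// mulrA.
    by congr (_ * _ * _); rewrite pN; lra.
  rewrite !gmomSS gmom0 !mulr1 mulrAC ler_pM2r ?gmom_gt0//.
  have fx := sqr_mul_expR_ge (ltW x4) x6.
  have Y4 : (3 * x / N) ^+ 2 <= Y ^+ 4.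
    rewrite (exprM _ 2 2) lerXn2r ?nnegrE ?sqr_ge0//.
    by rewrite divr_ge0//; lra.
  apply: le_trans (_ : (N - 2) * (N - 4) * ((3 * x / N) ^+ 2 * E) <= _); last first.
    rewrite ler_wpM2l ?mulr_ge0 ?subr_ge0//; [lra|lra|].
    by rewrite ler_wpM2r// ltW.
  have -> : (N - 2) * (N - 4) * ((3 * x / N) ^+ 2 * E) =
     (9 * (N - 2) * (N - 4) / N ^+ 2) * (x ^+ 2 * E) by field; lra.
  apply: le_trans (_ : 5 * (3 / 5) <= _); first lra.
  apply: ler_pM => //; try lra.
  by rewrite ler_pdivlMr ?exprn_gt0// expr2; nra.
(* For [x > 6] the order is twice the integer part of [x / 2], hence [q >= 3] as [pow4_expR]
   requires. *)
have [q /andP[qx xq]] : exists q : nat, q%:R <= x / 2 < q.+1%:R.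
  by exists (Num.trunc (x / 2)); apply: truncn_itv; lra.
have q3 : (3 <= q)%N by rewrite -ltnS -(ltr_nat R); apply: le_lt_trans xq; lra.
have qp : (q.*2 <= p)%N.
  by rewrite -ltnS -(ltr_nat R) -mul2n natrM -/N; lra.
have q2 : (2 <= q.*2)%N by rewrite (leq_double 1) ltnW// ltnW.
exists q.*2; split; [exact: q2|exact: qp|].
apply: le_trans (_ : q%:R ^+ q * gmom (p - q.*2) <= _).
  by rewrite ler_pM2r ?gmom_gt0// gmom_double_le.
apply: le_trans (_ : (p - q.*2).+1%:R ^+ q * gmom (p - q.*2) * (Y ^+ q.*2 * E) <= _);
  last first.
  by rewrite ler_wpM2r ?gmom_sub_le// mulr_ge0 ?exprn_ge0// ltW.
rewrite mulrAC ler_pM2r ?gmom_gt0// -mul2n exprM mulrA -exprMn.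
have -> : (p - 2 * q).+1%:R = N - 2 * q%:R :> R.
  by rewrite /N -natr1 natrB ?mul2n// -mul2n natrM -natr1; lra.
(* From [3 x <= N] and [2 q <= x] follows [(N - 2 q) * (3 x / N) >= 3 x - 2 q >= 4 q]: the factor 3
   in [Y ^+ 2] is what produces the base 4. *)
apply: le_trans (_ : (4 * q%:R) ^+ q * E <= _); last first.
  rewrite ler_wpM2r ?(ltW E0)// lerXn2r ?nnegrE//.
    by rewrite mulr_ge0 ?sqr_ge0//; lra.
  apply: le_trans (_ : (N - 2 * q%:R) * (3 * x / N) <= _); last first.
    by rewrite ler_wpM2l//; lra.
  rewrite mulrA ler_pdivlMr//; nra.
rewrite exprMn mulrAC ler_peMl ?exprn_ge0//.
have e4 := pow4_expR q3.
apply: le_trans (_ : expR (q.+1%:R) * E <= _); last by rewrite ler_pM2r.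
by rewrite /E -expRD -[leLHS]expR0 ler_expR; lra.
Qed.

End MomentBounds.

(** * Projection error *)

Section ProjectionError.
Context {R : realType}.
Local Notation fnorm := (@frobenius_norm R _ _).

Lemma frobenius_norm_sqr_orthogonal m n (B C : 'M[R]_(m, n)) :
  B^T *m C = 0 -> fnorm (B + C) ^+ 2 = fnorm B ^+ 2 + fnorm C ^+ 2.
Proof.
move=> BC; rewrite -(frobenius_norm_tr (B + C)) -(frobenius_norm_tr B).
rewrite -(frobenius_norm_tr C) !frobenius_norm_sqrE !trmxK.
have -> : (B + C)^T = B^T + C^T by rewrite linearD.
rewrite mulmxDl !mulmxDr.
have CB : C^T *m B = 0 by rewrite -[LHS]trmxK trmx_mul trmxK BC trmx0.
by rewrite BC CB addr0 add0r linearD.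
Qed.

(** Pythagoras: the residual is orthogonal to the column space of [Z]. The exact gap, beyond the
    inequality, shows how far a given [X] is from optimal. *)
Lemma col_proj_error m n l (A : 'M[R]_(m, n)) (Z : 'M[R]_(m, l)) (X : 'M[R]_(l, n)) :
  fnorm (A - Z *m X) ^+ 2 = fnorm ((1%:M - col_proj Z) *m A) ^+ 2
    + fnorm (Z *m (mpinv Z *m A - X)) ^+ 2.
Proof.
have [ZXZ _ sZX _] := mpinvP Z.
have -> : A - Z *m X = (1%:M - col_proj Z) *m A + Z *m (mpinv Z *m A - X).
  by rewrite mulmxBl mul1mx mulmxBr mulmxA /col_proj addrA subrK.
rewrite frobenius_norm_sqr_orthogonal// trmx_mul mulmxA -(mulmxA A^T).
have -> : (1%:M - col_proj Z)^T = 1%:M - col_proj Z.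
  by rewrite linearB/= trmx1 /col_proj sZX.
by rewrite mulmxBl mul1mx /col_proj ZXZ subrr mulmx0 mul0mx.
Qed.

Lemma col_proj_error_le m n l (A : 'M[R]_(m, n)) (Z : 'M[R]_(m, l)) (X : 'M[R]_(l, n)) :
  fnorm ((1%:M - col_proj Z) *m A) <= fnorm (A - Z *m X).
Proof.
rewrite -(@ler_pXn2r _ 2) ?nnegrE ?frobenius_norm_ge0// col_proj_error.
by rewrite lerDl sqr_ge0.
Qed.

Lemma rational_mx_approx m n l (Z : 'M[R]_(m, l)) (X : 'M[R]_(l, n)) (e : R) :
  0 < e -> exists Y : 'M[rat]_(l, n), fnorm (Z *m (X - map_mx ratr Y)) ^+ 2 < e.
Proof.
(* [B] sums over all entries the squared absolute row sums of [Z]: entrywise accuracy [d] in [X]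
   costs at most [d ^+ 2 * B], and [d <= 1] makes this at most [d * B]. *)
move=> e0; pose B := \sum_(i < m) \sum_(j < n) (\sum_(a < l) `|Z i a|) ^+ 2.
have B0 : 0 <= B by rewrite sumr_ge0// => i _; rewrite sumr_ge0// => j _; exact: sqr_ge0.
pose d := Num.min 1 (e / (2 * (B + 1))).
have d0 : 0 < d by rewrite lt_min ltr01/= divr_gt0// mulr_gt0// ltr_wpDl.
have d1 : d <= 1 by rewrite ge_min lexx.
have de : d * B < e.
  have : d * (2 * (B + 1)) <= e.
    by rewrite -ler_pdivlMr ?mulr_gt0 ?ltr_wpDl// ge_min lexx orbT.
  by nra.
have appr (i : 'I_l) (j : 'I_n) : {q : rat | `|X i j - ratr q| <= d}.
  apply: cid; have [q] := @rat_in_itvoo R (X i j - d) (X i j + d) ltac:(lra).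
  by rewrite in_itv/= => /andP[q1 q2]; exists q; rewrite ler_norml; apply/andP; split; lra.
exists (\matrix_(i, j) sval (appr i j)); apply: le_lt_trans de.
apply: (@le_trans _ _ (d ^+ 2 * B)); last first.
  by rewrite expr2 ler_wpM2r// ger_pMr.
rewrite frobenius_norm_sqr mulr_sumr ler_sum// => i _; rewrite mulr_sumr ler_sum// => j _.
rewrite -exprMn -real_normK ?num_real// lerXn2r ?nnegrE//.
  by rewrite mulr_ge0 ?sumr_ge0// ltW.
rewrite mxE mulr_sumr; apply: le_trans (ler_norm_sum _ _ _) _; apply: ler_sum => a _.
by rewrite normrM mulrC ler_wpM2r// !mxE; case: (appr a j).
Qed.

(* [col_proj] is not continuous, but the error is an infimum over [X] of the
   continuous functions [fnorm (A - Z *m X)], and rational [X] suffice. *)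
Lemma measurable_col_proj_error d (T : measurableType d) m n l
    (A : 'M[R]_(m, n)) (Z : T -> 'M[R]_(m, l)) : measurable_fun setT Z ->
  measurable_fun setT (fun w => fnorm ((1%:M - col_proj (Z w)) *m A)).
Proof.
move=> mZ; apply: (measurability _ (RGenInftyO.measurableE R)) => // _ [_ [c ->] <-].
rewrite setTI.
pose F (i : nat) : set T := if unpickle i is Some Y then
  [set w | fnorm (A - Z w *m map_mx ratr (Y : 'M[rat]_(l, n))) < c] else set0.
rewrite (_ : _ @^-1` _ = \bigcup_i F i).
  apply: bigcupT_measurable => i; rewrite /F; case: unpickle => // Y.
  have mf : measurable_fun setT
      (fun w => fnorm (A - Z w *m map_mx ratr (Y : 'M[rat]_(l, n)))).
    apply: measurable_frobenius_norm; apply/measurable_mxP => i' j.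
    under eq_fun do rewrite !mxE; apply: measurable_funB => //.
    apply: measurable_sum => a; apply: measurable_funM => //.
    by move/measurable_mxP : mZ; exact.
  by rewrite -[X in measurable X]setTI; exact: (mf measurableT `]-oo, c[%classic).
apply/seteqP; split => [w|w [i _]]; rewrite /= ?in_itv/=.
  move=> wc; have c0 : 0 < c by apply: le_lt_trans wc; exact: frobenius_norm_ge0.
  (* The optimal coefficient is [mpinv Z *m A]; a rational matrix close to it uses up less than the
     gap below [c]. *)
  have [|Y Ye] := @rational_mx_approx m n l (Z w) (mpinv (Z w) *m A)
     (c ^+ 2 - fnorm ((1%:M - col_proj (Z w)) *m A) ^+ 2).
    by rewrite subr_gt0 ltrXn2r ?nnegrE ?frobenius_norm_ge0// ltW.
  exists (pickle Y) => //; rewrite /F pickleK /=.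
  rewrite -(@ltr_pXn2r _ 2) ?nnegrE ?frobenius_norm_ge0 ?(ltW c0)// col_proj_error.
  by rewrite addrC -ltrBrDr.
rewrite /F; case: unpickle => // Y /=; apply: le_lt_trans.
exact: col_proj_error_le.
Qed.

End ProjectionError.

(** * Power means with integer exponents *)

Section PowerMean.
Context {R : realType}.

(* Convexity of [x |-> x ^ (b.+2 / 2)] at [x = s ^+ 2], without real exponents. *)
Lemma exprn_tangent (b : nat) (s z : R) : 0 <= s -> 0 <= z ->
  s ^+ b.+2 + b.+2%:R / 2 * s ^+ b * (z ^+ 2 - s ^+ 2) <= z ^+ b.+2.
Proof.
move=> s0 z0.
suff : s ^+ b.+2 + b.+2%:R / 2 * s ^+ b * (z ^+ 2 - s ^+ 2) <= z ^+ b.+2 /\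
   s ^+ b.+3 + b.+3%:R / 2 * s ^+ b.+1 * (z ^+ 2 - s ^+ 2) <= z ^+ b.+3 by case.
(* Multiplying by [z ^+ 2] raises the exponent by two; what is lost is a nonnegative multiple of
   [(z ^+ 2 - s ^+ 2) ^+ 2]. *)
have step c : s ^+ c.+2 + c.+2%:R / 2 * s ^+ c * (z ^+ 2 - s ^+ 2) <= z ^+ c.+2 ->
    s ^+ c.+4 + c.+4%:R / 2 * s ^+ c.+2 * (z ^+ 2 - s ^+ 2) <= z ^+ c.+4.
  move=> h.
  have sc : 0 <= s ^+ c by rewrite exprn_ge0.
  have -> : z ^+ c.+4 = z ^+ 2 * z ^+ c.+2 by rewrite -exprD.
  apply: le_trans (_ : z ^+ 2 * (s ^+ c.+2 + c.+2%:R / 2 * s ^+ c * (z ^+ 2 - s ^+ 2)) <= _);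
    last by rewrite ler_wpM2l ?sqr_ge0.
  rewrite -subr_ge0.
  have -> : z ^+ 2 * (s ^+ c.+2 + c.+2%:R / 2 * s ^+ c * (z ^+ 2 - s ^+ 2)) -
     (s ^+ c.+4 + c.+4%:R / 2 * s ^+ c.+2 * (z ^+ 2 - s ^+ 2)) =
     c.+2%:R / 2 * s ^+ c * (z ^+ 2 - s ^+ 2) ^+ 2.
    have -> : c.+4%:R = c.+2%:R + 2 :> R by rewrite -natrD addn2.
    have -> : s ^+ c.+4 = s ^+ 2 * s ^+ 2 * s ^+ c by rewrite -!exprD.
    have -> : s ^+ c.+2 = s ^+ 2 * s ^+ c by rewrite -exprD.
    by field.
  by rewrite mulr_ge0 ?sqr_ge0// mulr_ge0// divr_ge0.
elim: b => [|b [h1 h2]]; last by split => //; exact: step.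
split; first by rewrite expr0 mulr1 divff// mul1r addrC subrK.
rewrite -subr_ge0.
have -> : z ^+ 3 - (s ^+ 3 + 3%:R / 2 * s ^+ 1 * (z ^+ 2 - s ^+ 2)) =
   (z - s) ^+ 2 * (z + s / 2) by field.
by rewrite mulr_ge0 ?sqr_ge0// addr_ge0 ?divr_ge0.
Qed.

(** The tangent bound at [s] is averaged; its linear part cancels because [s ^+ 2] is the mean of
    the [z i ^+ 2]. *)
Lemma power_mean_le (I : finType) (w z : I -> R) (s : R) (b : nat) :
  (2 <= b)%N -> (forall i, 0 <= w i) -> (forall i, 0 <= z i) -> 0 <= s ->
  \sum_i w i = 1 -> s ^+ 2 = \sum_i w i * z i ^+ 2 ->
  s ^+ b <= \sum_i w i * z i ^+ b.
Proof.
case: b => [|[|b]]// _ w0 z0 s0 w1 s2.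
apply: le_trans (_ : \sum_i w i * (s ^+ b.+2 + b.+2%:R / 2 * s ^+ b * (z i ^+ 2 - s ^+ 2)) <= _);
  last by apply: ler_sum => i _; rewrite ler_wpM2l// exprn_tangent.
rewrite le_eqVlt; apply/orP; left; apply/eqP.
set K := b.+2%:R / 2 * s ^+ b.
transitivity (\sum_i (s ^+ b.+2 * w i + K * (w i * z i ^+ 2 - s ^+ 2 * w i))).
  by rewrite big_split/= -!mulr_sumr sumrB -s2 -mulr_sumr w1 !mulr1 subrr mulr0 addr0.
by apply: eq_bigr => i _; ring.
Qed.

End PowerMean.

(** * Deterministic bound on the projection error *)

Section ErrorDecomposition.
Context {R : realType}.
Local Notation fnorm := (@frobenius_norm R _ _).

(** Each row of [B] has at most one nonzero entry, so squaring creates no cross terms. For the tail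
    columns of a diagonal matrix, the weights are the squared tail singular values. *)
Lemma frobenius_norm_sqr_mul_sparse m q r (B : 'M[R]_(m, q)) (Y : 'M[R]_(q, r)) :
  (forall i j j', j != j' -> B i j * B i j' = 0) ->
  fnorm (B *m Y) ^+ 2 = \sum_j (\sum_i B i j ^+ 2) * \sum_c Y j c ^+ 2.
Proof.
move=> B0.
have E i c : (B *m Y) i c ^+ 2 = \sum_j B i j ^+ 2 * Y j c ^+ 2.
  rewrite mxE expr2 mulr_suml; apply: eq_bigr => j _.
  rewrite mulr_sumr (bigD1 j)//= big1 ?addr0 -?exprMn// => j' j'j.
  by rewrite mulrACA B0 1?eq_sym// mul0r.
rewrite frobenius_norm_sqr.
under eq_bigr do under eq_bigr do rewrite E.
under eq_bigr do rewrite exchange_big/=.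
rewrite exchange_big/=; apply: eq_bigr => j _; rewrite mulr_suml.
by apply: eq_bigr => i _; rewrite mulr_sumr.
Qed.

Lemma sum_tail_ord n k (F : 'I_n -> R) : (forall i : 'I_n, (i < k)%N -> F i = 0) ->
  \sum_(i < n - k) F (tail_ord i) = \sum_i F i.
Proof.
move=> F0; have [nk|/ltnW kn] := leqP n k.
  rewrite [RHS]big1 => [|i _]; last by apply: F0; exact: leq_trans nk.
  by rewrite big1// => -[i] /[dup]; rewrite {1}(eqP nk).
(* Extending [F] by 0 to all naturals allows the range to be cut at [k]. *)
pose f i := if insub i is Some j then F j else 0.
have fE (i : 'I_n) : F i = f i by rewrite /f valK.
under eq_bigr do rewrite fE; under [RHS]eq_bigr do rewrite fE.
rewrite -(big_mkord xpredT f) (big_cat_nat (leq0n k) kn)/= [X in _ = X + _]big1_seq ?add0r.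
  by rewrite -[X in \sum_(X <= _ < n) _]add0n big_addn big_mkord; apply: eq_bigr => i _; rewrite addnC.
move=> i; rewrite mem_index_iota => /= ik.
by rewrite /f; case: insubP => // j _ ji; apply: F0; rewrite ji.
Qed.

(** The first [k] rows may be restored since a diagonal matrix vanishes there in the last [q]
    columns. *)
Lemma frobenius_norm_trailing_block m k q (S : 'M[R]_(m, k + q)) : is_diag_mx S ->
  fnorm (trailing_block k S) ^+ 2 = \sum_j \sum_i rsubmx S i j ^+ 2.
Proof.
move=> /is_diag_mxP S0; rewrite exchange_big/= frobenius_norm_sqr.
rewrite -(@sum_tail_ord m k (fun i => \sum_j rsubmx S i j ^+ 2)).
  apply: eq_bigr => i _; under eq_bigr do rewrite mxE.
  rewrite (@sum_tail_ord _ k (fun j => S (tail_ord i) j ^+ 2)).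
    rewrite big_split_ord/= big1 ?add0r => [|j _].
      by apply: eq_bigr => j _; rewrite mxE.
    by rewrite S0 ?expr0n//= neq_ltn (leq_trans (ltn_ord j)) ?leq_addr ?orbT.
  by move=> j jk; rewrite S0 ?expr0n//= neq_ltn (leq_trans jk) ?leq_addr ?orbT.
move=> i ik; rewrite big1// => j _.
by rewrite mxE S0 ?expr0n//= neq_ltn (leq_trans ik) ?leq_addr.
Qed.

(* The entries of $\Omega_2\Omega_1^\dagger$ for $\Omega$ split after its first
   [k] rows. *)
Definition block_ratio k q l (W : 'M[R]_(k + q, l)) : 'M[R]_(q, k) :=
  dsubmx W *m right_inv (usubmx W).

(* The projection error is at most [fnorm (A - (A *m G) *m X)] for every [X]; the
   bound comes from [X = right_inv (usubmx W) *m usubmx V^T], [W = V^T *m G]. *)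
Lemma col_proj_error_svd m k q l (A : 'M[R]_(m, k + q)) U S V (G : 'M[R]_(k + q, l)) :
  is_svd A U S V -> \det (gram (usubmx (V^T *m G))) != 0 ->
  fnorm ((1%:M - col_proj (A *m G)) *m A) ^+ 2 <=
    fnorm (trailing_block k S) ^+ 2 +
    \sum_j (\sum_i rsubmx S i j ^+ 2) * \sum_c block_ratio (V^T *m G) j c ^+ 2.
Proof.
move=> [qU qV dS _ _ ->]; set W := V^T *m G => dW.
set A0 := U *m S *m V^T; set C := right_inv (usubmx W).
have BR : block_ratio W = dsubmx W *m C by [].
have WC : usubmx W *m C = 1%:M by exact: mulmx_right_inv.
(* From here on [C] is used through two facts: it is a right inverse of the upper block, and it
   defines [block_ratio]. *)
clearbody C.
set Sa := lsubmx S; set Sb := rsubmx S.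
have sparse i j j' : j != j' -> Sb i j * Sb i j' = 0.
  move=> jj'; rewrite !mxE; have [/is_diag_mxP S0] := (dS, tt).
  have [ij|ij] := eqVneq (i : nat) (k + j)%N; last by rewrite S0 ?mul0r.
  by rewrite mulrC S0 ?mul0r// ij/= eqn_add2l.
apply: (@le_trans _ _ (fnorm (A0 - A0 *m G *m (C *m usubmx V^T)) ^+ 2)).
  by rewrite ler_pXn2r ?nnegrE ?frobenius_norm_ge0 ?col_proj_error_le.
rewrite frobenius_norm_trailing_block//.
rewrite -(@frobenius_norm_sqr_mul_sparse _ _ _ Sb (block_ratio W)) //.
(* This [X] reproduces the leading part of [A] exactly; what remains is the tail and the leakage of
   the tail into the first [k] right singular directions. *)
have -> : A0 - A0 *m G *m (C *m usubmx V^T) =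
    U *m (row_mx (- (Sb *m block_ratio W)) Sb *m V^T).
  rewrite /A0 -!mulmxA -mulmxBr; congr (_ *m _).
  have hv r (M : 'M[R]_(k + q, r)) : S *m M = Sa *m usubmx M + Sb *m dsubmx M.
    by rewrite -{1}[S]hsubmxK -{1}[M]vsubmxK mul_row_col.
  rewrite (mulmxA V^T G) -/W (mulmxA W) (mulmxA S) (mulmxA S W).
  rewrite !hv mulmxDl -(mulmxA Sa) WC mulmx1.
  rewrite -[in RHS](vsubmxK V^T) mul_row_col mulNmx mulmxDl.
  by rewrite BR !mulmxA opprD addrACA subrr add0r addrC.
rewrite frobenius_norm_mull// frobenius_norm_mulr ?trmxK//.
rewrite frobenius_norm_sqr_row_mx addrC (frobenius_norm_sqr Sb) exchange_big/=.
by rewrite !frobenius_norm_sqr; apply: lerD => //; apply: ler_sum => i _;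
  apply: ler_sum => j _; rewrite mxE sqrrN.
Qed.

End ErrorDecomposition.

Section GaussianRotation.
Context {R : realType}.

Lemma integral_indicT d (T : measurableType d) (mu : {measure set T -> \bar R})
    (A : set T) :
  measurable A -> (\int[mu]_x (\1_A x)%:E = mu A)%E.
Proof. by move=> mA; rewrite integral_indic// setIT. Qed.

Lemma is_gaussian_mull d (T : measurableType d) (P : {measure set T -> \bar R}) n l
    (Q : 'M[R]_n) (X : T -> 'M[R]_(n, l)) :
  orthogonal_mx Q -> is_gaussian P X -> is_gaussian P (fun w => Q *m X w).
Proof.
move=> qQ gX; have [mX _] := gX.
have mQ := @measurable_mulmxl R n n l Q.
split=> [|B mB]; first by apply: measurableT_comp => //; exact: mQ.
have mI (A : set 'M[R]_(n, l)) : measurable A ->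
    measurable_fun setT (fun x => (\1_A x)%:E : \bar R).
  by move=> mA; apply/measurable_EFinP; exact: measurable_indic.
have mBB := measurable_mx_box mB.
have [_ /(_ B mB) <-] := @gauss_mxP R n l.
rewrite preimage_id -(integral_indicT _ mBB).
rewrite -(@integral_gauss_mull _ _ _ Q _ qQ (mI _ mBB)) => [|x]; last by rewrite lee_fin.
rewrite -(integral_is_gaussian gX (F := fun x => (\1_(mx_box B) (Q *m x))%:E)); first last.
- by move=> x; rewrite lee_fin.
- exact: (measurableT_comp (mI _ mBB) mQ).
rewrite -integral_indicT// -[X in measurable X]setTI.
by apply: (measurableT_comp mQ mX).
Qed.

End GaussianRotation.

(** * Error bounds *)

Section BlockRatioMoments.
Context {R : realType} {a p q : nat}.
Local Notation k := (1 + a)%N.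

Lemma measurable_block_ratio_normX (i : 'I_q) (j : 'I_k) b :
  measurable_fun setT (fun W : 'M[R]_(k + q, a + p) => `|block_ratio W i j| ^+ b).
Proof.
apply: measurable_funX; apply: measurableT_comp => //.
apply: (measurableT_comp (@measurable_mx_entry R _ _ i j)).
apply: measurable_mulmx; first by apply/measurable_mxP => i' j';
  under eq_fun do rewrite mxE; exact: measurable_mx_entry.
apply: measurableT_comp; first exact: measurable_right_inv.
by apply/measurable_mxP => i' j'; under eq_fun do rewrite mxE; exact: measurable_mx_entry.
Qed.

Lemma block_ratio_moment d (T : measurableType d) (P : {measure set T -> \bar R})
    (W : T -> 'M[R]_(k + q, a + p)) (w : 'I_q * 'I_k -> R) b :
  is_gaussian P W -> (forall ij, 0 <= w ij) -> (0 < b)%N -> (b < p)%N ->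
  (\int[P]_x (\sum_ij w ij * `|block_ratio (W x) ij.1 ij.2| ^+ b)%:E
    <= ((\sum_ij w ij) * (@gmom R b * @gmom R (p.-1 - b) / @gmom R p.-1))%:E)%E.
Proof.
move=> gW w0 b0 bp.
pose F ij (W : 'M[R]_(k + q, a + p)) := (`|block_ratio W ij.1 ij.2| ^+ b)%:E.
have mF ij : measurable_fun setT (F ij).
  by apply/measurable_EFinP; exact: measurable_block_ratio_normX.
have F0 ij W' : (0 <= F ij W')%E by rewrite lee_fin exprn_ge0.
have mFW ij : measurable_fun setT (fun x => F ij (W x)).
  by apply: measurableT_comp => //; case: gW.
have -> : (\int[P]_x (\sum_ij w ij * `|block_ratio (W x) ij.1 ij.2| ^+ b)%:E =
    \sum_ij (w ij)%:E * \int[P]_x F ij (W x))%E.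
  under eq_integral do rewrite -sumEFin.
  rewrite ge0_integral_sum//=; last by move=> ij x _; rewrite lee_fin mulr_ge0 ?exprn_ge0.
    apply: eq_bigr => ij _; rewrite -ge0_integralZl ?lee_fin//.
  move=> ij; under eq_fun do rewrite EFinM.
  exact: measurable_funeM (mFW ij).
rewrite mulr_suml -sumEFin; apply: lee_sum => ij _.
rewrite EFinM lee_wpmul2l ?lee_fin// (integral_is_gaussian gW)//.
rewrite EFinM lee_pdivlMr ?gmom_gt0// EFinM -!gmomE.
apply: le_trans (gauss_ratio_moment ij.1 ij.2 b0 bp).
rewrite le_eqVlt; apply/orP; left; apply/eqP.
by congr (_ * _)%E; apply: eq_integral => W' _; rewrite /F -row_mul [in RHS]mxE.
Qed.

End BlockRatioMoments.

Section Bounds.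
Context {R : realType} {a p q : nat}.
Local Notation k := (1 + a)%N.
Context d (T : measurableType d) (P : probability T R).

Lemma gaussian_det_gram_usubmx0 (W : T -> 'M[R]_(k + q, a + p.+1)) : is_gaussian P W ->
  measurable [set x | \det (gram (usubmx (W x))) = 0] /\
  P [set x | \det (gram (usubmx (W x))) = 0] = 0%E.
Proof.
move=> gW; have [mW _] := gW.
pose N : set 'M[R]_(k, a + p.+1) := [set M | \det (gram M) = 0].
have mN : measurable N := @measurable_det_gram0 R k (a + p.+1).
have mu : measurable_fun setT (fun M : 'M[R]_(k + q, a + p.+1) => usubmx M).
  by apply/measurable_mxP => i j; under eq_fun do rewrite mxE; exact: measurable_mx_entry.
have mI : measurable_fun setT
    (fun M : 'M[R]_(k + q, a + p.+1) => (\1_N (usubmx M))%:E : \bar R).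
  by apply/measurable_EFinP; apply: (measurableT_comp _ mu); exact: measurable_indic.
have mNW : measurable ((fun x => usubmx (W x)) @^-1` N).
  by rewrite -[X in measurable X]setTI; apply: (measurableT_comp mu mW).
split => //; rewrite (_ : [set _ | _] = (fun x => usubmx (W x)) @^-1` N)//.
rewrite -integral_indicT//.
rewrite (integral_is_gaussian gW mI) => [|M]; last by rewrite lee_fin.
apply: etrans (integral_gauss_col_mx mI _) _ => [M|]; first by rewrite lee_fin.
rewrite -(@gauss_mx_det_gram0 R k (a + p.+1)) ?addnS ?leq_addr//.
rewrite -integral_indicT//; apply: eq_integral => x _.
under eq_integral do rewrite col_mxKu.
rewrite integral_cst//; apply: etrans (mule1 _); congr (_ * _)%E.
exact: probability_setT.
Qed.

(** AM-GM with parameter [al] makes the bound affine in [h], so its expectation needs that of [h]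
    alone. At [al = 0] the value of [h / al] is 0, which is why [h] must vanish. *)
Lemma sqrt_sum_le (e s h al : R) : 0 <= s -> 0 <= h -> 0 <= al -> (al = 0 -> h = 0) ->
  e ^+ 2 <= s ^+ 2 + h -> e <= s + (h / al + al) / 2.
Proof.
move=> s0 h0 al0 ah eh.
have g0 : 0 <= (h / al + al) / 2 by rewrite divr_ge0// addr_ge0// divr_ge0.
have hg : h <= ((h / al + al) / 2) ^+ 2.
  have [/[dup] /ah -> ->|an] := eqVneq al 0; first exact: sqr_ge0.
  have {1}-> : h = (h / al) * al by rewrite divfK.
  by have := sqr_ge0 (h / al - al); lra.
rewrite leNgt; apply/negP => lt; have : (s + (h / al + al) / 2) ^+ 2 < e ^+ 2.
  by rewrite ltrXn2r// ?nnegrE ?addr_ge0// (le_trans _ (ltW lt))// addr_ge0.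
by have := mulr_ge0 s0 g0; nra.
Qed.

(** The cross term of the square is nonnegative and is dropped. *)
Lemma sqr_scale_lt (y c tt h : R) : 0 <= y -> 0 <= c ->
  ((1 + y * c) * tt) ^+ 2 < tt ^+ 2 + h -> y ^+ 2 * (c ^+ 2 * tt ^+ 2) < h.
Proof.
move=> y0 c0; have := mulr_ge0 (mulr_ge0 y0 c0) (sqr_ge0 tt).
have -> : ((1 + y * c) * tt) ^+ 2 =
  tt ^+ 2 + 2 * (y * c * tt ^+ 2) + y ^+ 2 * (c ^+ 2 * tt ^+ 2) by ring.
lra.
Qed.

Variables (W : T -> 'M[R]_(k + q, a + p.+1)) (s : 'I_q -> R) (err : T -> R) (tau : R).
Hypotheses (gW : is_gaussian P W) (s0 : forall j, 0 <= s j) (tau0 : 0 <= tau).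
Hypotheses (tauE : tau ^+ 2 = \sum_j s j) (merr : measurable_fun setT err).
Hypothesis err0 : forall x, 0 <= err x.
Hypothesis errP : forall x, \det (gram (usubmx (W x))) != 0 ->
  err x ^+ 2 <= tau ^+ 2 + \sum_j s j * \sum_c block_ratio (W x) j c ^+ 2.

Let sum_pairs (w : 'I_q -> R) (z : 'I_q -> 'I_k -> R) :
  \sum_j w j * \sum_c z j c = \sum_(jc : 'I_q * 'I_k) w jc.1 * z jc.1 jc.2.
Proof.
rewrite -(pair_bigA _ (fun j c => w j * z j c))/=.
by apply: eq_bigr => j _; rewrite mulr_sumr.
Qed.

Let sum_weights (c : R) : \sum_(jc : 'I_q * 'I_k) s jc.1 * c = k%:R * tau ^+ 2 * c.
Proof.
rewrite -(pair_bigA _ (fun j _ => s j * c))/= tauE mulrAC mulr_sumr.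
by apply: eq_bigr => j _; rewrite sumr_const card_ord -[RHS]mulrA mulr_natl mulrC.
Qed.

Let measurable_weighted (w : 'I_q * 'I_k -> R) b :
  measurable_fun setT (fun x => \sum_jc w jc * `|block_ratio (W x) jc.1 jc.2| ^+ b).
Proof.
apply: measurable_sum => jc; apply: measurable_funM => //.
by apply: measurableT_comp (@measurable_block_ratio_normX R a p.+1 q _ _ b) _; case: gW.
Qed.

Lemma expectation_col_proj_error_le : (2 <= p)%N ->
  ('E_P[err] <= ((1 + Num.sqrt (k%:R / (p.-1)%:R)) * tau)%:E)%E.
Proof.
move=> p2; set r := k%:R / _.
have p1 : 0 < p.-1%:R :> R by rewrite ltr0n; case: (p) p2 => [|[]].
have r0 : 0 < r by rewrite divr_gt0.
(* Chosen so that [al ^+ 2] bounds the expectation of [H], which balances the two halves of the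
   AM-GM bound: since [m_(p-2) / m_p = 1 / (p - 1)], that expectation is at most
   [k * tau ^+ 2 / (p - 1)]. *)
pose al := tau * Num.sqrt r.
have al0 : 0 <= al by rewrite mulr_ge0.
pose H x := \sum_(jc : 'I_q * 'I_k) s jc.1 * `|block_ratio (W x) jc.1 jc.2| ^+ 2.
have HE x : \sum_j s j * \sum_c block_ratio (W x) j c ^+ 2 = H x.
  rewrite sum_pairs; apply: eq_bigr => jc _.
  by rewrite real_normK ?num_real.
have H0 x : 0 <= H x by apply: sumr_ge0 => jc _; rewrite mulr_ge0// exprn_ge0.
have mH : measurable_fun setT H by exact: (measurable_weighted (fun jc => s jc.1)).
have EH : (\int[P]_x (H x)%:E <= (al ^+ 2)%:E)%E.
  apply: le_trans (block_ratio_moment (b := 2) gW (fun jc => s0 jc.1) _ _) _ => //.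
  rewrite lee_fin gmom2 mul1r; have := sum_weights 1; under eq_bigr do rewrite mulr1.
  move=> ->; rewrite mulr1 exprMn (sqr_sqrtr (ltW r0)) /= (gmom_sub2 p2) subn1.
  have gn : @gmom R (p - 2) != 0 by rewrite gt_eqF ?gmom_gt0.
  rewrite le_eqVlt; apply/orP; left; apply/eqP; rewrite /r.
  by field; rewrite gn gt_eqF.
have alH x : al = 0 -> H x = 0.
  move/eqP; rewrite mulf_eq0 sqrtr_eq0 leNgt r0 orbF => /eqP t0.
  apply: big1 => jc _; have : \sum_j s j == 0 by rewrite -tauE t0 expr0n.
  by rewrite psumr_eq0// => /allP/(_ jc.1 (mem_index_enum _))/eqP ->; rewrite mul0r.
have [mN PN] := gaussian_det_gram_usubmx0 gW.
have split_half (x y z : R) : x + (z / y + y) / 2 = (x + y / 2) + (2 * y)^-1 * z.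
  by rewrite invfM; ring.
pose g x := tau + (H x / al + al) / 2.
have g0 x : 0 <= g x by rewrite addr_ge0 ?divr_ge0 ?addr_ge0 ?divr_ge0.
have mg : measurable_fun setT g.
  apply: measurable_funD => //; apply: measurable_funM => //.
  by apply: measurable_funD => //; apply: measurable_funM.
apply: (@le_trans _ _ (\int[P]_x (g x)%:E)%E).
  rewrite unlock; apply: ae_ge0_le_integral => //=.
  - by move=> x _; rewrite lee_fin.
  - exact/measurable_EFinP.
  - by move=> x _; rewrite lee_fin.
  - exact/measurable_EFinP.
  (* The pointwise bound may fail where the upper block loses rank, a null set. *)
  - exists [set x | \det (gram (usubmx (W x))) = 0]; split => // x /=.
    move/not_implyP => [_]; apply: contra_notP => /eqP dW.
    rewrite lee_fin; apply: (@sqrt_sum_le _ _ (H x) _ _ _ _ (alH x)) => //.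
    by rewrite -HE; exact: errP.
under eq_integral => x _.
  rewrite (_ : g x = (tau + al / 2) + (2 * al)^-1 * H x); last by rewrite /g split_half.
  rewrite EFinD; over.
rewrite ge0_integralD//=; first last.
- by apply/measurable_EFinP; apply: measurable_funM.
- by move=> x _; rewrite lee_fin mulr_ge0// invr_ge0 mulr_ge0.
- by move=> x _; rewrite lee_fin addr_ge0// divr_ge0.
rewrite integral_cst//= probability_setT mule1.
under eq_integral do rewrite EFinM.
rewrite ge0_integralZl//; first last.
- by rewrite lee_fin invr_ge0 mulr_ge0.
- by move=> x _; rewrite lee_fin.
- exact/measurable_EFinP.
apply: (@le_trans _ _ ((tau + al / 2)%:E + (2 * al)^-1%:E * (al ^+ 2)%:E)%E).
  by rewrite leeD2l// lee_wpmul2l// lee_fin invr_ge0 mulr_ge0.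
rewrite -EFinM -EFinD lee_fin le_eqVlt; apply/orP; left; apply/eqP.
rewrite [RHS](_ : _ = tau + al); last by rewrite /al; ring.
rewrite invfM -addrA; congr (_ + _).
have [->|an] := eqVneq al 0; first by rewrite expr0n mulr0 mul0r addr0.
by field.
Qed.

Lemma col_proj_error_tail (u t : R) : (4 <= p)%N -> 1 <= u -> 1 <= t ->
  ((1 - expR (- (u ^+ 2 / 2)) - t ^- p)%:E <=
    P [set x | (err x <= (1 + Num.sqrt 3 * u * t * Num.sqrt (k%:R / p.+1%:R)) * tau)%R])%E.
Proof.
move=> p4 u1 t1.
have k0 : 0 < k%:R :> R by rewrite ltr0n.
have u0 : 0 < u by apply: lt_le_trans u1.
have t0 : 0 < t by apply: lt_le_trans t1.
have N0 : 0 < p.+1%:R :> R by rewrite ltr0n.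
pose Y := Num.sqrt 3 * u * t * Num.sqrt (p.+1%:R^-1).
have Y0 : 0 < Y by rewrite !mulr_gt0// sqrtr_gt0 ?invr_gt0.
have Y2 : Y ^+ 2 = 3 * u ^+ 2 * t ^+ 2 / p.+1%:R.
  by rewrite /Y !exprMn !sqr_sqrtr ?invr_ge0 ?ltW.
have -> : Num.sqrt 3 * u * t * Num.sqrt (k%:R / p.+1%:R) = Y * Num.sqrt k%:R.
  by rewrite sqrtrM ?ltW// /Y; ring.
have u21 : 1 <= u ^+ 2 by rewrite exprn_ege1.
have [b [b2 bp hb]] := exists_tail_moment p4 u21 t1 (ltW Y0) Y2.
set dl := _ + _ in hb; set K := _ * tau.
have K0 : 0 <= K by rewrite mulr_ge0// addr_ge0// mulr_ge0// ltW.
have [mN PN] := gaussian_det_gram_usubmx0 gW.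
(* Normalized to sum 1 for the power mean. If [tau = 0] every weight is 0, hence the weaker bound
   [wle1] for the moment estimate. *)
pose w (jc : 'I_q * 'I_k) : R := s jc.1 * (k%:R * tau ^+ 2)^-1.
have w0 jc : 0 <= w jc by rewrite mulr_ge0// invr_ge0 mulr_ge0 ?sqr_ge0// ltW.
pose J x := \sum_jc w jc * `|block_ratio (W x) jc.1 jc.2| ^+ b.
have mJ : measurable_fun setT J by exact: measurable_weighted.
have J0 x : 0 <= J x by apply: sumr_ge0 => jc _; rewrite mulr_ge0// exprn_ge0.
have w1 : tau != 0 -> \sum_jc w jc = 1.
  by move=> tn; rewrite sum_weights divff// mulf_neq0 ?sqrf_eq0// gt_eqF.
have wle1 : \sum_jc w jc <= 1.
  have [t00|/w1 ->//] := eqVneq tau 0.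
  by rewrite sum_weights t00 expr0n mulr0 mul0r.
have EJ : (\int[P]_x (J x)%:E <= (Y ^+ b * dl)%:E)%E.
  apply: le_trans (block_ratio_moment gW w0 (ltnW b2) _) _; first by rewrite ltnS.
  rewrite lee_fin /=; apply: (@le_trans _ _ (1 * (Y ^+ b * dl))); last by rewrite mul1r.
  apply: ler_pM => //; first exact: sumr_ge0.
    by rewrite divr_ge0 ?mulr_ge0// ltW// gmom_gt0.
  by rewrite ler_pdivrMr ?gmom_gt0// mulrC [X in _ <= X]mulrC mulrC.
set N := [set x | _ = 0] in mN PN.
pose B := [set x | Y ^+ b <= J x].
have mB : measurable B.
  rewrite (_ : B = setT `&` J @^-1` `[Y ^+ b, +oo[); first exact: mJ.
  by rewrite setTI; apply/seteqP; split => x; rewrite /B/= in_itv/= andbT.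
(* Markov's inequality, from [Y ^+ b] times the indicator of [B] being at most [J]. *)
have PB : (P B <= dl%:E)%E.
  have Yb0 : 0 < Y ^+ b by rewrite exprn_gt0.
  rewrite -(@lee_pmul2l _ (Y ^+ b)%:E)// -EFinM; apply: le_trans EJ.
  rewrite -integral_indicT// -ge0_integralZl//; first last.
  - by rewrite lee_fin ltW.
  - by apply/measurable_EFinP; exact: measurable_indic.
  apply: ge0_le_integral => //.
  - by move=> x _; rewrite -EFinM lee_fin mulr_ge0// ltW.
  - by apply: measurable_funeM; apply/measurable_EFinP; exact: measurable_indic.
  - exact/measurable_EFinP.
  move=> x _; rewrite -EFinM lee_fin indicE; case: (boolP (x \in B)).
    by rewrite mulr1 inE.
  by rewrite mulr0.
set E := [set x | _].
have mE : measurable E.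
  rewrite (_ : E = setT `&` err @^-1` `]-oo, K]); first exact: merr.
  by rewrite setTI; apply/seteqP; split => x; rewrite /E/= in_itv.
have sub : ~` E `<=` N `|` B.
  move=> x /= /negP; rewrite -ltNge => Ke.
  have [dW|dW] := eqVneq (\det (gram (usubmx (W x)))) 0; first by left.
  right; have e2 := errP dW.
  have Ke2 : K ^+ 2 < err x ^+ 2 by rewrite ltrXn2r// ?nnegrE.
  set H := \sum_j _ in e2.
  have H0 : 0 <= H.
    by apply: sumr_ge0 => j _; rewrite mulr_ge0//; apply: sumr_ge0 => c _; exact: sqr_ge0.
  have YkH : Y ^+ 2 * (k%:R * tau ^+ 2) < H.
    rewrite -{1}(sqr_sqrtr (ltW k0)).
    exact: (sqr_scale_lt (ltW Y0) (sqrtr_ge0 _) (lt_le_trans Ke2 e2)).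
  have tn : tau != 0.
    apply/eqP => t00; move: YkH; rewrite t00 expr0n !mulr0 /H big1 ?ltxx// => j _.
    have : \sum_j s j == 0 by rewrite -tauE t00 expr0n.
    by rewrite psumr_eq0// => /allP/(_ j (mem_index_enum _))/eqP ->; rewrite mul0r.
  have kt0 : 0 < k%:R * tau ^+ 2 by rewrite mulr_gt0// exprn_even_gt0.
  (* The weighted quadratic mean of the ratios; an error above [K] forces it above [Y], and then the
     power mean puts the point in [B]. *)
  pose z := Num.sqrt (H / (k%:R * tau ^+ 2)).
  have z2 : z ^+ 2 = H / (k%:R * tau ^+ 2) by rewrite sqr_sqrtr// divr_ge0// ltW.
  have Yz : Y <= z.
    by rewrite -(@ler_pXn2r _ 2) ?nnegrE ?(ltW Y0) ?sqrtr_ge0// z2 ler_pdivlMr// (ltW YkH).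
  apply: (@le_trans _ _ (z ^+ b)); first by apply: lerXn2r; rewrite ?nnegrE ?(ltW Y0) ?sqrtr_ge0.
  apply: power_mean_le (w1 tn) _ => //; first exact: sqrtr_ge0.
  rewrite z2 /H sum_pairs mulr_suml; apply: eq_bigr => jc _.
  by rewrite real_normK ?num_real// /w mulrAC.
have PE : (P (~` E) <= dl%:E)%E.
  apply: le_trans (le_measure P _ _ sub) _; rewrite ?inE; first exact: measurableC.
    exact: measurableU.
  by apply: le_trans (measureU2 P mN mB) _; rewrite -[dl%:E]add0e leeD// [leLHS]PN.
have -> : 1 - expR (- (u ^+ 2 / 2)) - t ^- p = 1 - dl by rewrite /dl opprD addrA.
rewrite -[E]setCK probability_setC; last exact: measurableC.
by rewrite EFinB leeB.
Qed.

End Bounds.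

(** * Application to [V^T *m G] and the tail singular values *)

Theorem corollary4p1 (R : realType) (d : measure_display)
    (T : measurableType d) (P : probability T R) (m n k l : nat)
    (A : 'M[R]_(m, n)) (U : 'M[R]_m) (Sigma : 'M[R]_(m, n)) (V : 'M[R]_n)
    (G : T -> 'M[R]_(n, l)) (hk : (1 <= k)%N) (hsvd : is_svd A U Sigma V)
    (hG : std_gaussian_mx P G) (hl : (l <= \rank A)%N) :
  let err := fun w : T =>
    frobenius_norm ((1%:M - col_proj (A *m G w)) *m A) in
  let tail := frobenius_norm (trailing_block k Sigma) in
  ((k + 2 <= l)%N ->
     ('E_P[err] <=
        ((1 + Num.sqrt (k%:R / (l - k - 1)%:R)) * tail)%:E)%E) /\
  ((k + 4 <= l)%N ->
     forall u t : R, 1 <= u -> 1 <= t ->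
     ((1 - expR (- (u ^+ 2 / 2)) - t ^- (l - k))%:E <=
        P [set w | (err w <=
             (1 + Num.sqrt 3 * u * t * Num.sqrt (k%:R / (l - k + 1)%:R))
               * tail)%R])%E).
Proof.
have [kl|kl] := ltnP l (k + 2); first by move=> err tail; split => h; exfalso; lia.
move=> err tail.
(* Here [k <= l], and [l] is at most the rank of [A], itself at most [n]; this makes the split of
   the rows of [V^T *m G] possible. *)
have kn : (k <= n)%N by move: (rank_leq_col A); lia.
have [a kE] : exists a, k = (1 + a)%N by exists k.-1; lia.
(* With [k = 1 + a] this makes [p = l - k], so the dimension [l - k + 1] of the inverse moments is
   [p.+1]. *)
have [p lE] : exists p, l = (a + p.+1)%N by exists (l - k)%N; lia.
have [q nE] : exists q, n = (k + q)%N by exists (n - k)%N; lia.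
clear hk hl kn; subst k l n.
have gW : is_gaussian P (fun x => V^T *m G x).
  apply: is_gaussian_mull (std_gaussian_mx_is_gaussian hG).
  by apply: orthogonal_mx_tr; case: hsvd.
have mG : measurable_fun setT G by case: (std_gaussian_mx_is_gaussian hG).
pose s (j : 'I_q) := \sum_i rsubmx Sigma i j ^+ 2.
have s0 j : 0 <= s j by apply: sumr_ge0 => i _; exact: sqr_ge0.
have tau0 : 0 <= tail by exact: frobenius_norm_ge0.
have tauE : tail ^+ 2 = \sum_j s j.
  by rewrite frobenius_norm_trailing_block//; case: hsvd.
have merr : measurable_fun setT err.
  by apply: measurable_col_proj_error; apply: measurable_mulmx.
have err0 x : 0 <= err x by exact: frobenius_norm_ge0.
have errP x := @col_proj_error_svd _ _ _ _ _ A U Sigma V (G x) hsvd.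
have -> : (a + p.+1 - (1 + a) = p)%N by lia.
split=> [_|pk u t u1 t1].
  by rewrite subn1; apply: expectation_col_proj_error_le gW s0 tau0 tauE merr err0 errP _; lia.
rewrite (addn1 p).
have p4 : (4 <= p)%N by lia.
exact: (col_proj_error_tail gW s0 tau0 tauE merr errP p4 u1 t1).
Qed.
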